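(* Consider the online allocation model and the policy $\mathrm{SPM}$ of the context. Let $\mathcal R_0\Subset\mathcal R\subset\mathbb R_+^d$ be compact ($\mathcal R_0$ contained in the interior of $\mathcal R$), and suppose that capacity-local active regularity with admissible exponent $\mathfrak p_{\mathcal R}\ge1$ and local fluid non-degeneracy with binding balance (both defined in the context) hold on $\mathcal R$. Suppose that $\rho_0:=b_T/T\in\mathrm{int}(\mathcal R_0)$. Then there is a constant $C<\infty$, depending on the local data (the model, $\mathcal R_0$, $\mathcal R$, the constants in the two local assumptions, and the margin of $\rho_0$ inside $\mathcal R_0$) but not on $T$, such that $$\mathrm{Reg}_T(\mathrm{SPM};b_T)\le C\begin{cases}(\log(eT))^2,&\mathfrak p_{\mathcal R}=1,\\[1mm] T^{1/2-1/(2\mathfrak p_{\mathcal R})}(\log(eT))^{(\mathfrak p_{\mathcal R}+1)/(2\mathfrak p_{\mathcal R})+1},&\mathfrak p_{\mathcal R}>1.\end{cases}$$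
   Context: **Model.** There are $d$ resources and $K$ request types. Type $k$ has a fixed direction $a^k\in\mathbb R_+^d$, $a^k\ne 0$; every resource $j$ has $a^k_j>0$ for some $k$. $A$ is the $d\times K$ matrix with columns $a^k$. Requests $Z_t=(J_t,\beta_t,V_t)$, $t=1,\dots,T$, are i.i.d. copies of $(J,\beta,V)$ with $\mathbb P(J=k)=\pi_k>0$. Conditional on $J=k$, the size satisfies $\beta\in[\underline\beta_k,\overline\beta_k]$ with $\underline\beta_k>0$, and the reward satisfies $V\in[0,\overline v]$. In each period the decision maker observes $Z_t$ and irrevocably chooses $x_t\in\{0,1\}$ (using only past and current information), subject to $\sum_t\beta_ta^{J_t}x_t\le b_T$ componentwise, where $b_T\in\mathbb R_+^d$. For $W_n=(Z_1,\dots,Z_n)$ and $b\in\mathbb R_+^d$ let $$\mathrm{OPT}_n(b;W_n)=\max_{0\le x_i\le1}\Big\{\sum_{i=1}^nV_ix_i:\ \sum_{i=1}^n\beta_ia^{J_i}x_i\le b\Big\},\qquad \Phi_n(b)=\mathbb E[\mathrm{OPT}_n(b;W_n)],\quad\Phi_0\equiv0.$$ The regret is $\mathrm{Reg}_T(\mathrm{ALG};b_T)=\mathbb E[\mathrm{OPT}_T(b_T;W_T)]-\mathbb E[\sum_{t=1}^TV_tx_t^{\mathrm{ALG}}]$. The policy $\mathrm{SPM}$: with $s$ periods remaining (including the current one), remaining capacity $b$ and current arrival $(J,\beta,V)=(k,z,v)$, accept if and only if $za^k\le b$ and $v\ge\Phi_{s-1}(b)-\Phi_{s-1}(b-za^k)$.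 **Ratio measures.** $R=V/\beta$. Put $\underline\beta=\min_k\underline\beta_k$, $\alpha_j=\min\{a^k_j:a^k_j>0\}$, $M_j=\overline v/(\underline\beta\alpha_j)$, $y=\max_k\sum_jM_ja^k_j$; then $R\in[0,y]$. For Borel $B\subseteq[0,y]$: $\mu_k(B)=\pi_k\mathbb E[\beta\mathbf 1\{R\in B\}\mid J=k]$, $\Lambda_{k,z}(B)=z\,\mathbb P(R\in B\mid J=k,\beta=z)$; $P_k^\beta$ is the law of $\beta$ given $J=k$. The support $S_k=\mathrm{supp}\,\mu_k=[r_k^-,r_k^+]\subseteq[0,y]$ is a compact interval for each $k$; $\Pi_k(q)=\min\{r_k^+,\max\{r_k^-,q\}\}$ and $\Pi(q)=(\Pi_1(q_1),\dots,\Pi_K(q_K))$. Put $C_k(r)=\mu_k([r,\infty))$, $C_k(r+)=\mu_k((r,\infty))$, $m_k^0=C_k(0)$, $m^0=(m^0_1,\dots,m^0_K)$. For $m\in\mathbb R_+^K$, $\rho\in\mathbb R_+^d$: $K_m(\rho)=\{u\in\mathbb R_+^K:0\le u\le m,\ Au\le\rho\}$. For convex $K$ and $x\in K$: $N_K(x)=\{z:z^\top(v-x)\le0\ \forall v\in K\}$. **Capacity-local active tube.** For compact $\mathcal R\subset\mathbb R_+^d$ and $\eta>0$, $\mathcal A_k(\mathcal R,\eta)$ is the set of values $\Pi_k(q_k)$ for which there exist $m\in\mathbb R_+^K$, $\rho\in\mathbb R_+^d$, $u\in\mathbb R_+^K$, $q\in[0,y]^K$ with $\|m-m^0\|_\infty\le\eta$,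 $\mathrm{dist}_\infty(\rho,\mathcal R)\le\eta$, $u\in K_m(\rho)$, $\Pi(q)\in N_{K_m(\rho)}(u)$, and $C_j(q_j+)-\eta\le u_j\le C_j(q_j)+\eta$ for $j=1,\dots,K$. Put $\mathcal J_k(\mathcal R,\eta)=\overline{\mathrm{conv}\,\mathcal A_k(\mathcal R,\eta)}\cap S_k$. **Capacity-local active regularity** on $\mathcal R$ with admissible exponent $\mathfrak p_{\mathcal R}\ge1$: there exist $\eta_{\mathcal R}>0$, relatively open sets $U_k\subseteq S_k$ with $\mathcal J_k(\mathcal R,\eta_{\mathcal R})\subseteq U_k$ for every $k$, and constants $0<c\le C<\infty$ such that for every $k$ and every interval $I\subseteq[0,y]$ with $I\cap S_k\subseteq U_k$, $c\,\ell_k(I)^{\mathfrak p_{\mathcal R}}\le\mu_k(I)\le C\,\ell_k(I)$, where $\ell_k(I)=\mathrm{Leb}(I\cap S_k)$. The $U_k$ are the local active neighborhoods. **Local fluid non-degeneracy and binding balance** on $\mathcal R$ (with the same $U_k$): the sets $U_k$ are separated from the endpoints of $S_k$ (the tube is interior), and (a) for every $\rho\in\mathcal R$ there is a pair $(q^\rho,u^\rho)$ with $\Pi_k(q_k^\rho)\in U_k$ and $C_k(q_k^\rho+)\le u_k^\rho\le C_k(q_k^\rho)$ for all $k$, $u^\rho\in K_{m^0}(\rho)$, $\Pi(q^\rho)\in N_{K_{m^0}(\rho)}(u^\rho)$, and $Au^\rho=\rho$; (b) (dominated tube) for each $k$ there is $C_{\rm dom}<\infty$ such that for $P_k^\beta$-a.e.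 $z$, $\Lambda_{k,z}(I)\le C_{\rm dom}\mu_k(I)$ for every interval $I\subseteq[0,y]$ with $I\cap S_k\subseteq U_k$. *)

(* Defs.v *)
From HB Require Import structures.
From mathcomp Require Import all_boot all_order all_algebra.
From mathcomp Require Import all_classical all_reals all_analysis.
Set Implicit Arguments.
Unset Strict Implicit.
Unset Printing Implicit Defensive.
Import Order.TTheory GRing.Theory Num.Theory.
Import numFieldNormedType.Exports.
Local Open Scope classical_set_scope.
Local Open Scope ring_scope.

(* The set of request types is 'I_K.+1: there is at least one type, and a
   measurable type is required to be inhabited. It carries the discrete
   sigma-algebra. *)
HB.instance Definition _ (n : nat) := isPointed.Build 'I_n.+1 ord0.
HB.instance Definition _ (n : nat) :=
  @isMeasurable.Build default_measure_display 'I_n.+1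
    discrete_measurable discrete_measurable0
    discrete_measurableC discrete_measurableU.

(* A request (J, beta, V): type, size, reward. *)
Notation request R K := ('I_K.+1 * R * R)%type.

Section request_coordinates.
Variables (R : realType) (K : nat).

Definition rtype (z : request R K) : 'I_K.+1 := z.1.1.
Definition rsize (z : request R K) : R := z.1.2.
Definition reward (z : request R K) : R := z.2.

(* R = V / beta *)
Definition ratio (z : request R K) : R := reward z / rsize z.

Lemma measurable_rtype_eq (k : 'I_K.+1) : measurable [set z | rtype z = k].
Proof.
have mt : measurable_fun [set: request R K] rtype.
  by apply: measurableT_comp => //; exact: measurable_fst.
by rewrite -[X in measurable X]setTI; exact: (mt measurableT [set k]).
Qed.

Lemma measurable_rsize : measurable_fun [set: request R K] rsize.
Proof. by apply: measurableT_comp => //; exact: measurable_snd. Qed.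

HB.instance Definition _ :=
  isMeasurableFun.Build _ _ _ _ rsize measurable_rsize.

End request_coordinates.

Section vectors.
Variable R : realType.

Definition nonneg_vec n (u : 'cV[R]_n) : Prop := forall i, 0 <= u i 0.
Definition le_vec n (u v : 'cV[R]_n) : Prop := forall i, u i 0 <= v i 0.

Definition normal_cone n (S : set 'cV[R]_n) (x : 'cV[R]_n) : set 'cV[R]_n :=
  [set z | forall v, S v -> \sum_i z i 0 * (v i 0 - x i 0) <= 0].

(* Support of a Borel measure on the line, given by its (finite) values. *)
Definition msupport (m : set R -> R) : set R :=
  [set r | forall e : R, 0 < e -> 0 < m (ball r e)].

End vectors.

(* [law] is the joint law of (J, beta, V). *)
Record model (R : realType) (d K : nat) := Model {
  direction : 'M[R]_(d, K.+1);
  law : probability (request R K) R;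
  size_lo : 'I_K.+1 -> R;
  size_hi : 'I_K.+1 -> R;
  reward_hi : R }.

Section model_data.
Variables (R : realType) (d K : nat) (M : model R d K).
Local Notation A := (direction M).

Definition type_prob (k : 'I_K.+1) : R := fine (law M [set z | rtype z = k]).

(* P( . | J = k): the law restricted to {J = k}, renormalized. The second
   argument of [mnormalize] is its value when pi_k = 0, a case excluded by
   [valid_model]. *)
Definition cond_law (k : 'I_K.+1) : probability (request R K) R :=
  mnormalize (mrestr (law M) (measurable_rtype_eq k)) (law M).

(* P_k^beta *)
Definition size_law (k : 'I_K.+1) : probability R R :=
  distribution (cond_law k) (@rsize R K).

(* mu_k(B) = pi_k E[beta 1{R in B} | J = k] *)
Definition mu_ratio (k : 'I_K.+1) (B : set R) : R :=
  type_prob k * fine 'E_(cond_law k)[fun z => rsize z * \1_B (ratio z)].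

(* [kap k z] is the law of R given J = k and beta = z: [kap] is a regular
   version of this conditional law. *)
Definition is_cond_ratio_law (kap : 'I_K.+1 -> R.-pker R ~> R) : Prop :=
  forall k (B D : set R), measurable B -> measurable D ->
    (\int[size_law k]_(z in B) kap k z D =
     cond_law k [set w | B (rsize w) /\ D (ratio w)])%E.

(* Lambda_{k,z}(B) = z P(R in B | J = k, beta = z) *)
Definition Lambda (kap : 'I_K.+1 -> R.-pker R ~> R) (k : 'I_K.+1) (z : R)
  (B : set R) : R := z * fine (kap k z B).

(* Here [inf] and [sup] are the minimum and maximum of finite nonempty sets. *)
Definition size_min : R := inf (range (size_lo M)).
Definition alpha_min (j : 'I_d) : R :=
  inf [set A j k | k in [set k | 0 < A j k]].
Definition Mcst (j : 'I_d) : R := reward_hi M / (size_min * alpha_min j).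
Definition ymax : R := sup (range (fun k => \sum_j Mcst j * A j k)).

Definition ratio_supp (k : 'I_K.+1) : set R := msupport (mu_ratio k).
(* S_k = [rlo k, rhi k] by [valid_model]. *)
Definition rlo (k : 'I_K.+1) : R := inf (ratio_supp k).
Definition rhi (k : 'I_K.+1) : R := sup (ratio_supp k).

Definition valid_model : Prop :=
  [/\ [/\ forall j k, 0 <= A j k,
          forall k, exists j, 0 < A j k
        & forall j, exists k, 0 < A j k],
      forall k, 0 < type_prob k,
      forall k, 0 < size_lo M k,
      {ae law M, forall z,
         size_lo M (rtype z) <= rsize z <= size_hi M (rtype z) /\
         0 <= reward z <= reward_hi M}
    & (* the support of each mu_k is a compact interval inside [0, y] *)
      forall k, ratio_supp k = [set r | rlo k <= r <= rhi k] /\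
                0 <= rlo k <= rhi k /\ rhi k <= ymax].

(* Pi_k and Pi *)
Definition clip (k : 'I_K.+1) (q : R) : R :=
  Num.min (rhi k) (Num.max (rlo k) q).
Definition clip_vec (q : 'cV[R]_K.+1) : 'cV[R]_K.+1 :=
  \col_k clip k (q k 0).

(* C_k(r), C_k(r+) and m^0 *)
Definition tail_mass (k : 'I_K.+1) (r : R) : R := mu_ratio k [set x | r <= x].
Definition tail_strict (k : 'I_K.+1) (r : R) : R := mu_ratio k [set x | r < x].
Definition m0 : 'cV[R]_K.+1 := \col_k tail_mass k 0.

(* K_m(rho) *)
Definition fluid_set (m : 'cV[R]_K.+1) (rho : 'cV[R]_d) : set 'cV[R]_K.+1 :=
  [set u | [/\ nonneg_vec u, le_vec u m & le_vec (A *m u) rho]].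

(* A_k(Rs, eta). Norms and distances of matrices are the sup-norm ones. *)
Definition active_set (Rs : set 'cV[R]_d) (eta : R) (k : 'I_K.+1) : set R :=
  [set r | exists (m : 'cV[R]_K.+1) (rho : 'cV[R]_d) (u q : 'cV[R]_K.+1),
    [/\ [/\ nonneg_vec m, nonneg_vec rho, nonneg_vec u
          & forall j, 0 <= q j 0 <= ymax],
        `|m - m0| <= eta /\ (edist_inf Rs rho <= eta%:E)%E,
        fluid_set m rho u /\ normal_cone (fluid_set m rho) u (clip_vec q),
        forall j,
          tail_strict j (q j 0) - eta <= u j 0 <= tail_mass j (q j 0) + eta
      & r = clip k (q k 0)]].

(* J_k(Rs, eta). In dimension one the convex hull is the interval hull
   [Rhull]. *)
Definition active_tube (Rs : set 'cV[R]_d) (eta : R) (k : 'I_K.+1) : set R :=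
  closure [set` Rhull (active_set Rs eta k)] `&` ratio_supp k.

(* l_k(I) = Leb(I cap S_k) *)
Definition ell (k : 'I_K.+1) (I : set R) : R :=
  fine (lebesgue_measure (I `&` ratio_supp k)).

(* Intervals I of [0, y] with I cap S_k inside U. *)
Definition local_interval (U : set R) (k : 'I_K.+1) (I : interval R) : Prop :=
  [set` I] `<=` [set r | 0 <= r <= ymax] /\ [set` I] `&` ratio_supp k `<=` U.

(* Capacity-local active regularity with exponent [p] and witnesses
   [eta], [U], [c], [C]. *)
Definition active_regular (Rs : set 'cV[R]_d) (p eta : R)
    (U : 'I_K.+1 -> set R) (c C : R) : Prop :=
  [/\ 1 <= p,
      0 < eta,
      forall k, exists O : set R, open O /\ U k = O `&` ratio_supp k,
      forall k, active_tube Rs eta k `<=` U k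
    & 0 < c <= C /\
      forall k (I : interval R), local_interval (U k) k I ->
        c * ell k [set` I] `^ p <= mu_ratio k [set` I] <= C * ell k [set` I]].

(* Local fluid non-degeneracy and binding balance, with neighborhoods [U]. *)
Definition fluid_nondegenerate (Rs : set 'cV[R]_d) (U : 'I_K.+1 -> set R)
    (kap : 'I_K.+1 -> R.-pker R ~> R) : Prop :=
  [/\ forall k, exists2 e : R, 0 < e &
        forall r, U k r -> rlo k + e <= r <= rhi k - e,
      forall rho, Rs rho -> exists q u : 'cV[R]_K.+1,
        [/\ forall k, U k (clip k (q k 0)),
            forall k, tail_strict k (q k 0) <= u k 0 <= tail_mass k (q k 0),
            fluid_set m0 rho u,
            normal_cone (fluid_set m0 rho) u (clip_vec q)
          & A *m u = rho]
    & forall k, exists Cdom : R,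
        {ae size_law k, forall z, forall I : interval R,
          local_interval (U k) k I ->
          Lambda kap k z [set` I] <= Cdom * mu_ratio k [set` I]}].

(* OPT_n(b; w_0, ..., w_(n-1)): value of the fractional linear program. *)
Definition OPT (n : nat) (b : 'cV[R]_d) (w : nat -> request R K) : R :=
  sup [set v | exists x : 'I_n -> R,
    [/\ forall i, 0 <= x i <= 1,
        forall j, \sum_(i < n) rsize (w i) * A j (rtype (w i)) * x i <= b j 0
      & v = \sum_(i < n) reward (w i) * x i]].

Definition consumption (z : request R K) : 'cV[R]_d :=
  rsize z *: col (rtype z) A.

(* The acceptance rule of SPM, relative to value functions [Phi]: [s] periods
   remain including the current one, [b] is the remaining capacity. *)
Definition spm_accept (Phi : nat -> 'cV[R]_d -> R) (s : nat) (b : 'cV[R]_d)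
    (z : request R K) : bool :=
  [forall j, consumption z j 0 <= b j 0] &&
  (Phi s.-1 b - Phi s.-1 (b - consumption z) <= reward z).

(* Capacity remaining after the first [t] of [T] periods under SPM. *)
Fixpoint spm_capacity (Phi : nat -> 'cV[R]_d -> R) (T : nat) (b : 'cV[R]_d)
    (w : nat -> request R K) (t : nat) : 'cV[R]_d :=
  if t is t'.+1 then
    let b' := spm_capacity Phi T b w t' in
    if spm_accept Phi (T - t') b' (w t') then b' - consumption (w t') else b'
  else b.

(* Decision of SPM in period [t], counted from 0. *)
Definition spm_decision (Phi : nat -> 'cV[R]_d -> R) (T : nat) (b : 'cV[R]_d)
    (w : nat -> request R K) (t : nat) : bool :=
  spm_accept Phi (T - t) (spm_capacity Phi T b w t) (w t).

End model_data.

Section random_arrivals.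
Variables (R : realType) (d K : nat) (M : model R d K).
Variables (disp : measure_display) (Omega : measurableType disp).
Variable P : probability Omega R.
Variable Z : nat -> {RV P >-> request R K}.

(* Z_0, ..., Z_(T-1) are i.i.d. copies of (J, beta, V). Independence of
   subfamilies is the case where some of the [B t] are the full space. *)
Definition iid_requests (T : nat) : Prop :=
  (forall t B, (t < T)%N -> measurable B -> distribution P (Z t) B = law M B) /\
  (forall B : 'I_T -> set (request R K), (forall t, measurable (B t)) ->
    (P (\bigcap_t (Z (t : 'I_T) @^-1` B t)) =
     \prod_(t < T) P (Z t @^-1` B t))%E).

(* Phi_n(b) = E[OPT_n(b; Z_0, ..., Z_(n-1))] *)
Definition Phi (n : nat) (b : 'cV[R]_d) : R :=
  fine 'E_P[fun w => OPT M n b (fun t => Z t w)].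

Definition regret (T : nat) (b : 'cV[R]_d) (x : nat -> Omega -> bool) : R :=
  fine 'E_P[fun w => OPT M T b (fun t => Z t w)] -
  fine 'E_P[fun w => \sum_(t < T) reward (Z t w) * (x t w)%:R].

Definition SPM (T : nat) (b : 'cV[R]_d) : nat -> Omega -> bool :=
  fun t w => spm_decision M Phi T b (fun i => Z i w) t.

End random_arrivals.

Definition regret_rate (R : realType) (p : R) (T : nat) : R :=
  let L := ln (expR 1 * T%:R) in
  if p == 1 then L ^+ 2
  else T%:R `^ (1 / 2 - 1 / (2 * p)) * L `^ ((p + 1) / (2 * p) + 1).

(* Main.v *)
Require Import Defs.
From mathcomp Require Import all_boot all_order all_algebra.
From mathcomp Require Import all_classical all_reals all_analysis.
From mathcomp Require Import measurable_realfun ring lra.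
Set Implicit Arguments.
Unset Strict Implicit.
Unset Printing Implicit Defensive.
Import Order.TTheory GRing.Theory Num.Theory.
Import numFieldNormedType.Exports.
Local Open Scope classical_set_scope.
Local Open Scope ring_scope.

(* Let n + 1 periods remain with capacity (n + 1) rho, and let (q, u) be the fluid
   pair at rho. Complementary slackness, paired with the fluid identities
   u_k = C_k(q_k) and A u = rho, bounds x mu_k([q_k, q_k + x)) for the distance x
   between q_k and the dual price of a sample program by x times a sampling error
   eps, whose second moment is O(1/n) because it only involves intervals with
   geometrically decreasing masses. Together with c x^p <= mu_k([q_k, q_k + x))
   this gives x = O(eps^(1/p)), so accepting when the ratio is at least q_k loses
   at most O(eps^(1 + 1/p)) = O(n^(-1/2 - 1/(2p))) in the period. SPM is one-step
   optimal, hence loses no more, and its expected consumption is within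
   O(n^(-1/(2p))) of rho. The remaining capacity ratio is therefore almost a
   martingale; a quadratic potential around rho_0, with a flat part that widens to
   absorb the drift, controls the loss on leaving R0 in a backward induction on
   the number of periods. The regret is at most a multiple of the sum of
   n^(-1/2 - 1/(2p)), which is O(T^(1/2 - 1/(2p)) log T). *)

(** A wrong decision needs a ratio between [q_k] and the sample price, and it costs at most the size
    times the distance of the two. For a fixed sample of future requests the mean loss is thus a gap
    times the mass of this gap, the very quantity that complementary slackness bounds: hence the
    exponent 1 + 1/p of [eps] instead of 2/p. The constants must not depend on rho. All fluid prices
    lie in the active tube, whose closed hull is inside the open [U_k], so one distance [e1] around
    [q_k] serves every rho. A right inverse of A, which exists because A u = rho is solvable for all
    rho in a ball, translates between prices of resources and prices of types. Outside a box around
    rho_0 the only bound on the loss is one maximal reward per remaining period. The potential is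
    therefore multiplied by the number of remaining periods: outside the box the product exceeds
    that bound. The mean growth of the potential is O(1/n^2), and the weight makes it O(1/n), no
    more than the loss of the period. *)

(* [ratio] would otherwise denote a type of mathcomp's fraction library. *)
Local Notation ratio := Defs.ratio.

(** * Bounded measurable functions and their expectations *)

(* Not [b%:R], which would parse the order relations of [b] in nat_scope. *)
Definition ind (R : realType) (b : bool) : R := if b then 1 else 0.
Arguments ind {R} b%_R.

(** Boundedness holds at every point and not only almost surely. Under a probability measure it
    settles every integrability condition, and it passes to sections and partial integrals. *)
Definition bmeas (R : realType) d (T : measurableType d) (f : T -> R) :=
  measurable_fun setT f /\ exists M : R, forall x, `|f x| <= M.

Section bmeas_closure.
Context (R : realType) d (T : measurableType d).
Implicit Types f g : T -> R.

Lemma bmeas_cst (a : R) : bmeas (fun _ : T => a).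
Proof. by split; [exact: measurable_cst|exists `|a|]. Qed.

Lemma bmeasD f g : bmeas f -> bmeas g -> bmeas (fun x => f x + g x).
Proof.
move=> [mf [Mf bf]] [mg [Mg bg]]; split; first exact: measurable_funD.
exists (Mf + Mg) => x; apply: (le_trans (ler_normD _ _)).
by apply: lerD.
Qed.

Lemma bmeasN f : bmeas f -> bmeas (fun x => - f x).
Proof.
move=> [mf [Mf bf]]; split; first exact: measurable_funN.
by exists Mf => x; rewrite normrN.
Qed.

Lemma bmeasB f g : bmeas f -> bmeas g -> bmeas (fun x => f x - g x).
Proof. by move=> mf mg; apply: bmeasD => //; apply: bmeasN. Qed.

Lemma bmeasM f g : bmeas f -> bmeas g -> bmeas (fun x => f x * g x).
Proof.
move=> [mf [Mf bf]] [mg [Mg bg]]; split; first exact: measurable_funM.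
by exists (Mf * Mg) => x; rewrite normrM; apply: ler_pM.
Qed.

Lemma bmeasX f n : bmeas f -> bmeas (fun x => f x ^+ n).
Proof.
move=> mf; elim: n => [|n IH]; first exact: bmeas_cst.
under eq_fun do rewrite exprS.
exact: bmeasM.
Qed.

Lemma bmeas_sum (I : Type) (s : seq I) (F : I -> T -> R) :
  (forall i, bmeas (F i)) -> bmeas (fun x => \sum_(i <- s) F i x).
Proof.
move=> mF; elim: s => [|i s IH].
  by under eq_fun do rewrite big_nil; exact: bmeas_cst.
by under eq_fun do rewrite big_cons; exact: bmeasD.
Qed.

Lemma bmeas_bool (b : T -> bool) : measurable_fun setT b ->
  bmeas (fun x => (b x)%:R : R).
Proof.
move=> mb; split; last first.
  by exists 1 => x; case: (b x); rewrite ?normr1 ?normr0.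
rewrite [X in measurable_fun _ X](_ : _ = fun x => if b x then 1 else 0); last first.
  by apply/funext => x; case: (b x).
by apply: measurable_fun_ifT.
Qed.

Lemma bmeas_comp d' (T' : measurableType d') (h : T' -> T) f :
  measurable_fun setT h -> bmeas f -> bmeas (f \o h).
Proof.
move=> mh [mf [M bf]]; split; first exact: measurableT_comp.
by exists M => x /=.
Qed.

End bmeas_closure.

Section expectation.
Context (R : realType) d (T : measurableType d) (P : probability T R).
Implicit Types f g : T -> R.

Lemma prob_setT_lty : (P setT < +oo)%E.
Proof. by rewrite (probability_setT P) ltry. Qed.

Lemma bmeas_integrable f : bmeas f -> P.-integrable setT (EFin \o f).
Proof.
move=> [mf [M bf]]; apply: measurable_bounded_integrable => //.
  by rewrite prob_setT_lty.
exists M; split; first by rewrite num_real.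
by move=> y My x _ /=; exact: le_trans (bf x) (ltW My).
Qed.

Lemma expect_cst (a : R) : \int[P]_x a = a.
Proof. by rewrite /Rintegral integral_cst//= probability_setT mule1. Qed.

Lemma expect_D f g : bmeas f -> bmeas g ->
  \int[P]_x (f x + g x) = \int[P]_x f x + \int[P]_x g x.
Proof. by move=> mf mg; rewrite RintegralD//; exact: bmeas_integrable. Qed.

Lemma expect_B f g : bmeas f -> bmeas g ->
  \int[P]_x (f x - g x) = \int[P]_x f x - \int[P]_x g x.
Proof. by move=> mf mg; rewrite RintegralB//; exact: bmeas_integrable. Qed.

Lemma expect_Z (a : R) f : bmeas f -> \int[P]_x (a * f x) = a * \int[P]_x f x.
Proof. by move=> mf; rewrite RintegralZl//; exact: bmeas_integrable. Qed.

Lemma expect_le f g : bmeas f -> bmeas g -> (forall x, f x <= g x) ->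
  \int[P]_x f x <= \int[P]_x g x.
Proof. by move=> mf mg fg; apply: le_Rintegral => //; exact: bmeas_integrable. Qed.

Lemma expect_le_cst f a : bmeas f -> (forall x, f x <= a) -> \int[P]_x f x <= a.
Proof. by move=> mf fa; rewrite -[leRHS]expect_cst; apply: expect_le => //; exact: bmeas_cst. Qed.

Lemma expect_ge_cst f a : bmeas f -> (forall x, a <= f x) -> a <= \int[P]_x f x.
Proof. by move=> mf fa; rewrite -[leLHS]expect_cst; apply: expect_le => //; exact: bmeas_cst. Qed.

Lemma expect_sum (I : Type) (s : seq I) (F : I -> T -> R) :
  (forall i, bmeas (F i)) ->
  \int[P]_x (\sum_(i <- s) F i x) = \sum_(i <- s) \int[P]_x (F i x).
Proof.
move=> mF; elim: s => [|i s IH].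
  by under eq_Rintegral do rewrite big_nil; rewrite big_nil expect_cst.
under eq_Rintegral do rewrite big_cons.
by rewrite big_cons expect_D ?IH//; exact: bmeas_sum.
Qed.

Lemma expect_norm_le f M : bmeas f -> (forall x, `|f x| <= M) ->
  `|\int[P]_x f x| <= M.
Proof.
move=> mf fM; rewrite ler_norml expect_le_cst ?andbT//; last first.
  by move=> x; exact: le_trans (ler_norm _) (fM x).
by apply: expect_ge_cst => // x; have := fM x; rewrite ler_norml => /andP[].
Qed.

Lemma expect_distribution d' (T' : measurableType d') (h : {RV P >-> T'})
  (f : T' -> R) : bmeas f ->
  \int[distribution P h]_y f y = \int[P]_x f (h x).
Proof.
move=> mf; rewrite /Rintegral integral_distribution//.
- by apply/measurable_EFinP; case: mf.
- by apply: (bmeas_integrable (f := f \o h)); exact: bmeas_comp.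
Qed.

End expectation.

Section fubini.
Context (R : realType) d1 d2 (T1 : measurableType d1) (T2 : measurableType d2).
Context (P1 : probability T1 R) (P2 : probability T2 R).
Implicit Types f : T1 * T2 -> R.

Lemma bmeas_pair1 f x : bmeas f -> bmeas (fun y => f (x, y)).
Proof.
move=> [mf [M bf]]; split; last by exists M.
exact: measurableT_comp mf (pair1_measurable x).
Qed.

Lemma bmeas_pair2 f y : bmeas f -> bmeas (fun x => f (x, y)).
Proof.
move=> [mf [M bf]]; split; last by exists M.
exact: measurableT_comp mf (pair2_measurable y).
Qed.

Lemma bmeas_fubini1 f : bmeas f -> bmeas (fun x => \int[P2]_y f (x, y)).
Proof.
move=> mf; have [mf1 [M bf]] := mf; split; last first.
  exists M => x; apply: expect_norm_le => //; exact: bmeas_pair1.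
(* Adding the bound [M] makes the integrand nonnegative, as Tonelli's theorem requires. *)
rewrite [X in measurable_fun _ X](_ : _ =
   (fun x => (fine (\int[P2]_y ((f (x, y)) + M)%:E)) - M)); last first.
  apply/funext => x.
  rewrite [X in _ = X - _](@expect_D _ _ _ P2 (fun y => f (x, y)) (fun=> M)).
  - by rewrite expect_cst addrK.
  - exact: bmeas_pair1.
  - exact: bmeas_cst.
apply: measurable_funB; last exact: measurable_cst.
apply: measurableT_comp; first exact: fine_measurable.
apply: (@measurable_fun_fubini_tonelli_F _ _ _ _ _ P2 (fun z => (f z + M)%:E)).
- by apply/measurable_EFinP; apply: measurable_funD.
- by move=> z; rewrite lee_fin; have := bf z; rewrite ler_norml => /andP[+ _]; lra.
Qed.

Lemma expect_prod f : bmeas f ->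
  \int[(P1 \x P2)%E]_z f z = \int[P1]_x \int[P2]_y f (x, y).
Proof.
move=> mf; have mf1 := bmeas_fubini1 mf.
have i12 : (P1 \x P2)%E.-integrable setT (EFin \o f).
  case: mf => [m [M bf]]; apply: measurable_bounded_integrable => //.
    exact: (prob_setT_lty (P1 \x P2)%E).
  exists M; split; first by rewrite num_real.
  by move=> y My x _ /=; exact: le_trans (bf x) (ltW My).
rewrite {1}/Rintegral -(integral12_prod_meas1 i12) /Rintegral.
congr fine; apply: eq_integral => x _ /=.
rewrite -[LHS]fineK//.
apply: integrable_fin_num => //.
exact: (bmeas_integrable P2 (bmeas_pair1 x mf)).
Qed.

End fubini.

(** * Independent requests *)

Definition scons (X : Type) (z : X) (w : nat -> X) : nat -> X :=
  fun i => if i is j.+1 then w j else z.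

Lemma measurable_forall_ord d (T : measurableType d) n (E : 'I_n -> set T) :
  (forall i, measurable (E i)) -> measurable [set t | forall i, E i t].
Proof.
move=> mE.
have -> : [set t | forall i, E i t] = \big[setI/setT]_(i <- index_enum 'I_n) E i.
  rewrite -bigcap_seq; apply/seteqP; split => [t tE i _|t tE i]; first exact: tE.
  by apply: tE => /=; rewrite mem_index_enum.
by apply: (big_ind measurable) => //; exact: measurableI.
Qed.

Section tuple_rectangles.
Context (R : realType) d (X : measurableType d) (n : nat).

Definition rect (B : 'I_n -> set X) : set (n.-tuple X) :=
  [set t | forall i, B i (tnth t i)].

Lemma measurable_rect (B : 'I_n -> set X) :
  (forall i, measurable (B i)) -> measurable (rect B).
Proof.
move=> mB; apply: (@measurable_forall_ord _ _ _ (fun i => (@tnth n X ^~ i) @^-1` B i)).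
by move=> i; rewrite -[X in measurable X]setTI; exact: measurable_tnth.
Qed.

(** Rectangles are stable under intersection, contain the full space and generate the sigma-algebra
    of tuples: the preimage of a set under one coordinate is a rectangle with full sides
    elsewhere. *)
Lemma tuple_measure_unique (m1 m2 : probability (n.-tuple X) R) :
  (forall B, (forall i, measurable (B i)) -> m1 (rect B) = m2 (rect B)) ->
  forall A, measurable A -> m1 A = m2 A.
Proof.
move=> m12 A mA.
pose G : set (set (n.-tuple X)) :=
  [set A | exists2 B, (forall i, measurable (B i)) & A = rect B].
apply: (measure_unique G (fun=> setT)) => //.
- apply/seteqP; split.
    apply: smallest_sub; first exact: smallest_sigma_algebra.
    rewrite -bigcup_seq; apply: bigcup_sub => i _ Y [B mB <-].
    apply: sub_sigma_algebra.
    exists (fun j => if j == i then B else setT).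
      by move=> j; case: eqP.
    rewrite setTI; apply/seteqP; split => [t tB j|t /(_ i)] /=.
      by case: eqP => // ->.
    by rewrite eqxx.
  apply: smallest_sub; first exact: sigma_algebra_measurable.
  by move=> _ [B mB ->]; exact: measurable_rect.
- move=> _ _ [B mB ->] [B' mB' ->]; exists (fun i => B i `&` B' i).
    by move=> i; exact: measurableI.
  by apply/seteqP; split => [t [tB tB'] i|t tB]; [split|split => i; case: (tB i)].
- by move=> _; exists (fun=> setT) => //; apply/seteqP; split.
- by rewrite bigcup_const//; exists 0%N.
- by move=> _ [B mB ->]; exact: m12.
- by move=> _; exact: prob_setT_lty.
Qed.

End tuple_rectangles.

Definition mkRV (R : realType) d d' (T : measurableType d) (T' : measurableType d')
  (P : probability T R) (h : T -> T') (mh : measurable_fun setT h) : {RV P >-> T'} :=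
  MeasurableFun.Pack (MeasurableFun.Class (isMeasurableFun.Build _ _ _ _ _ mh)).

(* Measurability of a functional of sequences in [V], tested along measurable
   families of sequences: no sigma-algebra on sequences is needed. *)
Definition cmeas (R : realType) d (X : measurableType d) (V : set X)
    (F : (nat -> X) -> R) :=
  forall dY (Y : measurableType dY) (zeta : nat -> Y -> X),
    (forall i, measurable_fun setT (zeta i)) -> (forall i y, V (zeta i y)) ->
    measurable_fun setT (fun y => F (fun i => zeta i y)).

Section shift.
Context (R : realType) dO (Omega : measurableType dO) (P : probability Omega R).
Context d (X : measurableType d) (nu : set X -> \bar R) (Z : nat -> {RV P >-> X}).
Variable T : nat.
Hypothesis Zlaw : forall t B, (t < T)%N -> measurable B -> P (Z t @^-1` B) = nu B.
Hypothesis Zind : forall B : 'I_T -> set X, (forall t, measurable (B t)) ->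
    (P (\bigcap_t (Z (t : 'I_T) @^-1` B t)) = \prod_(t < T) P (Z t @^-1` B t))%E.
Variable V : set X.
Hypothesis ZV : forall t w, V (Z t w).
Variable san : X -> X.
Hypotheses (msan : measurable_fun setT san) (sanV : forall x, V (san x))
  (sanid : forall x, V x -> san x = x).

Lemma iid_prefix n (B : nat -> set X) : (n <= T)%N ->
  (forall i, measurable (B i)) ->
  (P [set w | forall i : 'I_n, B i (Z i w)] = \prod_(i < n) nu (B i))%E.
Proof.
(* Requests from [n] on are left unconstrained; their factors in the product are 1. *)
move=> nT mB; pose B' (t : 'I_T) := if (t < n)%N then B t else setT.
have mB' t : measurable (B' t) by rewrite /B'; case: ifP.
have -> : [set w | forall i : 'I_n, B i (Z i w)] = \bigcap_t (Z (t : 'I_T) @^-1` B' t).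
  apply/seteqP; split => [w wB t _|w wB i] /=.
    by rewrite /B' /=; case: ifPn => // tn; exact: (wB (Ordinal tn)).
  have := wB (widen_ord nT i) Logic.I.
  by rewrite /B' /= ltn_ord.
rewrite Zind// (eq_bigr (fun t : 'I_T => if (t < n)%N then nu (B t) else 1%E)); last first.
  move=> t _; rewrite /B'; case: ifP => tn; first by rewrite Zlaw.
  by rewrite preimage_setT probability_setT.
rewrite -big_mkcond/= (big_ord_narrow nT).
by apply: eq_bigr.
Qed.

Lemma measurable_prefix n B : (forall i, measurable (B i)) ->
  measurable [set w | forall i : 'I_n, B i (Z i w)].
Proof.
move=> mB; apply: measurable_forall_ord => i.
by rewrite -[X in measurable X]setTI; exact: (measurable_funP (Z i)).
Qed.

Lemma measurable_scons (i : nat) : measurable_fun setT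
  (fun x : Omega * Omega => scons (Z 0%N x.1) (fun j => Z j x.2) i).
Proof. by case: i => [|i] /=; apply: measurableT_comp. Qed.

(** Conditioning on the first request. The later requests are replaced by an independent copy
    indexed from 0 again, so that the inner integral is an expectation of the same kind with one
    period less. It holds because the two sequences have the same law on their first [n.+1] entries,
    the only ones that [F] reads. *)
Lemma expect_shift n (F : (nat -> X) -> R) (M : R) : (n < T)%N -> cmeas V F ->
  (forall w w', (forall i, (i < n.+1)%N -> w i = w' i) -> F w = F w') ->
  (forall w, (forall i, V (w i)) -> `|F w| <= M) ->
  \int[P]_w F (fun i => Z i w) =
  \int[P]_w \int[P]_w' F (scons (Z 0%N w) (fun i => Z i w')).
Proof.
move=> nT mF locF bF.
(* A tuple may contain invalid entries and ends after [n.+1] of them; padding by [point] and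
   applying [san] yields a sequence in [V], on which [F] is measurable and bounded. *)
pose sq (t : n.+1.-tuple X) (i : nat) := san (nth point t i).
have msq i : measurable_fun setT (fun t : n.+1.-tuple X => sq t i).
  apply: measurableT_comp => //.
  have [ni|ni] := leqP n.+1 i.
    rewrite (_ : (fun t => _) = fun=> point); first exact: measurable_cst.
    by apply/funext => t; rewrite nth_default// size_tuple.
  rewrite (_ : (fun t => _) = fun t => tnth t (Ordinal ni)); first exact: measurable_tnth.
  by apply/funext => t; rewrite (tnth_nth point).
pose F' (t : n.+1.-tuple X) := F (sq t).
have bF' : bmeas F'.
  split; first by apply: mF => // i y; exact: sanV.
  by exists M => t; apply: bF => i; exact: sanV.
have F'E (w : nat -> X) : (forall i, V (w i)) -> F' [tuple w i | i < n.+1] = F w.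
  move=> wV; apply: locF => i ni; rewrite /sq.
  by rewrite -(tnth_nth point [tuple w i | i < n.+1] (Ordinal ni)) tnth_mktuple sanid.
pose h w := [tuple Z i w | i < n.+1].
have mh : measurable_fun setT h.
  apply/measurable_fun_tnthP => i; rewrite (_ : _ \o _ = Z i)//.
  by apply/funext => w; rewrite /= tnth_mktuple.
pose h2 (x : Omega * Omega) := [tuple scons (Z 0%N x.1) (fun j => Z j x.2) i | i < n.+1].
have mh2 : measurable_fun setT h2.
  apply/measurable_fun_tnthP => i.
  rewrite (_ : _ \o _ = fun x : Omega * Omega => scons (Z 0%N x.1) (fun j => Z j x.2) i).
    exact: measurable_scons.
  by apply/funext => w; rewrite /= tnth_mktuple.
pose H := mkRV P mh; pose H2 := mkRV (P \x P)%E mh2.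
have dE A : measurable A -> distribution P H A = distribution (P \x P)%E H2 A.
  apply: tuple_measure_unique => B mB.
  pose B' (i : nat) := if insub i is Some j then B j else setT.
  have mB' i : measurable (B' i) by rewrite /B'; case: insubP.
  have BB' (i : 'I_n.+1) : B i = B' i by rewrite /B' valK.
  have e1 : distribution P H (rect B) = (\prod_(i < n.+1) nu (B' i))%E.
    rewrite -(iid_prefix (B := B'))//.
    congr (P _); apply/seteqP; split => w /= wB i.
      by rewrite -BB'; have := wB i; rewrite tnth_mktuple.
    by rewrite tnth_mktuple BB'; exact: wB.
  have e2 : distribution (P \x P)%E H2 (rect B) = (\prod_(i < n.+1) nu (B' i))%E.
    transitivity ((P \x P)%E ((Z 0%N @^-1` B' 0%N) `*`
       [set w | forall i : 'I_n, B' i.+1 (Z i w)])).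
      congr ((P \x P)%E _); apply/seteqP; split=> [x xB|x [xB0 xB] i].
        split => /=; first by have := xB ord0; rewrite tnth_mktuple BB'.
        by move=> i; have := xB (lift ord0 i); rewrite tnth_mktuple BB'.
      rewrite tnth_mktuple BB' /= /scons; case: i => -[|i] //= lti.
      exact: (xB (Ordinal (lti : (i < n)%N))).
    rewrite product_measure1E//; last 2 first.
    - by rewrite -[X in measurable X]setTI; exact: (measurable_funP (Z 0%N)).
    - exact: (@measurable_prefix n (fun i => B' i.+1)).
    rewrite big_ord_recl/= Zlaw//; last exact: leq_trans nT.
    congr (_ * _)%E.
    by rewrite (iid_prefix (B := fun i => B' i.+1))//; exact: ltnW.
  exact: etrans e1 (esym e2).
transitivity (\int[distribution P H]_t F' t).
  rewrite expect_distribution//; apply: eq_Rintegral => w _ /=.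
  by symmetry; apply: (F'E (fun i => Z i w)).
transitivity (\int[distribution (P \x P)%E H2]_t F' t).
  rewrite /Rintegral; congr fine; apply: eq_measure_integral => A mA _; exact: dE.
rewrite (expect_distribution H2)//= expect_prod; last exact: (bmeas_comp mh2 bF').
apply: eq_Rintegral => w _; apply: eq_Rintegral => w' _.
apply: (F'E (scons (Z 0%N w) (fun i => Z i w'))) => -[|i] /=; exact: ZV.
Qed.

End shift.

(** * The packing linear program *)

Section OPT_basics.
Context (R : realType) (d K : nat) (M : model R d K).
Local Notation A := (direction M).
Local Notation X := (request R K).
Implicit Types (b : 'cV[R]_d) (w : nat -> X) (z : X).
Variables (bl bh vh : R).
Hypotheses (bl0 : 0 < bl) (A0 : forall j k, 0 <= A j k) (blh : bl <= bh) (vh0 : 0 <= vh).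

Definition valid_req : set X :=
  [set z | bl <= rsize z <= bh /\ 0 <= reward z <= vh].

Definition feas n b w (x : 'I_n -> R) :=
  (forall i, 0 <= x i <= 1) /\
  forall j, \sum_(i < n) rsize (w i) * A j (rtype (w i)) * x i <= b j 0.

Definition obj n w (x : 'I_n -> R) := \sum_(i < n) reward (w i) * x i.

Lemma consE z j : consumption M z j 0 = rsize z * A j (rtype z).
Proof. by rewrite /consumption !mxE. Qed.

Lemma valid_req_size z : valid_req z -> 0 < rsize z.
Proof. by move=> [/andP[h _] _]; exact: lt_le_trans bl0 h. Qed.

Lemma cons_ge0 z j : valid_req z -> 0 <= consumption M z j 0.
Proof. by move=> vz; rewrite consE mulr_ge0// ltW// valid_req_size. Qed.

Lemma obj_ge0 n w (x : 'I_n -> R) : (forall i, valid_req (w i)) ->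
  (forall i, 0 <= x i <= 1) -> 0 <= obj w x.
Proof.
move=> vw x01; apply: sumr_ge0 => i _; apply: mulr_ge0.
  by case: (vw i) => _ /andP[].
by case/andP: (x01 i).
Qed.

Lemma obj_le n w (x : 'I_n -> R) : (forall i, valid_req (w i)) ->
  (forall i, 0 <= x i <= 1) -> obj w x <= n%:R * vh.
Proof.
move=> vw x01; rewrite -[n in leRHS]card_ord mulr_natl -sumr_const.
apply: ler_sum => i _; case: (vw i) => _ /andP[v0 v1]; case/andP: (x01 i) => x0 x1.
by rewrite -[leRHS]mulr1; apply: ler_pM.
Qed.

Lemma OPT_ub n b w : (forall i, valid_req (w i)) ->
  has_ubound [set v | exists x : 'I_n -> R,
    [/\ forall i, 0 <= x i <= 1,
        forall j, \sum_(i < n) rsize (w i) * A j (rtype (w i)) * x i <= b j 0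
      & v = \sum_(i < n) reward (w i) * x i]].
Proof. by move=> vw; exists (n%:R * vh) => _ [x [x01 _ ->]]; exact: obj_le. Qed.

Lemma obj_le_OPT n b w (x : 'I_n -> R) : (forall i, valid_req (w i)) ->
  feas b w x -> obj w x <= OPT M n b w.
Proof. by move=> vw [x01 xb]; apply: ub_le_sup; [exact: OPT_ub|exists x]. Qed.

Lemma feas0 n b w : nonneg_vec b -> feas b w (fun _ : 'I_n => 0).
Proof.
move=> b0; split=> [i|j]; first by rewrite lexx ler01.
by rewrite big1 ?b0// => i _; rewrite mulr0.
Qed.

Lemma OPT_le n b w c : nonneg_vec b ->
  (forall x : 'I_n -> R, feas b w x -> obj w x <= c) -> OPT M n b w <= c.
Proof.
move=> b0 xc; apply: ge_sup; last by move=> _ [x [x01 xb ->]]; exact: xc.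
have [x01 xb] := @feas0 n b w b0.
by exists (obj w (fun _ : 'I_n => 0)); exists (fun=> 0).
Qed.

Lemma OPT_ge0 n b w : (forall i, valid_req (w i)) -> 0 <= OPT M n b w.
Proof.
move=> vw; have [/asboolP[x fx]|/asboolPn nx] := boolP `[< exists x : 'I_n -> R, feas b w x >].
  apply: le_trans (obj_le_OPT vw fx); apply: obj_ge0 => //; exact: fx.1.
(* Without a feasible vector the set of values is empty and its [sup] is 0. *)
rewrite /OPT (_ : [set v | _] = set0) ?sup0//.
by apply/seteqP; split => // v [x [x1 x2 _]]; apply: nx; exists x.
Qed.

Lemma OPT_leM n b w : (forall i, valid_req (w i)) -> OPT M n b w <= n%:R * vh.
Proof.
move=> vw; have [/asboolP[x fx]|/asboolPn nx] := boolP `[< exists x : 'I_n -> R, feas b w x >].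
  apply: ge_sup; last by move=> _ [y [y01 yb ->]]; exact: obj_le.
  by exists (obj w x); exists x; split; [exact: fx.1|exact: fx.2|].
rewrite /OPT (_ : [set v | _] = set0) ?sup0; first by rewrite mulr_ge0.
by apply/seteqP; split => // v [x [x1 x2 _]]; apply: nx; exists x.
Qed.

Lemma OPT_loc n b w w' : (forall i, (i < n)%N -> w i = w' i) ->
  OPT M n b w = OPT M n b w'.
Proof.
move=> ww'; rewrite /OPT; congr sup; apply/seteqP; split => v [x [x1 x2 ->]];
  exists x; split => //.
- by move=> j; apply: le_trans (x2 j); apply: ler_sum => i _; rewrite ww'.
- by apply: eq_bigr => i _; rewrite ww'.
- by move=> j; apply: le_trans (x2 j); apply: ler_sum => i _; rewrite ww'.
- by apply: eq_bigr => i _; rewrite ww'.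
Qed.

(** One step of dynamic programming: a feasible vector splits into its first coordinate and a vector
    that is feasible for the capacity left over. *)
Lemma OPT_scons_le n b z w c : nonneg_vec b -> valid_req z ->
  (forall i, valid_req (w i)) ->
  (forall x, 0 <= x <= 1 -> nonneg_vec (b - x *: consumption M z) ->
     reward z * x + OPT M n (b - x *: consumption M z) w <= c) ->
  OPT M n.+1 b (scons z w) <= c.
Proof.
move=> b0 vz vw H; apply: OPT_le => // x [x01 xb].
have tail j : \sum_(i < n) rsize (w i) * A j (rtype (w i)) * x (lift ord0 i) <=
    (b - x ord0 *: consumption M z) j 0.
  have := xb j; rewrite big_ord_recl/= !mxE.
  rewrite [rsize z * _ * _]mulrC [x ord0 * (rsize z * _)]mulrC.
  rewrite [_ * x ord0]mulrC lerBrDl.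
  by move=> h; exact: h.
apply: le_trans (H (x ord0) (x01 ord0) _).
  rewrite /obj big_ord_recl/=; apply: lerD => //.
  by apply: (@obj_le_OPT n _ w (fun i => x (lift ord0 i))).
move=> j; apply: le_trans (tail j); apply: sumr_ge0 => i _.
rewrite !mulr_ge0//; first by rewrite ltW// valid_req_size.
by case/andP: (x01 (lift ord0 i)).
Qed.

Lemma OPT_mono n b b' w : nonneg_vec b -> (forall i, valid_req (w i)) -> le_vec b b' ->
  OPT M n b w <= OPT M n b' w.
Proof.
move=> b0 vw bb'; apply: OPT_le => // x [x1 x2]; apply: obj_le_OPT => //.
by split => // j; exact: le_trans (bb' j).
Qed.

(** If [x] is feasible for [b], then [th * x] is feasible for [b']. This gives the crude bound on
    the value of the capacity of one request. *)
Lemma OPT_scale n b b' w th : nonneg_vec b -> (forall i, valid_req (w i)) ->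
  0 <= th <= 1 -> le_vec (th *: b) b' ->
  th * OPT M n b w <= OPT M n b' w.
Proof.
move=> b0 vw /andP[th0 th1] bb'.
have [->|thn0] := eqVneq th 0; first by rewrite mul0r OPT_ge0.
have thp : 0 < th by rewrite lt_def thn0.
rewrite -ler_pdivlMl//; apply: OPT_le => // x [x1 x2].
rewrite ler_pdivlMl//.
have -> : th * obj w x = obj w (fun i => th * x i).
  by rewrite /obj mulr_sumr; apply: eq_bigr => i _; rewrite mulrCA.
apply: obj_le_OPT => //; split => [i|j].
  by case/andP: (x1 i) => h0 h1; rewrite mulr_ge0// mulr_ile1.
apply: le_trans (bb' j); rewrite !mxE.
rewrite (eq_bigr (fun i : 'I_n => th * (rsize (w i) * A j (rtype (w i)) * x i))).
  by rewrite -mulr_sumr ler_pM2l.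
by move=> i _; rewrite mulrCA.
Qed.

Lemma OPT_scons_crude n b z w : nonneg_vec b -> valid_req z -> (forall i, valid_req (w i)) ->
  OPT M n.+1 b (scons z w) <= vh + OPT M n b w.
Proof.
move=> b0 vz vw; apply: OPT_scons_le => // x /andP[x0 x1] bx.
case: (vz) => _ /andP[v0 v1]; apply: lerD.
  by rewrite -[leRHS]mulr1; apply: ler_pM.
apply: OPT_mono => // j; rewrite mxE gerDl mxE oppr_le0 mxE mulr_ge0//.
exact: cons_ge0.
Qed.

End OPT_basics.

(** * Duality *)

Section lagrange.
Context (R : realType) (n d : nat).
Local Notation vec := ('I_n -> R).
Implicit Types (f h : vec -> R) (S : set vec).

Definition mixv (t : R) (x y : vec) : vec := fun i => t * x i + (1 - t) * y i.

Definition affine_fun f :=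
  forall t x y, f (mixv t x y) = t * f x + (1 - t) * f y.

Definition convex_vec S :=
  forall t x y, 0 <= t <= 1 -> S x -> S y -> S (mixv t x y).

(* The multiplier is a supremum of slopes between feasible and infeasible points;
   the strictly feasible [x0] makes it finite. *)
Lemma lagrange1 S f h (F : R) x0 : convex_vec S -> affine_fun f -> affine_fun h ->
  S x0 -> h x0 < 0 -> (forall x, S x -> h x <= 0 -> f x <= F) ->
  exists2 l, 0 <= l & forall x, S x -> f x - l * h x <= F.
Proof.
move=> cS af ah Sx0 hx0 H.
(* The point of the segment from [x] to [y] at which [h] vanishes is feasible; the bound on [f]
   there compares the two slopes. *)
have key x y : S x -> S y -> 0 < h x -> h y < 0 ->
    (f x - F) / h x <= (F - f y) / (- h y).
  move=> Sx Sy hx hy.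
  have hxy : 0 < h x - h y by lra.
  pose t := (- h y) / (h x - h y).
  have t01 : 0 <= t <= 1.
    by rewrite /t divr_ge0 ?ler_pdivrMr//; lra.
  have := H _ (cS t x y t01 Sx Sy).
  rewrite ah af => /(_ _).
  have -> : t * h x + (1 - t) * h y = 0 by rewrite /t; field; lra.
  rewrite lexx => /(_ isT) Hz.
  rewrite ler_pdivrMr// mulrAC ler_pdivlMr; last lra.
  have : (t * f x + (1 - t) * f y) * (h x - h y) <= F * (h x - h y).
    by rewrite ler_pM2r.
  have -> : (t * f x + (1 - t) * f y) * (h x - h y) = - h y * f x + h x * f y.
    by rewrite /t; field; lra.
  lra.
(* Including 0 makes the set nonempty and the multiplier nonnegative. *)
pose Q : set R := [set l | l = 0 \/ exists x, [/\ S x, 0 < h x & l = (f x - F) / h x]].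
have ubQ y : S y -> h y < 0 -> ubound Q ((F - f y) / (- h y)).
  move=> Sy hy l [->|[x [Sx hx ->]]]; last exact: key.
  by apply: divr_ge0; [rewrite subr_ge0; apply: H => //; exact: ltW|lra].
have hQ : has_sup Q.
  by split; [exists 0; left|exists ((F - f x0) / (- h x0)); exact: ubQ].
exists (sup Q); first by apply: ub_le_sup; [case: hQ|left].
move=> x Sx; have [hx|hx|hx] := ltgtP (h x) 0.
- have : sup Q <= (F - f x) / (- h x) by apply: ge_sup; [case: hQ|exact: ubQ].
  by rewrite ler_pdivlMr; lra.
- have : (f x - F) / h x <= sup Q.
    by apply: ub_le_sup; [case: hQ|right; exists x].
  by rewrite ler_pdivrMr//; lra.
- by rewrite hx mulr0 subr0; apply: H => //; rewrite hx.
Qed.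

(** The constraints are dualized one at a time: while the first one moves into the objective, the
    others restrict the set, which stays convex and still contains [x0]. *)
Lemma lagrange S f (H : 'I_d -> vec -> R) (F : R) x0 (s : seq 'I_d) :
  uniq s -> convex_vec S -> affine_fun f -> (forall j, affine_fun (H j)) ->
  S x0 -> (forall j, H j x0 < 0) ->
  (forall x, S x -> (forall j, j \in s -> H j x <= 0) -> f x <= F) ->
  exists2 l : 'I_d -> R, (forall j, 0 <= l j) &
    forall x, S x -> f x - \sum_(j <- s) l j * H j x <= F.
Proof.
move=> us cS af aH Sx0 Hx0; elim: s f af us => [|j s IH] f af /= us HF.
  exists (fun=> 0) => // x Sx; rewrite big_nil subr0.
  by apply: HF => // j; rewrite in_nil.
case/andP: us => js us.
pose S' : set vec := [set x | S x /\ forall i, i \in s -> H i x <= 0].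
have [||||||l l0 Hl] := @lagrange1 S' f (H j) F x0.
- move=> t x y t01 [Sx hx] [Sy hy]; split; first exact: cS.
  move=> i si; rewrite aH; have := hx i si; have := hy i si.
  case/andP: t01 => t0 t1 hyi hxi.
  have : t * H i x <= 0 by rewrite mulr_ge0_le0.
  have : (1 - t) * H i y <= 0 by rewrite mulr_ge0_le0// subr_ge0.
  lra.
- exact: af.
- exact: aH.
- by split => // i _; exact: ltW.
- exact: Hx0.
- move=> x [Sx hx] hj; apply: HF => // i; rewrite inE => /orP[/eqP->//|]; exact: hx.
have [||l' l'0 Hl'] := IH (fun x => f x - l * H j x) _ us.
- by move=> t x y; rewrite af aH; ring.
- by move=> x Sx hx; apply: Hl; split.
exists (fun i => if i == j then l else l' i) => [i|x Sx]; first by case: eqP.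
rewrite big_cons eqxx opprD addrA.
rewrite [\sum_(i <- s) _](_ : _ = \sum_(i <- s) l' i * H i x); first exact: Hl'.
apply: eq_big_seq => i si; case: eqP => // ij.
by move: js; rewrite -ij si.
Qed.

End lagrange.

Section duality.
Context (R : realType) (d K : nat) (M : model R d K).
Local Notation A := (direction M).
Local Notation X := (request R K).
Implicit Types (b : 'cV[R]_d) (w : nat -> X) (z : X).
Variables (bl bh vh : R).
Hypotheses (bl0 : 0 < bl) (A0 : forall j k, 0 <= A j k) (blh : bl <= bh) (vh0 : 0 <= vh).
Local Notation valid_req := (@valid_req R K bl bh vh).
Local Notation g n b w := (OPT M n b w).

Definition price (l : 'I_d -> R) (k : 'I_K.+1) : R := \sum_j l j * A j k.

(** Optimality of the multiplier, stated by the Lagrangian: its maximum over the unit cube is at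
    most OPT. Together with [weak_dual] this means that [l] solves the dual program. *)
Definition dual_at n b w (l : 'I_d -> R) :=
  (forall j, 0 <= l j) /\
  forall x : 'I_n -> R, (forall i, 0 <= x i <= 1) ->
    \sum_j l j * b j 0 +
    \sum_(i < n) (reward (w i) - rsize (w i) * price l (rtype (w i))) * x i <= g n b w.

Lemma sum_price n w (l : 'I_d -> R) (x : 'I_n -> R) :
  \sum_(i < n) rsize (w i) * price l (rtype (w i)) * x i =
  \sum_j l j * \sum_(i < n) rsize (w i) * A j (rtype (w i)) * x i.
Proof.
under [RHS]eq_bigr do rewrite mulr_sumr.
rewrite exchange_big/=; apply: eq_bigr => i _.
rewrite /price mulr_sumr mulr_suml; apply: eq_bigr => j _.
by ring.
Qed.

(** Since all capacities are positive, [x = 0] is strictly feasible and [lagrange] applies. *)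
Lemma dual_exists n b w : (forall i, valid_req (w i)) -> (forall j, 0 < b j 0) ->
  exists l, dual_at n b w l.
Proof.
move=> vw b0.
pose H j (x : 'I_n -> R) := \sum_(i < n) rsize (w i) * A j (rtype (w i)) * x i - b j 0.
pose S : set ('I_n -> R) := [set x | forall i, 0 <= x i <= 1].
have aff (c : 'I_n -> R) (e : R) : affine_fun (fun x : 'I_n -> R => \sum_i c i * x i - e).
  move=> t x y; rewrite [X in X - _](_ : _ = t * (\sum_i c i * x i) +
    (1 - t) * (\sum_i c i * y i)); first by ring.
  rewrite !mulr_sumr -big_split/=; apply: eq_bigr => i _; rewrite /mixv; ring.
have [|||||||l l0 Hl] := @lagrange R n d S (@obj R K n w) H (g n b w) (fun=> 0)
  (index_enum 'I_d).
- exact: index_enum_uniq.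
- move=> t x y /andP[t0 t1] Sx Sy i; rewrite /mixv.
  case/andP: (Sx i) => x0 x1; case/andP: (Sy i) => y0 y1.
  by apply/andP; split; nra.
- have := aff (fun i : 'I_n => reward (w i)) 0.
  by move=> h t x y; have := h t x y; rewrite !subr0.
- by move=> j; exact: (aff (fun i : 'I_n => rsize (w i) * A j (rtype (w i)))).
- by move=> i; rewrite lexx ler01.
- by move=> j; rewrite /H big1 ?sub0r ?oppr_lt0// => i _; rewrite mulr0.
- move=> x Sx Hx; apply: obj_le_OPT => //; split => // j.
  by have := Hx j (mem_index_enum j); rewrite subr_le0.
exists l; split => // x x01; apply: le_trans (Hl x x01).
rewrite le_eqVlt; apply/orP; left; apply/eqP.
rewrite /obj /H.
have -> : \sum_(i < n) (reward (w i) - rsize (w i) * price l (rtype (w i))) * x i =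
    \sum_(i < n) reward (w i) * x i -
    \sum_j l j * \sum_(i < n) rsize (w i) * A j (rtype (w i)) * x i.
  by rewrite -sum_price -sumrB; apply: eq_bigr => i _; rewrite mulrBl.
have -> : forall u v : 'I_d -> R, \sum_j l j * (u j - v j) =
    \sum_j l j * u j - \sum_j l j * v j.
  by move=> u v; rewrite -sumrB; apply: eq_bigr => j _; rewrite mulrBr.
ring.
Qed.

Lemma weak_dual n b w (l : 'I_d -> R) : nonneg_vec b -> (forall i, valid_req (w i)) ->
  (forall j, 0 <= l j) ->
  g n b w <= \sum_j l j * b j 0 +
    \sum_(i < n) Num.max 0 (reward (w i) - rsize (w i) * price l (rtype (w i))).
Proof.
move=> b0 vw l0; apply: OPT_le => // x [x01 xb].
have h1 : \sum_j l j * \sum_(i < n) rsize (w i) * A j (rtype (w i)) * x i <=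
    \sum_j l j * b j 0 by apply: ler_sum => j _; apply: ler_wpM2l.
have h2 : \sum_(i < n) (reward (w i) - rsize (w i) * price l (rtype (w i))) * x i <=
   \sum_(i < n) Num.max 0 (reward (w i) - rsize (w i) * price l (rtype (w i))).
  apply: ler_sum => i _; case/andP: (x01 i) => x0 x1.
  set e := _ - _; have [e0|e0] := leP 0 e; first by rewrite -[leRHS]mulr1 ler_wpM2l.
  by rewrite mulr_le0_ge0// ltW.
rewrite -sum_price in h1.
have h3 : \sum_(i < n) (reward (w i) - rsize (w i) * price l (rtype (w i))) * x i =
    \sum_(i < n) reward (w i) * x i -
    \sum_(i < n) rsize (w i) * price l (rtype (w i)) * x i.
  by rewrite -sumrB; apply: eq_bigr => i _; rewrite mulrBl.
rewrite /obj; lra.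
Qed.

Lemma dual_le n b w l : dual_at n b w l ->
  \sum_j l j * b j 0 +
    \sum_(i < n) Num.max 0 (reward (w i) - rsize (w i) * price l (rtype (w i)))
  <= g n b w.
Proof.
move=> [l0 H].
apply: le_trans (H (fun i : 'I_n => ind (0 <= reward (w i) - rsize (w i) * price l (rtype (w i)))) _); last first.
  by move=> i; rewrite /ind; case: ifP; rewrite ?lexx ?ler01.
rewrite lerD2l; apply: ler_sum => i _; set e := _ - _.
by rewrite /ind; have [e0|e0] := leP 0 e; rewrite ?mulr1 ?mulr0.
Qed.

(** For fixed [l] the dual objective is affine in the capacity; it is attained at [b] and bounds OPT
    from above at [b']. *)
Lemma supergradient n b b' w l : nonneg_vec b' -> (forall i, valid_req (w i)) ->
  dual_at n b w l -> g n b' w <= g n b w + \sum_j l j * (b' j 0 - b j 0).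
Proof.
move=> b0 vw dl; have := dual_le dl; have := weak_dual n b0 vw dl.1.
have -> : \sum_j l j * (b' j 0 - b j 0) = \sum_j l j * b' j 0 - \sum_j l j * b j 0.
  by rewrite -sumrB; apply: eq_bigr => j _; rewrite mulrBr.
lra.
Qed.

(** A step too small to change the sign of a nonzero [g] moves the positive part exactly linearly;
    at [g = 0] the one-sided derivative depends on the sign of [e]. This is the origin of the two
    tie-breaking rules in [kkt]. *)
Lemma max_small (g e th : R) : 0 < th -> (g != 0 -> th * `|e| < `|g|) ->
  Num.max 0 g - Num.max 0 (g - th * e) =
  th * e * (if e < 0 then ind (0 <= g) else ind (0 < g)).
Proof.
rewrite /ind => th0 H; have [g0|g0|g0] := ltgtP g 0.
- have := H (negbT (lt_eqF g0)); rewrite (ltr0_norm g0) => h.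
  have : th * e <= th * `|e| by rewrite ler_pM2l// ler_norm.
  have : - (th * e) <= th * `|e| by rewrite -mulrN ler_pM2l// -normrN ler_norm.
  move=> h1 h2; rewrite if_same/= mulr0.
  by rewrite max_l ?subrr//; lra.
- have := H (negbT (gt_eqF g0)); rewrite (gtr0_norm g0) => h.
  have : th * e <= th * `|e| by rewrite ler_pM2l// ler_norm.
  move=> h2; rewrite if_same/= mulr1.
  by rewrite max_r; lra.
- rewrite g0 !sub0r; have [e0|e0] := ltP e 0.
    by rewrite mulr1 max_r; [ring|nra].
  by rewrite mulr0 max_l; [ring|nra].
Qed.

(* Obtained from the optimality of [l] along the segment from [l] to [l'], to
   first order at [l]. *)
Lemma kkt n b w l l' : nonneg_vec b -> (forall i, valid_req (w i)) ->
  dual_at n b w l -> (forall j, 0 <= l' j) ->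
  \sum_(i < n) rsize (w i) * (price l' (rtype (w i)) - price l (rtype (w i))) *
    (if price l' (rtype (w i)) < price l (rtype (w i))
     then ind (price l (rtype (w i)) <= ratio (w i))
     else ind (price l (rtype (w i)) < ratio (w i)))
  <= \sum_j (l' j - l j) * b j 0.
Proof.
move=> b0 vw dl l'0.
pose gg (i : 'I_n) := reward (w i) - rsize (w i) * price l (rtype (w i)).
pose ee (i : 'I_n) := rsize (w i) * (price l' (rtype (w i)) - price l (rtype (w i))).
(* With the step [th] below no nonzero reduced reward changes sign. Terms with [gg i = 0] contribute
   0, the value of a division by 0. *)
pose S := \sum_(i < n) (`|ee i| + 1) / `|gg i|.
have S0 : 0 <= S by apply: sumr_ge0 => i _; apply: divr_ge0 => //; apply: addr_ge0.
pose th := (1 + S)^-1.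
have th0 : 0 < th by rewrite invr_gt0; lra.
have th1 : th <= 1 by rewrite invf_le1; lra.
have thS i : gg i != 0 -> th * `|ee i| < `|gg i|.
  move=> gi; rewrite mulrC ltr_pdivrMr; last lra.
  have gp : 0 < `|gg i| by rewrite normr_gt0.
  rewrite -ltr_pdivrMl// mulrC.
  have : (`|ee i| + 1) / `|gg i| <= S.
    rewrite /S (bigD1 i)//= lerDl; apply: sumr_ge0 => j _.
    by apply: divr_ge0 => //; apply: addr_ge0.
  have : `|ee i| / `|gg i| <= (`|ee i| + 1) / `|gg i|.
    by rewrite ler_pM2r ?invr_gt0// lerDl.
  lra.
pose lt j := l j + th * (l' j - l j).
have lt0 j : 0 <= lt j.
  rewrite /lt; have := dl.1 j; have := l'0 j; nra.
have pE k : price lt k = price l k + th * (price l' k - price l k).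
  rewrite /price -sumrB mulr_sumr -big_split/=; apply: eq_bigr => j _.
  by rewrite /lt; ring.
have := weak_dual n b0 vw lt0; have := dual_le dl.
have -> : \sum_j lt j * b j 0 = \sum_j l j * b j 0 + th * \sum_j (l' j - l j) * b j 0.
  rewrite mulr_sumr -big_split/=; apply: eq_bigr => j _; rewrite /lt; ring.
set S1 := \sum_(i < n) Num.max _ _; set S2 := \sum_(i < n) Num.max _ _ => h1 h2.
have : S1 - S2 <= th * \sum_j (l' j - l j) * b j 0 by lra.
rewrite -sumrB (eq_bigr (fun i : 'I_n => th * (ee i * (if ee i < 0 then ind (0 <= gg i) else ind (0 < gg i))))); last first.
  move=> i _; rewrite pE mulrA -max_small//; last exact: thS.
  by congr (_ - Num.max _ _); rewrite /gg /ee; ring.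
rewrite -mulr_sumr ler_pM2l// => h; apply: le_trans h.
rewrite le_eqVlt; apply/orP; left; apply/eqP; apply: eq_bigr => i _.
have si := valid_req_size bl0 (vw i).
congr (_ * _); rewrite /ee pmulr_rlt0// subr_lt0.
have -> : (0 <= gg i) = (price l (rtype (w i)) <= ratio (w i)).
  by rewrite /ratio ler_pdivlMr// subr_ge0 mulrC.
by have -> : (0 < gg i) = (price l (rtype (w i)) < ratio (w i)); rewrite // /ratio ltr_pdivlMr// subr_gt0 mulrC.
Qed.

Lemma price_consE l z (t : R) b : 
  \sum_j l j * ((b - t *: consumption M z) j 0 - b j 0) = - t * (rsize z * price l (rtype z)).
Proof.
rewrite /price !mulr_sumr; apply: eq_bigr => j _.
by rewrite !mxE; ring.
Qed.

(** Concavity of OPT along a column of A: the supergradient inequalities at the two capacities are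
    added. It allows a single price, at a capacity lowered by more than any request of type [k], to
    dominate the prices left by all these requests. *)
Lemma price_mono n b (t : R) k w l l' : nonneg_vec b ->
  nonneg_vec (b - t *: col k A) -> 0 < t -> (forall i, valid_req (w i)) ->
  dual_at n b w l -> dual_at n (b - t *: col k A) w l' -> price l k <= price l' k.
Proof.
move=> b0 b'0 t0 vw dl dl'.
have := supergradient b'0 vw dl; have := supergradient b0 vw dl'.
have -> : \sum_j l j * ((b - t *: col k A) j 0 - b j 0) = - t * price l k.
  by rewrite /price mulr_sumr; apply: eq_bigr => j _; rewrite !mxE; ring.
have -> : \sum_j l' j * (b j 0 - (b - t *: col k A) j 0) = t * price l' k.
  by rewrite /price mulr_sumr; apply: eq_bigr => j _; rewrite !mxE; ring.
by move=> h1 h2; rewrite -(ler_pM2l t0); lra.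
Qed.

(** Accepting a fraction [x] of the request lowers the value of the rest by at least [x] times its
    price at [b], so that rejection forgoes at most the positive part of the reduced reward. *)
Lemma OPT_reject_le n b z w l : nonneg_vec b -> valid_req z -> (forall i, valid_req (w i)) ->
  dual_at n b w l ->
  g n.+1 b (scons z w) <= g n b w + Num.max 0 (reward z - rsize z * price l (rtype z)).
Proof.
move=> b0 vz vw dl; apply: (OPT_scons_le bl0 A0 b0 vz vw) => x /andP[x0 x1] bx.
have := supergradient bx vw dl; rewrite price_consE.
set e := reward z - _ => h.
have : x * e <= Num.max 0 e.
  have [e0|e0] := leP 0 e; first by rewrite -[leRHS]mul1r ler_wpM2r.
  by rewrite mulr_ge0_le0// ltW.
by rewrite /e; lra.
Qed.

(** The counterpart of [OPT_reject_le]. The price is now taken at the capacity left by the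
    acceptance, because the supergradient must be based at the capacity that the decision leads
    to. *)
Lemma OPT_accept_le n b z w l : nonneg_vec b -> nonneg_vec (b - consumption M z) ->
  valid_req z -> (forall i, valid_req (w i)) ->
  dual_at n (b - consumption M z) w l ->
  g n.+1 b (scons z w) <= reward z + g n (b - consumption M z) w +
    Num.max 0 (rsize z * price l (rtype z) - reward z).
Proof.
move=> b0 bz0 vz vw dl; apply: (OPT_scons_le bl0 A0 b0 vz vw) => x /andP[x0 x1] bx.
have := supergradient bx vw dl.
have -> : \sum_j l j * ((b - x *: consumption M z) j 0 - (b - consumption M z) j 0) =
    (1 - x) * (rsize z * price l (rtype z)).
  by rewrite /price !mulr_sumr; apply: eq_bigr => j _; rewrite !mxE; ring.
set e := rsize z * _ => h.
have : (1 - x) * (e - reward z) <= Num.max 0 (e - reward z).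
  have [e0|e0] := leP 0 (e - reward z).
    by rewrite -[leRHS]mul1r ler_wpM2r// gerBl.
  by rewrite mulr_ge0_le0// ?subr_ge0// ltW.
by lra.
Qed.

Lemma OPT_diff_ge n b z w l : nonneg_vec (b - consumption M z) ->
  (forall i, valid_req (w i)) -> dual_at n b w l ->
  rsize z * price l (rtype z) <= g n b w - g n (b - consumption M z) w.
Proof.
move=> bz0 vw dl; have := supergradient bz0 vw dl.
have -> : \sum_j l j * ((b - consumption M z) j 0 - b j 0) = - (rsize z * price l (rtype z)).
  by have := price_consE l z 1 b; rewrite scale1r mulN1r.
by move=> h; lra.
Qed.

Lemma OPT_diff_le n b z w l : nonneg_vec b ->
  (forall i, valid_req (w i)) -> dual_at n (b - consumption M z) w l ->
  g n b w - g n (b - consumption M z) w <= rsize z * price l (rtype z).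
Proof.
move=> b0 vw dl; have := supergradient b0 vw dl.
have -> : \sum_j l j * (b j 0 - (b - consumption M z) j 0) = rsize z * price l (rtype z).
  by rewrite /price !mulr_sumr; apply: eq_bigr => j _; rewrite !mxE; ring.
lra.
Qed.

End duality.

(** * Measurability of the program and of the policy *)

Lemma measurable_forallb d (Y : measurableType d) (n : nat) (f : 'I_n -> Y -> bool) :
  (forall i, measurable_fun setT (f i)) ->
  measurable_fun setT (fun y => [forall i, f i y]).
Proof.
move=> mf; apply: (measurable_fun_bool true); rewrite setTI.
rewrite (_ : _ @^-1` _ = [set y | forall i, (f i @^-1` [set true]) y]); last first.
  by apply/seteqP; split => y /= => [/forallP//|h]; apply/forallP.
apply: measurable_forall_ord => i.
by rewrite -[X in measurable X]setTI; exact: mf.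
Qed.

Lemma measurable_rsum d (Y : measurableType d) (R : realType) (I : Type) (s : seq I)
  (F : I -> Y -> R) : (forall i, measurable_fun setT (F i)) ->
  measurable_fun setT (fun y => \sum_(i <- s) F i y).
Proof.
move=> mF; elim: s => [|i s IH].
  by under eq_fun do rewrite big_nil; exact: measurable_cst.
by under eq_fun do rewrite big_cons; exact: measurable_funD.
Qed.

Section measurability.
Context (R : realType) (d K : nat) (M : model R d K).
Local Notation A := (direction M).
Local Notation X := (request R K).
Variables (bl bh vh : R).
Hypotheses (bl0 : 0 < bl) (A0 : forall j k, 0 <= A j k) (blh : bl <= bh) (vh0 : 0 <= vh).
Local Notation valid_req := (@valid_req R K bl bh vh).

Lemma measurable_rtype_fun (f : 'I_K.+1 -> R) :
  measurable_fun [set: X] (fun z => f (rtype z)).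
Proof.
apply: (@measurableT_comp _ _ _ _ _ _ f); first by [].
by apply: measurableT_comp => //; exact: measurable_fst.
Qed.

Lemma measurable_reward : measurable_fun [set: X] (@reward R K).
Proof. exact: measurable_snd. Qed.

Lemma measurable_cons j : measurable_fun [set: X] (fun z => consumption M z j 0).
Proof.
under eq_fun do rewrite consE.
apply: measurable_funM; first exact: measurable_rsize.
exact: (measurable_rtype_fun (fun k => A j k)).
Qed.

Lemma measurable_ratio : measurable_fun [set: X] (@Defs.ratio R K).
Proof.
apply: measurable_funM; first exact: measurable_reward.
have ms := @measurable_rsize R K.
(* Measurability of the inverse comes from that of [powR], which agrees with the inverse on
   nonnegative bases only; hence the square. *)
rewrite (_ : (fun z => _) = fun z => rsize z * ((rsize z) ^+ 2) `^ (-1)); last first.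
  apply/funext => z; rewrite powR_inv1 ?sqr_ge0//.
  by have [->|z0] := eqVneq (rsize z) 0; [rewrite invr0 mul0r|field].
apply: measurable_funM => //.
have mX : measurable_fun setT (fun z : X => rsize z ^+ 2) by exact: measurable_funX.
exact: (measurableT_comp (@measurable_powR R (-1)) mX).
Qed.

Lemma measurable_type_eq k : measurable_fun [set: X] (fun z => rtype z == k).
Proof.
apply: (measurable_fun_bool true); rewrite setTI.
rewrite (_ : _ @^-1` _ = [set z | rtype z = k]); first exact: measurable_rtype_eq.
by apply/seteqP; split => z /= /eqP.
Qed.

Definition cvmeas dY (Y : measurableType dY) (B : Y -> 'cV[R]_d) :=
  forall j, measurable_fun setT (fun y => B y j 0).

(* A countable set of [0, 1]-valued vectors. Every [x] is approached by such vectors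
   from below, which keeps a packing constraint satisfied; hence OPT is a
   countable supremum. *)
Definition rat_point n (m : nat) (i : 'I_n) : R :=
  if (unpickle m : option {ffun 'I_n -> rat}) is Some t
  then Num.max 0 (Num.min 1 (ratr (t i))) else 0.

Lemma rat_point01 n m (i : 'I_n) : 0 <= rat_point m i <= 1.
Proof.
rewrite /rat_point; case: unpickle => [t|]; last by rewrite lexx ler01.
by rewrite le_max lexx/= ge_max ler01 ge_min lexx.
Qed.

Lemma rat_point_approx n (x : 'I_n -> R) (e : R) : 0 < e -> (forall i, 0 <= x i <= 1) ->
  exists m, forall i, rat_point m i <= x i /\ x i - e <= rat_point m i.
Proof.
move=> e0 x01.
have H i : exists q : rat, 0 <= (ratr q : R) <= 1 /\ (ratr q : R) <= x i /\ x i - e <= (ratr q : R).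
  case/andP: (x01 i) => x0 x1.
  have [xe|xe] := leP (x i) e.
    by exists 0%Q; rewrite rmorph0 lexx ler01; split => //; split => //; lra.
  have : x i - e < x i by lra.
  move=> /rat_in_itvoo[q]; rewrite in_itv /= => /andP[h1 h2].
  by exists q; split; [apply/andP; split; lra|split; exact: ltW].
have /choice[f Hf] := H.
exists (pickle [ffun i => f i]) => i; rewrite /rat_point pickleK ffunE.
have [/andP[h0 h1] [h2 h3]] := Hf i.
by rewrite min_r// max_r.
Qed.

(** Infeasible points receive the value 0, which leaves the supremum unchanged because OPT is
    nonnegative. *)
Definition OPTseq n (b : 'cV[R]_d) (w : nat -> X) (m : nat) : R :=
  if [forall j, \sum_(i < n) rsize (w i) * A j (rtype (w i)) * rat_point m i <= b j 0]
  then \sum_(i < n) reward (w i) * rat_point m i else 0.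

Lemma OPTseq_ub n b w : (forall i, valid_req (w i)) -> has_ubound (range (OPTseq n b w)).
Proof.
move=> vw; exists (n%:R * vh) => _ [m _ <-]; rewrite /OPTseq; case: ifP => _.
  by apply: (obj_le vw) => i; exact: rat_point01.
by rewrite mulr_ge0.
Qed.

Lemma OPT_sups n b w : (forall i, valid_req (w i)) ->
  OPT M n b w = sups (OPTseq n b w) 0.
Proof.
move=> vw.
have -> : sups (OPTseq n b w) 0%N = sup (range (OPTseq n b w)).
  by congr sup; congr image; apply/seteqP; split.
apply/eqP; rewrite eq_le; apply/andP; split; last first.
  apply: ge_sup; first by exists (OPTseq n b w 0%N); exists 0%N.
  move=> _ [m _ <-]; rewrite /OPTseq; case: ifP => [/forallP h|_].
    apply: (obj_le_OPT vw); split => // i; exact: rat_point01.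
  exact: (OPT_ge0 _ _ _ vw).
have [/asboolP[x0 fx0]|/asboolPn nx] := boolP `[< exists x : 'I_n -> R, feas M b w x >]; last first.
  rewrite {1}/OPT (_ : [set v | _] = set0) ?sup0; last first.
    by apply/seteqP; split => // v [x [x1 x2 _]]; apply: nx; exists x.
  apply: le_trans (ub_le_sup (OPTseq_ub n b vw) (ex_intro2 _ _ 0%N Logic.I erefl)).
  rewrite /OPTseq; case: ifP => // _; apply: (obj_ge0 vw) => i; exact: rat_point01.
apply: ge_sup; first by exists (obj w x0); exists x0; split; [exact: fx0.1|exact: fx0.2|].
move=> _ [x [x01 xb ->]].
apply/ler_addgt0Pr => e e0.
(* Lowering every coordinate by at most [e / (n%:R * vh + 1)] costs at most [e] in total; the 1
   keeps the divisor positive. *)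
have n0 : 0 < n%:R * vh + 1 by rewrite ltr_wpDl// mulr_ge0.
have [m Hm] := rat_point_approx (divr_gt0 e0 n0) x01.
have fm : forall j, \sum_(i < n) rsize (w i) * A j (rtype (w i)) * rat_point m i <= b j 0.
  move=> j; apply: le_trans (xb j); apply: ler_sum => i _.
  by apply: ler_wpM2l; [rewrite mulr_ge0// ltW// (valid_req_size bl0 (vw i))|case: (Hm i)].
have := ub_le_sup (OPTseq_ub n b vw) (ex_intro2 _ _ m Logic.I erefl).
rewrite {1}/OPTseq (_ : [forall j, _] = true); last exact/forallP.
set S := sup _ => hS; rewrite -lerBlDr; apply: le_trans hS.
rewrite lerBlDr.
have : \sum_(i < n) reward (w i) * x i <=
   \sum_(i < n) (reward (w i) * rat_point m i + vh * (e / (n%:R * vh + 1))).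
  apply: ler_sum => i _; case: (vw i) => _ /andP[v0 v1].
  have [h1 h2] := Hm i.
  have h3 : x i - rat_point m i <= e / (n%:R * vh + 1) by lra.
  rewrite -lerBlDl -mulrBr; apply: ler_pM => //; lra.
rewrite big_split/= sumr_const card_ord -[_ *+ n]mulr_natl => h; apply: le_trans h _.
rewrite lerD2l !mulrA ler_pdivrMr// [leRHS]mulrC.
by rewrite ler_pM2r//; lra.
Qed.

Lemma measurable_OPT dY (Y : measurableType dY) n (B : Y -> 'cV[R]_d)
  (zeta : nat -> Y -> X) : cvmeas B -> (forall i, measurable_fun setT (zeta i)) ->
  (forall i y, valid_req (zeta i y)) ->
  measurable_fun setT (fun y => OPT M n (B y) (fun i => zeta i y)).
Proof.
move=> mB mz vz.
under eq_fun do rewrite (OPT_sups _ _ (fun i => vz i _)).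
apply: (@measurable_fun_sups _ _ _ _ (fun m y => OPTseq n (B y) (fun i => zeta i y) m)).
  by move=> y _; exact: (OPTseq_ub n (B y) (fun i => vz i y)).
move=> m; rewrite /OPTseq; apply: measurable_fun_ifT; last exact: measurable_cst.
  apply: measurable_forallb => j; apply: measurable_fun_ler => //.
  apply: measurable_rsum => i.
  apply: measurable_funM; last exact: measurable_cst.
  apply: measurable_funM.
    by apply: measurableT_comp; [exact: measurable_rsize|exact: mz].
  exact: (measurableT_comp (measurable_rtype_fun (fun k => A j k)) (mz i)).
apply: measurable_rsum => i; apply: measurable_funM; last exact: measurable_cst.
by apply: measurableT_comp; [exact: measurable_reward|exact: mz].
Qed.

Section spm.
Variable Ph : nat -> 'cV[R]_d -> R.
Hypothesis mPh : forall dY (Y : measurableType dY) n (B : Y -> 'cV[R]_d),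
  cvmeas B -> measurable_fun setT (fun y => Ph n (B y)).

Definition nextcap s b z := if spm_accept M Ph s b z then b - consumption M z else b.

Definition spm_reward s b (w : nat -> X) : R :=
  \sum_(t < s) reward (w t) * (spm_decision M Ph s b w t)%:R.

Lemma spm_capacity_scons s b z w t :
  spm_capacity M Ph s.+1 b (scons z w) t.+1 =
  spm_capacity M Ph s (nextcap s.+1 b z) w t.
Proof. by elim: t => [|t IH] //; rewrite [LHS]/= -/(spm_capacity M Ph s.+1 b (scons z w) t.+1) IH. Qed.

Lemma spm_reward_scons s b z w : spm_reward s.+1 b (scons z w) =
  reward z * (spm_accept M Ph s.+1 b z)%:R + spm_reward s (nextcap s.+1 b z) w.
Proof.
rewrite /spm_reward big_ord_recl/=; congr (_ + _).
apply: eq_bigr => i _; congr (_ * (_ : bool)%:R).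
by rewrite /spm_decision /bump add1n spm_capacity_scons subSS.
Qed.

Lemma nextcap_ge0 s b z : nonneg_vec b -> nonneg_vec (nextcap s b z).
Proof.
rewrite /nextcap; case: ifP => // /andP[/forallP h _] b0 j.
by have := h j; rewrite !mxE subr_ge0.
Qed.

Lemma spm_reward_loc s b w w' : (forall i, (i < s)%N -> w i = w' i) ->
  spm_reward s b w = spm_reward s b w'.
Proof.
move=> ww'; have cap t : (t <= s)%N -> spm_capacity M Ph s b w t = spm_capacity M Ph s b w' t.
  by elim: t => //= t IH ts; rewrite IH ?(ltnW ts)// ww'.
by apply: eq_bigr => i _; rewrite /spm_decision cap ?ww'// ltnW.
Qed.

Lemma spm_reward_ge0 s b w : (forall i, valid_req (w i)) -> 0 <= spm_reward s b w.
Proof.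
move=> vw; apply: sumr_ge0 => i _; apply: mulr_ge0 => //.
by case: (vw i) => _ /andP[].
Qed.

Lemma spm_reward_le s b w : (forall i, valid_req (w i)) -> spm_reward s b w <= s%:R * vh.
Proof.
move=> vw; rewrite -[s in leRHS]card_ord mulr_natl -sumr_const.
apply: ler_sum => i _; case: (vw i) => _ /andP[v0 v1].
by case: spm_decision; rewrite ?mulr1 ?mulr0.
Qed.

Lemma cvmeas_sub_cons dY (Y : measurableType dY) (B : Y -> 'cV[R]_d) (zeta : Y -> X) :
  cvmeas B -> measurable_fun setT zeta -> cvmeas (fun y => B y - consumption M (zeta y)).
Proof.
move=> mB mz j; under eq_fun do rewrite !mxE.
apply: measurable_funB => //.
have := measurableT_comp (measurable_cons j) mz.
by congr (measurable_fun _ _); apply/funext => y /=; rewrite !mxE.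
Qed.

Lemma measurable_accept dY (Y : measurableType dY) s (B : Y -> 'cV[R]_d) (zeta : Y -> X) :
  cvmeas B -> measurable_fun setT zeta ->
  measurable_fun setT (fun y => spm_accept M Ph s (B y) (zeta y)).
Proof.
move=> mB mz; apply: measurable_and.
  apply: measurable_forallb => j; apply: measurable_fun_ler => //.
  exact: (measurableT_comp (measurable_cons j) mz).
apply: measurable_fun_ler; last exact: (measurableT_comp measurable_reward mz).
by apply: measurable_funB; apply: mPh => //; exact: cvmeas_sub_cons.
Qed.

Lemma cvmeas_nextcap dY (Y : measurableType dY) s (B : Y -> 'cV[R]_d) (zeta : Y -> X) :
  cvmeas B -> measurable_fun setT zeta -> cvmeas (fun y => nextcap s (B y) (zeta y)).
Proof.
move=> mB mz j.
rewrite (_ : (fun y => _) = fun y => if spm_accept M Ph s (B y) (zeta y)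
   then (B y - consumption M (zeta y)) j 0 else B y j 0).
  by apply: measurable_fun_ifT => //; [exact: measurable_accept|exact: cvmeas_sub_cons].
by apply/funext => y; rewrite /nextcap; case: ifP.
Qed.

Lemma measurable_spm_reward dY (Y : measurableType dY) s (B : Y -> 'cV[R]_d)
  (zeta : nat -> Y -> X) : cvmeas B -> (forall i, measurable_fun setT (zeta i)) ->
  measurable_fun setT (fun y => spm_reward s (B y) (fun i => zeta i y)).
Proof.
move=> mB mz.
have mcap t : cvmeas (fun y => spm_capacity M Ph s (B y) (fun i => zeta i y) t).
  by elim: t => //= t IH; apply: (@cvmeas_nextcap _ _ (s - t)).
apply: measurable_rsum => i; apply: measurable_funM.
  exact: (measurableT_comp measurable_reward (mz i)).
by case: (bmeas_bool R (measurable_accept (s - i) (mcap i) (mz i))).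
Qed.

End spm.

End measurability.

(** * The loss to go *)

Section values.
Context (R : realType) (d K : nat) (M : model R d K).
Local Notation A := (direction M).
Local Notation X := (request R K).
Variables (bl bh vh : R).
Hypotheses (bl0 : 0 < bl) (A0 : forall j k, 0 <= A j k) (blh : bl <= bh) (vh0 : 0 <= vh).
Local Notation valid_req := (@valid_req R K bl bh vh).
Context dO (Omega : measurableType dO) (P : probability Omega R).
Variables (Z : nat -> {RV P >-> X}) (T : nat).
Hypothesis iidZ : iid_requests M Z T.
Hypothesis ZV : forall t w, valid_req (Z t w).

(* Clamping turns almost surely valid requests into surely valid ones. *)
Definition sanitize (z : X) : X :=
  (z.1.1, Num.max bl (Num.min bh z.1.2), Num.max 0 (Num.min vh z.2)).

Lemma measurable_sanitize : measurable_fun setT sanitize.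
Proof.
have mr : measurable_fun [set: X] (fun z : X => z.1.2).
  exact: (@measurable_rsize R K).
apply: measurable_fun_pair; last first.
  by apply: measurable_maxr => //; apply: measurable_minr => //; exact: measurable_snd.
apply: measurable_fun_pair.
  by apply: measurableT_comp => //; exact: measurable_fst.
by apply: measurable_maxr => //; apply: measurable_minr => //.
Qed.

Lemma sanitizeV z : valid_req (sanitize z).
Proof.
split; apply/andP; split; rewrite /rsize /reward /= ?le_max ?lexx// ge_max ge_min lexx/= ?andbT//.
Qed.

Lemma sanitize_id z : valid_req z -> sanitize z = z.
Proof.
case: z => [[k be] v] [/andP[/= h1 h2] /andP[h3 h4]].
by rewrite /sanitize /= (min_r h2) (max_r h1) (min_r h4) (max_r h3).
Qed.

Lemma expect_shiftZ n (F : (nat -> X) -> R) (B : R) : (n < T)%N -> cmeas valid_req F ->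
  (forall w w', (forall i, (i < n.+1)%N -> w i = w' i) -> F w = F w') ->
  (forall w, (forall i, valid_req (w i)) -> `|F w| <= B) ->
  \int[P]_w F (fun i => Z i w) =
  \int[P]_w \int[P]_w' F (scons (Z 0%N w) (fun i => Z i w')).
Proof.
case: iidZ => Zlaw Zind nT mF locF bF.
exact: (expect_shift Zlaw Zind ZV measurable_sanitize sanitizeV sanitize_id nT mF locF bF).
Qed.

Lemma measurable_Z2 i : measurable_fun setT (fun x : Omega * Omega => Z i x.2).
Proof. exact: measurableT_comp. Qed.

Lemma measurable_Z1 i : measurable_fun setT (fun x : Omega * Omega => Z i x.1).
Proof. exact: measurableT_comp. Qed.

Lemma PhiE n b : Phi M Z n b = \int[P]_w OPT M n b (fun i => Z i w).
Proof. by rewrite /Phi unlock. Qed.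

Lemma bmeas_OPT dY (Y : measurableType dY) n (B : Y -> 'cV[R]_d)
  (zeta : nat -> Y -> X) : cvmeas B -> (forall i, measurable_fun setT (zeta i)) ->
  (forall i y, valid_req (zeta i y)) ->
  bmeas (fun y => OPT M n (B y) (fun i => zeta i y)).
Proof.
move=> mB mz vz; split; first exact: (measurable_OPT bl0 A0 vh0).
exists (n%:R * vh) => y; rewrite ger0_norm.
  exact: (OPT_leM M vh0 n (B y) (fun i => vz i y)).
exact: (OPT_ge0 M n (B y) (fun i => vz i y)).
Qed.

Lemma bmeas_OPTZ n b : bmeas (fun w => OPT M n b (fun i => Z i w)).
Proof. by apply: (@bmeas_OPT _ _ n (fun=> b)) => // j; exact: measurable_cst. Qed.

Lemma bmeas_Phi dY (Y : measurableType dY) n (B : Y -> 'cV[R]_d) :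
  cvmeas B -> bmeas (fun y => Phi M Z n (B y)).
Proof.
move=> mB; under eq_fun do rewrite PhiE.
apply: (@bmeas_fubini1 _ _ _ _ _ P (fun x : Y * Omega => OPT M n (B x.1) (fun i => Z i x.2))).
apply: (@bmeas_OPT _ _ n (fun x : Y * Omega => B x.1) (fun i x => Z i x.2)) => //.
  by move=> j; exact: (measurableT_comp (mB j)).
by move=> i; exact: measurableT_comp.
Qed.

Let mPh dY (Y : measurableType dY) n (B : Y -> 'cV[R]_d) :
  cvmeas B -> measurable_fun setT (fun y => Phi M Z n (B y)).
Proof. by move=> mB; case: (bmeas_Phi n mB). Qed.

Local Notation Ph := (Phi M Z).
Local Notation acc s b z := (spm_accept M Ph s b z).

Definition value_to_go s b := \int[P]_w spm_reward M Ph s b (fun i => Z i w).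
Definition loss_to_go s b := Ph s b - value_to_go s b.

Lemma bmeas_spm_reward dY (Y : measurableType dY) s (B : Y -> 'cV[R]_d)
  (zeta : nat -> Y -> X) : cvmeas B -> (forall i, measurable_fun setT (zeta i)) ->
  (forall i y, valid_req (zeta i y)) ->
  bmeas (fun y => spm_reward M Ph s (B y) (fun i => zeta i y)).
Proof.
move=> mB mz vz; split; first exact: (measurable_spm_reward M mPh).
exists (s%:R * vh) => y; rewrite ger0_norm.
  exact: (spm_reward_le M vh0 _ _ _ (fun i => vz i y)).
exact: (spm_reward_ge0 M _ _ _ (fun i => vz i y)).
Qed.

Lemma bmeas_value_to_go dY (Y : measurableType dY) n (B : Y -> 'cV[R]_d) :
  cvmeas B -> bmeas (fun y => value_to_go n (B y)).
Proof.
move=> mB.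
apply: (@bmeas_fubini1 _ _ _ _ _ P (fun x : Y * Omega => spm_reward M Ph n (B x.1) (fun i => Z i x.2))).
apply: (@bmeas_spm_reward _ _ n (fun x : Y * Omega => B x.1) (fun i x => Z i x.2)) => //.
  by move=> j; exact: (measurableT_comp (mB j)).
by move=> i; exact: measurableT_comp.
Qed.

Lemma cvmeas_cst dY (Y : measurableType dY) (b : 'cV[R]_d) : cvmeas (fun _ : Y => b).
Proof. by move=> j; exact: measurable_cst. Qed.

Lemma bmeas_loss_to_go dY (Y : measurableType dY) n (B : Y -> 'cV[R]_d) :
  cvmeas B -> bmeas (fun y => loss_to_go n (B y)).
Proof. by move=> mB; apply: bmeasB; [exact: bmeas_Phi|exact: bmeas_value_to_go]. Qed.

Lemma Phi_rec n b : (n < T)%N ->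
  Ph n.+1 b = \int[P]_w \int[P]_w' OPT M n.+1 b (scons (Z 0%N w) (fun i => Z i w')).
Proof.
move=> nT; rewrite PhiE.
apply: (@expect_shiftZ n (OPT M n.+1 b) (n.+1%:R * vh) nT).
- move=> dY Y zeta mz vz.
  exact: (@measurable_OPT _ _ _ M _ _ _ bl0 A0 vh0 _ _ n.+1 (fun=> b) zeta (cvmeas_cst b) mz vz).
- by move=> w w' ww'; exact: OPT_loc.
- move=> w vw; rewrite ger0_norm; first exact: (OPT_leM M vh0 n.+1 b vw).
  exact: (OPT_ge0 M n.+1 b vw).
Qed.

Lemma value_to_go_rec n b : (n < T)%N ->
  value_to_go n.+1 b = \int[P]_w (reward (Z 0%N w) * (acc n.+1 b (Z 0%N w))%:R +
     value_to_go n (nextcap M Ph n.+1 b (Z 0%N w))).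
Proof.
move=> nT; rewrite /value_to_go.
rewrite (@expect_shiftZ n (spm_reward M Ph n.+1 b) (n.+1%:R * vh) nT).
- apply: eq_Rintegral => w _.
  under eq_Rintegral do rewrite spm_reward_scons.
  rewrite expect_D ?expect_cst//; first exact: bmeas_cst.
  exact: (@bmeas_spm_reward _ _ n (fun=> _) (fun i => Z i) (cvmeas_cst _)).
- move=> dY Y zeta mz vz.
  exact: (@measurable_spm_reward _ _ _ M Ph mPh _ _ n.+1 (fun=> b) zeta (cvmeas_cst b) mz).
- by move=> w w' ww'; exact: spm_reward_loc.
- move=> w vw; rewrite ger0_norm; first exact: (spm_reward_le M vh0 _ _ _ vw).
  exact: (spm_reward_ge0 M _ _ _ vw).
Qed.

Lemma loss_to_go_le n b : loss_to_go n b <= n%:R * vh.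
Proof.
rewrite /loss_to_go PhiE /value_to_go -[leRHS]subr0; apply: lerB.
  apply: expect_le_cst; first exact: bmeas_OPTZ.
  by move=> w; apply: (OPT_leM M vh0 n b (fun i => ZV i w)).
apply: expect_ge_cst => [|w].
  exact: (@bmeas_spm_reward _ _ n (fun=> _) (fun i => Z i) (cvmeas_cst _)).
exact: (spm_reward_ge0 M _ _ _ (fun i => ZV i w)).
Qed.

Lemma regretE b : regret M Z T b (SPM M Z T b) = loss_to_go T b.
Proof. rewrite /loss_to_go /value_to_go PhiE /regret unlock /Rintegral /spm_reward; congr (fine _ - fine _). Qed.

(** The loss against full hindsight if only the first decision is imposed, by [x], and all later
    ones are optimal for the known sample [w]. *)
Definition one_step_loss n b (x : X -> bool) (z : X) (w : nat -> X) : R :=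
  OPT M n.+1 b (scons z w) - reward z * (x z)%:R -
  OPT M n (if x z then b - consumption M z else b) w.

Section rule.
Variables (n : nat) (b : 'cV[R]_d) (x : X -> bool).
Hypotheses (b0 : nonneg_vec b) (nT : (n < T)%N) (mx : measurable_fun setT x)
  (xb : forall z, valid_req z -> x z -> forall j, consumption M z j 0 <= b j 0).

Let BX (z : X) := if x z then b - consumption M z else b.

Let mBX dY (Y : measurableType dY) (zeta : Y -> X) : measurable_fun setT zeta ->
  cvmeas (fun y => BX (zeta y)).
Proof.
move=> mz j; rewrite (_ : (fun y => _) = fun y => if x (zeta y)
   then (b - consumption M (zeta y)) j 0 else b j 0).
  apply: measurable_fun_ifT; first exact: measurableT_comp.
    exact: (cvmeas_sub_cons M (cvmeas_cst b) mz).
  exact: measurable_cst.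
by apply/funext => y; rewrite /BX; case: ifP.
Qed.

Lemma bmeas_rewardZ : bmeas (fun w => reward (Z 0%N w)).
Proof.
split; first exact: (measurableT_comp (@measurable_reward R K)).
exists vh => w; case: (ZV 0%N w) => _ /andP[v0 v1]; by rewrite ger0_norm.
Qed.

Lemma bmeas_one_step_loss :
  bmeas (fun y : Omega * Omega => one_step_loss n b x (Z 0%N y.1) (fun i => Z i y.2)).
Proof.
apply: bmeasB; first apply: bmeasB.
- apply: (@bmeas_OPT _ _ n.+1 (fun=> b)
    (fun i (y : Omega * Omega) => scons (Z 0%N y.1) (fun i => Z i y.2) i)).
  + exact: cvmeas_cst.
  + by case=> [|i] /=; [exact: measurable_Z1|exact: measurable_Z2].
  + by case=> [|i] y /=; exact: ZV.
- apply: bmeasM; first exact: (bmeas_comp (measurable_fst) bmeas_rewardZ).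
  by apply: (@bmeas_bool _ _ _ (fun y : Omega * Omega => x (Z 0%N y.1)));
    apply: measurableT_comp => //; exact: measurable_Z1.
- apply: (@bmeas_OPT _ _ n (fun y : Omega * Omega => BX (Z 0%N y.1)) (fun i y => Z i y.2)).
  + by apply: mBX; exact: measurable_Z1.
  + exact: measurable_Z2.
  + by move=> i y; exact: ZV.
Qed.

(* SPM maximizes the reward plus [Phi n] of the remaining capacity, so any
   other feasible rule [x] may replace it in the one-period loss. *)
Lemma loss_to_go_step :
  loss_to_go n.+1 b <= \int[P]_w \int[P]_w' one_step_loss n b x (Z 0%N w) (fun i => Z i w') +
     \int[P]_w loss_to_go n (nextcap M Ph n.+1 b (Z 0%N w)).
Proof.
have m0 : measurable_fun setT (Z 0%N) by [].
have mnc : cvmeas (fun w => nextcap M Ph n.+1 b (Z 0%N w)).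
  exact: (cvmeas_nextcap M mPh n.+1 (cvmeas_cst b) m0).
have macc : bmeas (fun w => reward (Z 0%N w) * (acc n.+1 b (Z 0%N w))%:R).
  apply: bmeasM; first exact: bmeas_rewardZ.
  by apply: bmeas_bool; exact: (measurable_accept M mPh n.+1 (cvmeas_cst b) m0).
have mO : bmeas (fun y : Omega * Omega => OPT M n.+1 b (scons (Z 0%N y.1) (fun i => Z i y.2))).
  apply: (@bmeas_OPT _ _ n.+1 (fun=> b)
    (fun i (y : Omega * Omega) => scons (Z 0%N y.1) (fun i => Z i y.2) i)).
  + exact: cvmeas_cst.
  + by case=> [|i] /=; [exact: measurable_Z1|exact: measurable_Z2].
  + by case=> [|i] y /=; exact: ZV.
have mO1 := bmeas_fubini1 P mO; have mL1 := bmeas_fubini1 P bmeas_one_step_loss.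
have mV := bmeas_value_to_go n mnc; have mG := bmeas_loss_to_go n mnc.
rewrite /loss_to_go Phi_rec// value_to_go_rec// -expect_B//; last exact: bmeasD.
rewrite -expect_D//.
apply: expect_le => //; [by apply: bmeasB => //; apply: bmeasD|by apply: bmeasD|].
move=> w /=; set z := Z 0%N w; have vz : valid_req z by exact: ZV.
have -> : \int[P]_w' one_step_loss n b x z (fun i => Z i w') =
  \int[P]_w' OPT M n.+1 b (scons z (fun i => Z i w')) - reward z * (x z)%:R - Ph n (BX z).
  rewrite PhiE /one_step_loss expect_B ?expect_B ?expect_cst//.
  - exact: (bmeas_pair1 w mO).
  - exact: bmeas_cst.
  - by apply: bmeasB; [exact: (bmeas_pair1 w mO)|exact: bmeas_cst].
  - exact: bmeas_OPTZ.
suff : reward z * (x z)%:R + Ph n (BX z) <=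
   reward z * (acc n.+1 b z)%:R + Ph n (nextcap M Ph n.+1 b z) by rewrite /loss_to_go; lra.
rewrite /BX /nextcap /spm_accept /=.
have [xz|xz] := boolP (x z).
  have -> /= : [forall j, consumption M z j 0 <= b j 0] by apply/forallP; exact: xb.
  rewrite mulr1; have [h|h] := boolP (Ph n b - Ph n (b - consumption M z) <= reward z).
    by rewrite mulr1.
  by rewrite mulr0 add0r; move: h; rewrite -ltNge; lra.
rewrite mulr0 add0r; case: ifP => [/andP[_ h]|_]; last by rewrite mulr0 add0r.
by rewrite mulr1; lra.
Qed.

End rule.

End values.

(** * Mass functions and their empirical versions *)

Section law.
Context (R : realType) (d K : nat) (M : model R d K).
Local Notation X := (request R K).
Variables (bl bh vh : R).
Hypotheses (bl0 : 0 < bl) (blh : bl <= bh) (vh0 : 0 <= vh).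
Local Notation valid_req := (@valid_req R K bl bh vh).
Context dO (Omega : measurableType dO) (P : probability Omega R).
Variables (Z : nat -> {RV P >-> X}) (T : nat).
Hypothesis iidZ : iid_requests M Z T.
Hypothesis ZV : forall t w, valid_req (Z t w).
Hypothesis T0 : (0 < T)%N.
Hypothesis pi0 : forall k, 0 < type_prob M k.

Definition weight (k : 'I_K.+1) (f : R -> bool) (z : X) : R :=
  rsize z * ind ((rtype z == k) && f (ratio z)).

Lemma measurable_pred (f : R -> bool) : measurable [set r | f r] ->
  measurable_fun setT f.
Proof.
move=> mf; apply: (measurable_fun_bool true); rewrite setTI.
by rewrite (_ : _ @^-1` _ = [set r | f r]).
Qed.

Lemma measurable_weight_ind k (f : R -> bool) : measurable [set r | f r] ->
  measurable_fun setT (fun z : X => ind ((rtype z == k) && f (ratio z)) : R).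
Proof.
move=> mf; rewrite /ind; apply: measurable_fun_ifT => //.
apply: measurable_and; first exact: measurable_type_eq.
exact: (measurableT_comp (measurable_pred mf) (@measurable_ratio R K)).
Qed.

Lemma bmeas_weightZ i k (f : R -> bool) : measurable [set r | f r] ->
  bmeas (fun w => weight k f (Z i w)).
Proof.
move=> mf; split.
  apply: (@measurableT_comp _ _ _ _ _ _ (weight k f)) => //.
  by apply: measurable_funM; [exact: measurable_rsize|exact: measurable_weight_ind].
exists bh => w; have [/andP[h1 h2] _] := ZV i w.
rewrite /weight /ind; case: ifP => _; first by rewrite mulr1 ger0_norm// (le_trans (ltW bl0)).
by rewrite mulr0 normr0 (le_trans (ltW bl0)).
Qed.

Lemma law_Z0 (B : set X) : measurable B -> law M B = distribution P (Z 0%N) B.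
Proof. by move=> mB; case: iidZ => h _; rewrite h. Qed.

(** The factor [type_prob M k] cancels the normalization of the conditional law, and the law is that
    of [Z 0], whose requests are valid at every point. *)
Lemma mu_ratio_expect k (f : R -> bool) : measurable [set r | f r] ->
  mu_ratio M k [set r | f r] = \int[P]_w weight k f (Z 0%N w).
Proof.
move=> mf.
pose Ek : set X := [set z | rtype z = k].
pose Gk : set X := [set z | (rtype z == k) && (0 <= rsize z)].
have mEk : measurable Ek by exact: measurable_rtype_eq.
have mGk : measurable Gk.
  have mb : measurable_fun setT (fun z : X => (rtype z == k) && (0 <= rsize z)).
    apply: measurable_and; first exact: measurable_type_eq.
    by apply: measurable_fun_ler => //; exact: measurable_rsize.
  have := mb measurableT [set true] I; rewrite setTI.
  by rewrite (_ : _ @^-1` _ = Gk).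
have lawE : law M Ek = (type_prob M k)%:E.
  by rewrite /type_prob fineK// fin_num_measure.
(* Unfolds [mnormalize]; its fallback branch is excluded since the mass of the type is positive and
   finite. *)
have condE U : cond_law M k U = (law M (U `&` Ek) * ((type_prob M k)^-1)%:E)%E.
  transitivity ((if (law M (setT `&` Ek) == 0%E) || (law M (setT `&` Ek) == +oo%E)
      then (law M : set X -> \bar R)
      else fun V => (law M (V `&` Ek) * ((fine (law M (setT `&` Ek)))^-1)%:E)%E) U).
    by [].
  by rewrite setTI lawE /= eqe gt_eqF.
(* The size is positive only almost surely under [law M]. Its positive part gives an integrand that
   is nonnegative everywhere, to which the rules for nonnegative integrals apply. *)
pose f0 (z : X) : R := Num.max 0 (rsize z) * ind ((rtype z == k) && f (ratio z)).
have f00 z : 0 <= f0 z by rewrite /f0 /ind mulr_ge0//; [rewrite le_max lexx|case: ifP].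
have mf0 : measurable_fun setT f0.
  apply: measurable_funM; last exact: measurable_weight_ind.
  by apply: measurable_maxr => //; exact: measurable_rsize.
have ae0 : {ae cond_law M k, forall z : X, setT z ->
    ((rsize z * \1_[set r | f r] (ratio z))%:E = (f0 z)%:E)%E}.
  exists (~` Gk); split; first exact: measurableC.
    rewrite condE (_ : law M (~` Gk `&` Ek) = 0%E) ?mul0e//.
    rewrite law_Z0; last by apply: measurableI => //; exact: measurableC.
    rewrite /distribution /pushforward (_ : _ @^-1` _ = set0) ?measure0//.
    apply/seteqP; split => // w [] /= h1 h2; apply: h1.
    rewrite /Gk /= (h2 : rtype (Z 0%N w) = k) eqxx /=.
    by have [/andP[h3 h4] _] := ZV 0%N w; exact: le_trans (ltW bl0) h3.
  move=> z /= nz hz; apply: nz => _; case/andP: hz => /eqP zk z0.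
  rewrite /f0 max_r// zk eqxx /= indicE /ind.
  case: ifPn => h; first by rewrite mem_set.
  by rewrite memNset//; exact/negP.
have f0E : f0 \_ Ek = f0.
  apply/funext => z; rewrite patchE; case: ifPn => // /negP h.
  rewrite /f0 /ind ifF ?mulr0//; apply/negbTE; rewrite negb_and; apply/orP; left.
  by apply/negP => /eqP zk; apply: h; rewrite inE.
have f0Ee : (EFin \o f0) \_ Ek = EFin \o f0.
  by rewrite restrict_EFin f0E.
have sc : 0 <= (type_prob M k)^-1 by rewrite invr_ge0 ltW.
have step : (\int[cond_law M k]_z (f0 z)%:E = ((type_prob M k)^-1)%:E * \int[law M]_z (f0 z)%:E)%E.
  transitivity (\int[cond_law M k]_(z in Ek) (EFin \o f0) z)%E.
    rewrite [RHS]integral_mkcond; apply: eq_integral => z _.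
    by rewrite -[LHS]/((EFin \o f0) z) -{1}f0Ee.
  transitivity (\int[mscale (NngNum sc) (law M)]_(z in Ek) (EFin \o f0) z)%E.
    apply: eq_measure_integral => U mU UEk.
    rewrite [LHS]condE (_ : U `&` Ek = U) ?setIidl//.
    by rewrite muleC.
  rewrite ge0_integral_mscale//.
  - congr (_ * _)%E; rewrite integral_mkcond; apply: eq_integral => z _.
    by rewrite -[RHS]/((EFin \o f0) z) -{2}f0Ee.
  - by apply/measurable_EFinP; apply: measurable_funTS.
  - by move=> z _; rewrite lee_fin.
rewrite /mu_ratio unlock.
rewrite (ae_eq_integral (EFin \o f0))//; last 2 first.
- apply/measurable_EFinP; apply: measurable_funM; first exact: measurable_rsize.
  apply: (@measurableT_comp _ _ _ _ _ _ (\1_[set r | f r] : R -> R)).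
    exact: measurable_indic.
  exact: measurable_ratio.
- exact/measurable_EFinP.
rewrite step.
have -> : (\int[law M]_z (f0 z)%:E = \int[P]_w (f0 (Z 0%N w))%:E)%E.
  transitivity (\int[distribution P (Z 0%N)]_z (f0 z)%:E)%E.
    by apply: eq_measure_integral => U mU _; exact: law_Z0.
  by rewrite ge0_integral_distribution//; exact/measurable_EFinP.
have -> : (\int[P]_w (f0 (Z 0%N w))%:E = (\int[P]_w weight k f (Z 0%N w))%:E)%E.
  rewrite /Rintegral fineK.
    apply: eq_integral => w _; congr (_%:E); rewrite /f0 /weight max_r//.
    by have [/andP[h1 h2] _] := ZV 0%N w; exact: le_trans (ltW bl0) h1.
  apply: integrable_fin_num => //.
  exact: (bmeas_integrable P (bmeas_weightZ 0%N k mf)).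
by rewrite -EFinM /= mulrA divff ?mul1r// gt_eqF.
Qed.

End law.

Section variance.
Context (R : realType) (d K : nat) (M : model R d K).
Local Notation X := (request R K).
Variables (bl bh vh : R).
Hypotheses (bl0 : 0 < bl) (blh : bl <= bh) (vh0 : 0 <= vh).
Local Notation valid_req := (@valid_req R K bl bh vh).
Context dO (Omega : measurableType dO) (P : probability Omega R).
Variables (Z : nat -> {RV P >-> X}) (T : nat).
Hypothesis iidZ : iid_requests M Z T.
Hypothesis ZV : forall t w, valid_req (Z t w).

Section centered.
Variables (f : X -> R) (B c : R).
Hypotheses (mf : measurable_fun setT f) (bf : forall z, valid_req z -> `|f z| <= B).
Hypothesis c_def : c = \int[P]_w f (Z 0%N w).

Definition centered_sum n (w : nat -> X) : R := \sum_(i < n) (f (w i) - c).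

Let bmf i : bmeas (fun w => f (Z i w)).
Proof. by split; [exact: measurableT_comp|exists B => w; exact: bf]. Qed.

Let cB : `|c| <= B.
Proof. by rewrite c_def; apply: expect_norm_le => // w; exact: bf. Qed.

Let bfc z : valid_req z -> `|f z - c| <= B + B.
Proof. by move=> vz; apply: le_trans (ler_normB _ _) _; apply: lerD => //; exact: bf. Qed.

Let centered_sum_bound n w : (forall i, valid_req (w i)) -> `|centered_sum n w| <= n%:R * (B + B).
Proof.
move=> vw; apply: le_trans (ler_norm_sum _ _ _) _.
rewrite -[n in leRHS]card_ord mulr_natl -sumr_const; apply: ler_sum => i _; exact: bfc.
Qed.

Let centered_sum_meas n : cmeas valid_req (centered_sum n).
Proof.
move=> dY Y zeta mz vz; apply: measurable_rsum => i.
apply: measurable_funB; last exact: measurable_cst.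
exact: measurableT_comp.
Qed.

Let centered_sum_loc n w w' : (forall i, (i < n)%N -> w i = w' i) -> centered_sum n w = centered_sum n w'.
Proof. by move=> ww'; apply: eq_bigr => i _; rewrite ww'. Qed.

Let centered_sum_scons n z w : centered_sum n.+1 (scons z w) = (f z - c) + centered_sum n w.
Proof. by rewrite /centered_sum big_ord_recl. Qed.

Let bmeas_centered_sum n : bmeas (fun w => centered_sum n (fun i => Z i w)).
Proof.
split; first by apply: centered_sum_meas.
by exists (n%:R * (B + B)) => w; apply: centered_sum_bound => i; exact: ZV.
Qed.

Let bm_fc : bmeas (fun w => f (Z 0%N w) - c).
Proof. by apply: bmeasB => //; exact: bmeas_cst. Qed.

Let expect_fc : \int[P]_w (f (Z 0%N w) - c) = 0.
Proof. by rewrite expect_B ?expect_cst -?c_def ?subrr//; exact: bmeas_cst. Qed.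

Lemma expect_centered_sum n : (n <= T)%N -> \int[P]_w centered_sum n (fun i => Z i w) = 0.
Proof.
elim: n => [|n IH] nT.
  by under eq_Rintegral do rewrite /centered_sum big_ord0; rewrite expect_cst.
rewrite (expect_shiftZ blh vh0 iidZ ZV (F := centered_sum n.+1) (B := n.+1%:R * (B + B)) nT)//.
- under eq_Rintegral => w _.
    under eq_Rintegral do rewrite centered_sum_scons.
    rewrite expect_D//; last exact: bmeas_cst.
    rewrite expect_cst IH ?addr0; last exact: ltnW.
    over.
  exact: expect_fc.
- by move=> w w' ww'; exact: centered_sum_loc.
- by move=> w vw; exact: centered_sum_bound.
Qed.

(** Additivity of the variance, by induction on the first request: the cross term vanishes since the
    remaining sum has mean 0, and a variance is at most the second moment. *)
Lemma expect_centered_sum2 n : (n <= T)%N ->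
  \int[P]_w (centered_sum n (fun i => Z i w)) ^+ 2 <= n%:R * \int[P]_w (f (Z 0%N w)) ^+ 2.
Proof.
elim: n => [|n IH] nT.
  rewrite mul0r; under eq_Rintegral do rewrite /centered_sum big_ord0 expr0n/=.
  by rewrite expect_cst.
rewrite (expect_shiftZ blh vh0 iidZ ZV (F := fun w => (centered_sum n.+1 w) ^+ 2)
   (B := (n.+1%:R * (B + B)) ^+ 2) nT)//; last first.
- move=> w vw; rewrite normrX lerXn2r// ?nnegrE//; last exact: centered_sum_bound.
  exact: le_trans (normr_ge0 _) (centered_sum_bound n.+1 vw).
- by move=> w w' ww'; congr (_ ^+ 2); exact: centered_sum_loc.
- by move=> dY Y zeta mz vz; apply: measurable_funX; exact: centered_sum_meas.
under eq_Rintegral => w _.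
  under eq_Rintegral do rewrite centered_sum_scons sqrrD -addrA.
  rewrite expect_D; [|exact: bmeas_cst|]; last first.
    apply: bmeasD; last exact: bmeasX.
    under eq_fun do rewrite -mulr_natl.
    by apply: bmeasM; [exact: bmeas_cst|apply: bmeasM => //; exact: bmeas_cst].
  rewrite expect_cst expect_D; [| |exact: bmeasX]; last first.
    under eq_fun do rewrite -mulr_natl mulrA.
    by apply: bmeasM => //; exact: bmeas_cst.
  under [X in _ + (X + _)]eq_Rintegral do rewrite -mulr_natl mulrA.
  rewrite expect_Z// expect_centered_sum ?mulr0 ?add0r; last exact: ltnW.
  over.
rewrite expect_D; [|exact: bmeasX|exact: bmeas_cst].
rewrite expect_cst -[n.+1]addn1 natrD mulrDl mul1r addrC; apply: lerD; first by apply: IH; exact: ltnW.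
have -> : \int[P]_w (f (Z 0%N w) - c) ^+ 2 = \int[P]_w (f (Z 0%N w)) ^+ 2 - c ^+ 2.
  have E w : (f (Z 0%N w) - c) ^+ 2 = f (Z 0%N w) ^+ 2 - (c *+ 2 * f (Z 0%N w) - c ^+ 2) by ring.
  under eq_Rintegral do rewrite E.
  rewrite expect_B; [|exact: bmeasX|]; last first.
    by apply: bmeasB; [apply: bmeasM => //|]; exact: bmeas_cst.
  rewrite expect_B; [| |exact: bmeas_cst]; last by apply: bmeasM => //; exact: bmeas_cst.
  by rewrite expect_Z// expect_cst -c_def; ring.
by rewrite gerBl sqr_ge0.
Qed.

End centered.

Definition emp_mass n k (f : R -> bool) (w : nat -> X) : R :=
  n%:R^-1 * \sum_(i < n) weight k f (w i).

Hypothesis T0 : (0 < T)%N.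
Hypothesis pi0 : forall k, 0 < type_prob M k.

Lemma weight_bound k f z : valid_req z -> 0 <= weight k f z <= bh.
Proof.
move=> [/andP[h1 h2] _]; rewrite /weight /ind; case: ifP => _.
  by rewrite mulr1 h2 (le_trans (ltW bl0)).
by rewrite mulr0 lexx (le_trans (ltW bl0))// (le_trans h1).
Qed.

Lemma measurable_weight k (f : R -> bool) : measurable [set r | f r] ->
  measurable_fun setT (weight k f : X -> R).
Proof. by move=> mf; apply: measurable_funM; [exact: measurable_rsize|exact: measurable_weight_ind]. Qed.

(** A weight is at most [bh], so its square is at most [bh] times the weight. The variance is thus
    proportional to the mass, which makes the deviations over intervals of halving mass summable. *)
Lemma emp_mass_dev n k (f : R -> bool) : (0 < n <= T)%N -> measurable [set r | f r] ->
  \int[P]_w (emp_mass n k f (fun i => Z i w) - mu_ratio M k [set r | f r]) ^+ 2 <=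
  bh * mu_ratio M k [set r | f r] / n%:R.
Proof.
move=> /andP[n0 nT] mf; set c := mu_ratio _ _ _.
have cE : c = \int[P]_w weight k f (Z 0%N w) by exact: (mu_ratio_expect bl0 blh iidZ ZV T0 pi0).
have n0R : (n%:R : R) != 0 by rewrite pnatr_eq0 -lt0n.
have E w : (emp_mass n k f (fun i => Z i w) - c) ^+ 2 =
    (n%:R^-1) ^+ 2 * (centered_sum (weight k f) c n (fun i => Z i w)) ^+ 2.
  rewrite -exprMn; congr (_ ^+ 2); rewrite /emp_mass /centered_sum sumrB mulrBr; congr (_ - _).
  by rewrite sumr_const card_ord -[c *+ n]mulr_natl mulrA mulVf// mul1r.
under eq_Rintegral do rewrite E.
have bw z : valid_req z -> `|weight k f z| <= bh.
  by move=> vz; case/andP: (weight_bound k f vz) => h1 h2; rewrite ger0_norm.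
have mw := measurable_weight k mf.
have bmw : bmeas (fun w => weight k f (Z 0%N w)) := bmeas_weightZ bl0 blh ZV 0%N k mf.
rewrite expect_Z; last first.
  apply: bmeasX; split.
    apply: measurable_rsum => i; apply: measurable_funB; last exact: measurable_cst.
    exact: measurableT_comp.
  exists (n%:R * (bh + `|c|)) => w; apply: le_trans (ler_norm_sum _ _ _) _.
  rewrite -[n in leRHS]card_ord mulr_natl -sumr_const; apply: ler_sum => i _.
  by apply: le_trans (ler_normB _ _) _; rewrite lerD2r; apply: bw.
apply: le_trans (_ : (n%:R^-1) ^+ 2 * (n%:R * (bh * c)) <= _); last first.
  by rewrite le_eqVlt; apply/orP; left; apply/eqP; field.
rewrite ler_wpM2l ?sqr_ge0//.
apply: le_trans (expect_centered_sum2 mw bw cE nT) _.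
rewrite ler_wpM2l// cE -expect_Z//; apply: expect_le.
- exact: bmeasX.
- by apply: bmeasM => //; exact: bmeas_cst.
- move=> w; case/andP: (weight_bound k f (ZV 0%N w)) => h1 h2.
  by rewrite expr2 ler_wpM2r.
Qed.

End variance.

(** * The fluid problem *)

Section hull_margin.
Context (R : realType).

Lemma in_Rhull (S : set R) (x y z : R) : S x -> S y -> x <= z <= y -> [set` Rhull S] z.
Proof.
move=> Sx Sy xzy; have h : is_interval [set` Rhull S] by exact: interval_is_interval.
by apply: (h x y) => //; exact: sub_Rhull.
Qed.

(** [S] need not be closed, but the closed interval from its infimum to its supremum lies in [O].
    Only the two endpoints need a neighbourhood, since the points strictly between them are in [O]
    anyway. *)
Lemma hull_margin (S O : set R) (lo hi : R) : open O -> S !=set0 ->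
  (forall r, S r -> lo <= r <= hi) ->
  closure [set` Rhull S] `&` [set r | lo <= r <= hi] `<=` O ->
  exists2 e : R, 0 < e & forall x y, S x -> `|y - x| <= e -> O y.
Proof.
move=> oO [s0 Ss0] Slohi SO.
have hS : has_inf S by split; [exists s0|exists lo => r /Slohi/andP[]].
have hS' : has_sup S by split; [exists s0|exists hi => r /Slohi/andP[]].
set a := inf S; set b := sup S.
have aS x : S x -> a <= x by move=> Sx; apply: ge_inf => //; case: hS.
have bS x : S x -> x <= b by move=> Sx; apply: ub_le_sup => //; case: hS'.
have SH x : S x -> closure [set` Rhull S] x.
  by move=> Sx; apply: subset_closure; exact: sub_Rhull.
have clS x : (forall e, 0 < e -> exists2 y, S y & `|x - y| < e) -> closure [set` Rhull S] x.
  move=> H B /nbhs_ballP[e /= e0 eB]; have [y Sy xy] := H e e0.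
  by exists y; split; [exact: sub_Rhull|apply: eB].
have loa : lo <= a by apply: lb_le_inf; [exists s0|move=> x /Slohi/andP[]].
have bhi : b <= hi by apply: ge_sup; [exists s0|move=> x /Slohi/andP[]].
have ab : a <= b by exact: le_trans (aS _ Ss0) (bS _ Ss0).
have Oa : O a.
  apply: SO; split; last by rewrite /= loa (le_trans ab).
  apply: clS => e e0; have [y Sy ya] := inf_adherent e0 hS.
  by exists y => //; rewrite ler0_norm ?subr_le0 ?aS//; rewrite -/a in ya; lra.
have Ob : O b.
  apply: SO; split; last by rewrite /= bhi (le_trans loa).
  apply: clS => e e0; have [y Sy ya] := sup_adherent e0 hS'.
  by exists y => //; rewrite ger0_norm ?subr_ge0 ?bS//; rewrite -/b in ya; lra.
have Oab x : a < x < b -> O x.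
  move=> /andP[ax xb]; apply: SO; split; last first.
    by rewrite /= (le_trans loa (ltW ax)) (le_trans (ltW xb) bhi).
  apply: subset_closure.
  have [y Sy ya] : exists2 y, S y & y < x.
    have [|y Sy hy] := @inf_adherent _ S (x - a) _ hS; first by rewrite subr_gt0.
    by exists y => //; rewrite -/a in hy; lra.
  have [z Sz za] : exists2 y, S y & x < y.
    have [|z Sz hz] := @sup_adherent _ S (b - x) _ hS'; first by rewrite subr_gt0.
    by exists z => //; rewrite -/b in hz; lra.
  by apply: (in_Rhull Sy Sz); rewrite !ltW.
have /nbhs_ballP[e1 /= e10 He1] : nbhs a O by apply: open_nbhs_nbhs.
have /nbhs_ballP[e2 /= e20 He2] : nbhs b O by apply: open_nbhs_nbhs.
exists (Num.min e1 e2 / 2); first by rewrite divr_gt0// lt_min e10.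
move=> x y Sx xy.
have m1 : Num.min e1 e2 <= e1 by rewrite ge_min lexx.
have m2 : Num.min e1 e2 <= e2 by rewrite ge_min lexx orbT.
have m0 : 0 < Num.min e1 e2 by rewrite lt_min e10.
have ax := aS _ Sx; have bx := bS _ Sx.
have xy1 := ler_norm (y - x); have xy2 : x - y <= `|y - x| by rewrite distrC ler_norm.
have [ya|ya|ya] := ltgtP y a.
- apply: He1; rewrite /ball /= ger0_norm; lra.
- have [yb|yb|yb] := ltgtP y b.
  + by apply: Oab; rewrite ya.
  + apply: He2; rewrite /ball /= ler0_norm; lra.
  + by rewrite yb.
- by rewrite ya.
Qed.

End hull_margin.

Section fluid.
Context (R : realType) (d K : nat) (M : model R d K).
Local Notation A := (direction M).
Variables (kap : 'I_K.+1 -> R.-pker R ~> R) (Rs : set 'cV[R]_d) (p eta : R)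
  (U : 'I_K.+1 -> set R) (c C : R).
Hypotheses (vM : valid_model M) (Rs0 : forall rho, Rs rho -> nonneg_vec rho)
  (reg : active_regular M Rs p eta U c C) (nd : fluid_nondegenerate M Rs U kap).

(** The pair of the binding balance, normalized so that [q] equals its own clip; the normal cone
    condition then speaks of [q] itself. *)
Definition fluid_pair (rho : 'cV[R]_d) (q u : 'cV[R]_K.+1) : Prop :=
  [/\ forall k, clip M k (q k 0) = q k 0,
      forall k, tail_strict M k (q k 0) <= u k 0 <= tail_mass M k (q k 0),
      fluid_set M (m0 M) rho u,
      normal_cone (fluid_set M (m0 M) rho) u q
    & A *m u = rho].

Lemma clip_interior k r e : 0 < e -> rlo M k + e <= clip M k r <= rhi M k - e ->
  clip M k r = r.
Proof.
move=> e0 /andP[]; rewrite /clip minElt maxElt.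
case: (ltP (rlo M k) r) => h1; case: ltP => h2 //; lra.
Qed.

(** Every fluid price is an active point, with perturbation zero of masses and capacities. The
    margin of the active set inside [U k], which does not involve rho, is therefore a margin around
    every fluid price. Within it intervals lie in the support, so that [ell] is their length. *)
Lemma fluid_margin : nonneg_vec (m0 M) -> exists2 e1 : R, 0 < e1 &
  forall rho, Rs rho -> exists q u, fluid_pair rho q u /\
    forall k, [/\ 0 <= q k 0 - e1,
      U k (q k 0) &
      forall b1 b2 x y, q k 0 - e1 <= x -> x <= y -> y <= q k 0 + e1 ->
        c * (y - x) `^ p <= mu_ratio M k [set` Interval (BSide b1 x) (BSide b2 y)]
          <= C * (y - x)].
Proof.
move=> m00.
case: reg => p1 eta0 Uopen tubeU [/andP[c0 cC] Hreg].
case: nd => Umargin Hfluid _.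
case: vM => _ _ _ _ Hsupp.
have /choice[ee Hee] : forall k, exists e : R, 0 < e /\
    forall rho q u, Rs rho -> fluid_pair rho q u -> U k (q k 0) ->
    forall x, `|x - q k 0| <= e -> U k x /\ rlo M k <= x <= rhi M k.
  move=> k; have [Sk [/andP[lo0 lohi] hiy]] := Hsupp k.
  have [W [oO UO]] := Uopen k; have [e' e'0 He'] := Umargin k.
  pose S := active_set M Rs eta k.
  have Slohi r : S r -> rlo M k <= r <= rhi M k.
    move=> [m [rho [u [q [_ _ _ _ ->]]]]].
    by rewrite /clip le_min lohi le_max lexx/= ge_min lexx.
  have inS rho q u : Rs rho -> fluid_pair rho q u -> S (q k 0).
    move=> Rrho [qclip tl fs nc Au].
    exists (m0 M), rho, u, q; split.
    - split => //; first exact: Rs0.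
        by case: fs.
      move=> j; have [_ [/andP[lo0' lohi'] hiy']] := Hsupp j.
      rewrite -(qclip j) /clip; apply/andP; split.
        by rewrite le_min (le_trans lo0' lohi') le_max lo0'.
      by rewrite ge_min hiy'.
    - by rewrite subrr normr0 ltW// edist_inf0// lee_fin ltW.
    - split => //; suff -> : clip_vec M q = q by [].
      by apply/colP => j; rewrite mxE qclip.
    - move=> j; have /andP[h1 h2] := tl j; apply/andP; split; lra.
    - by rewrite qclip.
  (* Without active points there is no fluid pair either, and any margin serves. *)
  have [/asboolP S0|/asboolPn S0] := boolP `[< S !=set0 >]; last first.
    exists 1; split => // rho q u Rrho fp; exfalso; apply: S0.
    by exists (q k 0); exact: inS Rrho fp.
  have [|e1 e10 He1] := @hull_margin R S W (rlo M k) (rhi M k) oO S0 Slohi.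
    move=> r [clr rr]; have : U k r by apply: tubeU; split => //; rewrite Sk.
    by rewrite UO => -[].
  (* [e1] keeps a point in the open set [W], and [e'], the distance of [U k] from the endpoints,
     keeps it in the support. *)
  exists (Num.min e1 e'); split; first by rewrite lt_min e10.
  move=> rho q u Rrho fp Uq x; rewrite le_min => /andP[xe1 xe'].
  have Sq := inS _ _ _ Rrho fp.
  have /andP[h1 h2] := He' _ Uq.
  have h3 := ler_norm (x - q k 0); have h4 : q k 0 - x <= `|x - q k 0| by rewrite distrC ler_norm.
  have xin : rlo M k <= x <= rhi M k by apply/andP; split; lra.
  by split => //; rewrite UO; split; [exact: He1 xe1|rewrite Sk].
have [e1 [e10 He1]] : exists e1 : R, 0 < e1 /\ forall k, e1 <= ee k.
  exists (\big[Num.min/1]_k ee k); split; last by move=> k; apply: bigmin_le.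
  by apply: lt_bigmin => // k _; case: (Hee k).
exists e1 => // rho Rrho; have [q [u [Uq tl fs nc Au]]] := Hfluid _ Rrho.
have qc k : clip M k (q k 0) = q k 0.
  by have [e' e'0 He'] := Umargin k; exact: (clip_interior e'0 (He' _ (Uq k))).
have fp : fluid_pair rho q u.
  split => //; rewrite (_ : q = clip_vec M q)//; apply/colP => j; by rewrite mxE qc.
exists q, u; split => // k.
have Uqk : U k (q k 0) by rewrite -qc; exact: Uq.
have near x : `|x - q k 0| <= e1 -> U k x /\ rlo M k <= x <= rhi M k.
  move=> h; case: (Hee k) => _ /(_ rho q u Rrho fp Uqk x); apply.
  exact: le_trans h (He1 k).
have [Sk [/andP[lo0 lohi] hiy]] := Hsupp k.
split => //.
  have [|_ /andP[h _]] := near (q k 0 - e1); last exact: le_trans lo0 h.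
  by rewrite addrAC subrr add0r normrN gtr0_norm.
move=> b1 b2 x y qx xy yq.
have inI z : [set` Interval (BSide b1 x) (BSide b2 y)] z -> x <= z <= y.
  rewrite /= in_itv; case: b1; case: b2 => /= /andP[h1 h2]; rewrite ?h1 ?h2 ?(ltW h1) ?(ltW h2)//.
have nearI z : [set` Interval (BSide b1 x) (BSide b2 y)] z -> U k z /\ rlo M k <= z <= rhi M k.
  by move=> /inI/andP[h1 h2]; apply: near; rewrite ler_norml; apply/andP; split; lra.
have li : local_interval M (U k) k (Interval (BSide b1 x) (BSide b2 y)).
  split => z; last by move=> [/nearI[]].
  move=> /nearI[_ /andP[h1 h2]] /=; apply/andP; split; [exact: le_trans h1|exact: le_trans hiy].
have := Hreg k _ li.
suff -> : ell M k [set` Interval (BSide b1 x) (BSide b2 y)] = y - x by [].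
rewrite /ell (_ : _ `&` _ = [set` Interval (BSide b1 x) (BSide b2 y)]); last first.
  by apply/seteqP; split => z; [case|move=> zI; split => //; rewrite Sk; case: (nearI _ zI)].
rewrite lebesgue_measure_itv /= /lt_ereal /=.
case: ifPn => h; first by [].
have -> : x = y by apply/eqP; rewrite eq_le xy leNgt.
by rewrite subrr.
Qed.

(** By the binding balance every point of the ball is some [A *m u]; differences of such points
    reach every unit vector. *)
Lemma right_inverse x0 (e : R) : 0 < e -> ball x0 e `<=` Rs ->
  exists Bm : 'M[R]_(K.+1, d), A *m Bm = 1%:M.
Proof.
move=> e0 bRs.
have surj rho : Rs rho -> exists u : 'cV[R]_K.+1, A *m u = rho.
  by case: nd => _ H _ /H[q [u [_ _ _ _ Au]]]; exists u.
have [u0 Au0] := surj _ (bRs _ (ballxx _ e0)).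
have /choice[v Hv] : forall j : 'I_d, exists v : 'cV[R]_K.+1, A *m v = delta_mx j 0.
  move=> j; have [|u Au] := surj (x0 + (e / 2) *: delta_mx j 0).
    apply: bRs; split => // i l; rewrite /ball /= !mxE opprD addrA subrr sub0r normrN.
    case: (_ && _); rewrite ?mulr1 ?mulr0 ?normr0// ger0_norm; lra.
  exists ((e / 2)^-1 *: (u - u0)).
  rewrite -scalemxAr mulmxBr Au Au0 addrAC subrr add0r scalerA mulVf ?scale1r//.
  lra.
exists (\matrix_(k, j) v j k 0); apply/matrixP => i j.
have := congr1 (fun z : 'cV[R]_d => z i 0) (Hv j); rewrite !mxE eqxx andbT => <-.
by apply: eq_bigr => k _; rewrite mxE.
Qed.

End fluid.

(** The ratios on which a price at distance [t] from [q], above it if [s] and below it otherwise,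
    disagrees with [q]. The point [q] belongs to the upper side, in accordance with acceptance at
    [q <= ratio]. *)
Definition one_side (R : realType) (s : bool) (q t r : R) : bool :=
  if s then (q <= r) && (r < q + t) else (q - t < r) && (r < q).

Section local_masses.
Context (R : realType) (d K : nat) (M : model R d K).
Local Notation A := (direction M).
Local Notation X := (request R K).
Variables (bl bh vh : R).
Hypotheses (bl0 : 0 < bl) (blh : bl <= bh).
Local Notation valid_req := (@valid_req R K bl bh vh).
Context dO (Omega : measurableType dO) (P : probability Omega R).
Variables (Z : nat -> {RV P >-> X}) (T : nat).
Hypothesis iidZ : iid_requests M Z T.
Hypothesis ZV : forall t w, valid_req (Z t w).
Hypothesis T0 : (0 < T)%N.
Hypothesis pi0 : forall k, 0 < type_prob M k.

Definition mass k (f : R -> bool) : R := mu_ratio M k [set r | f r].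

Lemma massE k (f : R -> bool) : measurable [set r | f r] ->
  mass k f = \int[P]_w weight k f (Z 0%N w).
Proof. by move=> mf; exact: (mu_ratio_expect bl0 blh iidZ ZV T0 pi0). Qed.

Let bw k (f : R -> bool) (mf : measurable [set r | f r]) := bmeas_weightZ bl0 blh ZV 0%N k mf.

Lemma ind_le (a b : bool) : (a -> b) -> ind a <= ind b :> R.
Proof. by case: a; case: b => // h; rewrite /ind ?lexx//; have := h isT. Qed.

Lemma weight_le k (f g : R -> bool) z : valid_req z -> (f (ratio z) -> g (ratio z)) ->
  weight k f z <= weight k g z.
Proof.
move=> vz fg; rewrite /weight ler_wpM2l ?(ltW (valid_req_size bl0 vz))//.
by apply: ind_le => /andP[-> /fg->].
Qed.

Lemma weight_add k (f g h : R -> bool) (z : X) :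
  (ind (f (ratio z)) = ind (g (ratio z)) + ind (h (ratio z)) :> R) ->
  weight k f z = weight k g z + weight k h z.
Proof.
rewrite /weight -mulrDr => H; congr (_ * _).
by case: (rtype z == k) => //=; rewrite /ind addr0.
Qed.

Lemma mass_le k (f g : R -> bool) : measurable [set r | f r] ->
  measurable [set r | g r] -> (forall r, f r -> g r) -> mass k f <= mass k g.
Proof.
move=> mf mg fg; rewrite !massE//; apply: expect_le; [exact: bw|exact: bw|].
by move=> w; apply: weight_le; [exact: ZV|exact: fg].
Qed.

Lemma mass_add k (f g h : R -> bool) : measurable [set r | f r] ->
  measurable [set r | g r] -> measurable [set r | h r] ->
  (forall r, ind (f r) = ind (g r) + ind (h r) :> R) -> mass k f = mass k g + mass k h.
Proof.
move=> mf mg mh H; rewrite !massE// -expect_D; [|exact: bw|exact: bw].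
by apply: eq_Rintegral => w _; apply: weight_add.
Qed.

Lemma mass_sub k (f g h : R -> bool) : measurable [set r | f r] ->
  measurable [set r | g r] -> measurable [set r | h r] ->
  (forall r, ind (f r) <= ind (g r) + ind (h r) :> R) -> mass k f <= mass k g + mass k h.
Proof.
move=> mf mg mh H; rewrite !massE// -expect_D; [|exact: bw|exact: bw].
apply: expect_le; [exact: bw|by apply: bmeasD; exact: bw|move=> w].
rewrite /weight -mulrDr ler_wpM2l ?(ltW (valid_req_size bl0 (ZV 0%N w)))//.
by case: (rtype _ == k) => //=; rewrite /ind addr0.
Qed.

Lemma mass_ge0 k (f : R -> bool) : measurable [set r | f r] -> 0 <= mass k f.
Proof.
move=> mf; rewrite massE//; apply: expect_ge_cst; first exact: bw.
by move=> w; case/andP: (weight_bound bl0 blh k f (ZV 0%N w)).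
Qed.

Lemma mass_le_bh k (f : R -> bool) : measurable [set r | f r] -> mass k f <= bh.
Proof.
move=> mf; rewrite massE//; apply: expect_le_cst; first exact: bw.
by move=> w; case/andP: (weight_bound bl0 blh k f (ZV 0%N w)).
Qed.

Lemma emp_mass_le n k (f g : R -> bool) w : (forall i, valid_req (w i)) ->
  (forall r, f r -> g r) -> emp_mass n k f w <= emp_mass n k g w.
Proof.
move=> vw fg; rewrite /emp_mass ler_wpM2l ?invr_ge0//; apply: ler_sum => i _.
by apply: weight_le => //; exact: fg.
Qed.

Lemma emp_mass_add n k (f g h : R -> bool) (w : nat -> X) :
  (forall r, ind (f r) = ind (g r) + ind (h r) :> R) ->
  emp_mass n k f w = emp_mass n k g w + emp_mass n k h w.
Proof.
move=> H; rewrite /emp_mass -mulrDr -big_split/=; congr (_ * _).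
by apply: eq_bigr => i _; apply: weight_add.
Qed.

Lemma emp_mass_ge0 n k (f : R -> bool) w : (forall i, valid_req (w i)) -> 0 <= emp_mass n k f w.
Proof.
move=> vw; rewrite /emp_mass mulr_ge0 ?invr_ge0//; apply: sumr_ge0 => i _.
by case/andP: (weight_bound bl0 blh k f (vw i)).
Qed.

Lemma meas_itv b1 (x : R) b2 y : measurable [set` Interval (BSide b1 x) (BSide b2 y)].
Proof. exact: measurable_itv. Qed.

Lemma one_side_itv s q t : [set r : R | one_side s q t r] =
  [set` Interval (BSide s (if s then q else q - t)) (BSide true (if s then q + t else q))].
Proof. by apply/seteqP; split => r; rewrite /one_side /= in_itv; case: s. Qed.

Lemma meas_one_side s q t : measurable [set r : R | one_side s q t r].
Proof. by rewrite one_side_itv; exact: meas_itv. Qed.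

Lemma meas_ge q : measurable [set r : R | q <= r].
Proof.
rewrite (_ : [set r | _] = [set` `[q, +oo[%R])//.
by apply/seteqP; split => r; rewrite /= in_itv /= andbT.
Qed.

Lemma meas_gt q : measurable [set r : R | q < r].
Proof.
rewrite (_ : [set r | _] = [set` `]q, +oo[%R])//.
by apply/seteqP; split => r; rewrite /= in_itv /= andbT.
Qed.

Variables (rho : 'cV[R]_d) (q u : 'cV[R]_K.+1) (e1 c C p : R).
Hypotheses (fp : fluid_pair M rho q u) (e10 : 0 < e1) (c0 : 0 < c) (p1 : 1 <= p).
Hypothesis (qe : forall k, 0 <= q k 0 - e1).
Hypothesis (reg : forall k b1 b2 x y, q k 0 - e1 <= x -> x <= y -> y <= q k 0 + e1 ->
        c * (y - x) `^ p <= mu_ratio M k [set` Interval (BSide b1 x) (BSide b2 y)]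
          <= C * (y - x)).

Lemma one_side_reg k s t : 0 <= t <= e1 ->
  c * t `^ p <= mass k (one_side s (q k 0) t) <= C * t.
Proof.
move=> /andP[t0 te]; rewrite /mass one_side_itv.
have := @reg k s true (if s then q k 0 else q k 0 - t) (if s then q k 0 + t else q k 0).
have -> : (if s then q k 0 + t else q k 0) - (if s then q k 0 else q k 0 - t) = t.
  by case: s; ring.
by apply; case: s; lra.
Qed.

Lemma one_side_incr k s t t' : 0 <= t -> t <= t' -> t' <= e1 ->
  mass k (one_side s (q k 0) t) <= mass k (one_side s (q k 0) t') /\
  mass k (one_side s (q k 0) t') <= mass k (one_side s (q k 0) t) + C * (t' - t).
Proof.
move=> t0 tt' t'e; have := meas_one_side s (q k 0) t; have := meas_one_side s (q k 0) t' => mt' mt.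
split; first by apply: mass_le => // r; rewrite /one_side; case: s {mt mt'}; move=> /andP[h1 h2]; apply/andP; split; lra.
pose I := Interval (BSide s (if s then q k 0 + t else q k 0 - t'))
          (BSide s (if s then q k 0 + t' else q k 0 - t)).
apply: (le_trans (@mass_sub k _ (one_side s (q k 0) t) (fun r => r \in I) _ _ _ _)) => //.
  move=> r; rewrite /one_side /I; case: s {mt mt' I}; rewrite in_itv /=.
    case: (ltP r (q k 0 + t)) => h1; case: (leP (q k 0) r) => h2; case: (ltP r (q k 0 + t')) => h3;
      rewrite /ind /=; lra.
  case: (ltP (q k 0 - t) r) => h1; case: (ltP r (q k 0)) => h2; case: (ltP (q k 0 - t') r) => h3;
      rewrite /ind /=; lra.
rewrite lerD2l /mass.
have := @reg k s s (if s then q k 0 + t else q k 0 - t') (if s then q k 0 + t' else q k 0 - t).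
have -> : (if s then q k 0 + t' else q k 0 - t) - (if s then q k 0 + t else q k 0 - t') = t' - t.
  by case: s {mt mt' I}; ring.
move=> /(_ _ _ _)/andP H; apply: (proj2 (H _ _ _)); case: s {mt mt' I H}; lra.
Qed.

(** The upper regularity bound on the degenerate interval at [q] excludes an atom, so the two tails
    that enclose [u] coincide. *)
Lemma u_tail k : u k 0 = mass k (fun r => q k 0 <= r).
Proof.
have mq := meas_itv true (q k 0) false (q k 0).
have e10' := e10.
have qe1 : q k 0 - e1 <= q k 0 by lra.
have qe2 : q k 0 <= q k 0 + e1 by lra.
have /andP[] := @reg k true false (q k 0) (q k 0) qe1 (lexx _) qe2.
rewrite subrr mulr0 => _ h0.
case: fp => _ /(_ k)/andP[h1 h2] _ _ _.
apply/eqP; rewrite eq_le; apply/andP; split; first exact: h2.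
apply: le_trans h1.
have := @mass_add k (fun r => q k 0 <= r) (fun r => r \in Interval (BSide true (q k 0)) (BSide false (q k 0)))
  (fun r => q k 0 < r) (meas_ge _) mq (meas_gt _).
move=> -> //; first by rewrite gerDr.
move=> r; rewrite in_itv /=; case: (ltgtP (q k 0) r) => h; rewrite /ind /=; lra.
Qed.

(** Both sides of [q] carry positive mass within distance [e1], and the lower side consists of
    nonnegative ratios. *)
Lemma u_interior k : 0 < u k 0 < m0 M k 0.
Proof.
have side_pos s : 0 < mass k (one_side s (q k 0) e1).
  have e11 : 0 <= e1 <= e1 by rewrite ltW//=.
  have /andP[h _] := @one_side_reg k s e1 e11.
  by apply: lt_le_trans h; rewrite mulr_gt0// powR_gt0.
apply/andP; split.
  rewrite u_tail; apply: lt_le_trans (side_pos true) _.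
  by apply: mass_le; [exact: meas_one_side|exact: meas_ge|move=> r /andP[]].
rewrite u_tail mxE /tail_mass -/(mass k (fun r => 0 <= r)).
apply: lt_le_trans (_ : mass k (fun r => q k 0 <= r) + mass k (one_side false (q k 0) e1) <= _).
  by rewrite ltrDl.
have mU : measurable [set r | (q k 0 <= r) || one_side false (q k 0) e1 r].
  rewrite (_ : [set r | _] = [set r | q k 0 <= r] `|` [set r | one_side false (q k 0) e1 r]).
    by apply: measurableU; [exact: meas_ge|exact: meas_one_side].
  by apply/seteqP; split => r /= => [/orP[]|[]->]; [left|right| |rewrite orbT].
rewrite -(@mass_add k (fun r => (q k 0 <= r) || one_side false (q k 0) e1 r))//; last 3 first.
- exact: meas_ge.
- exact: meas_one_side.
- move=> r; rewrite /one_side; case: (leP (q k 0) r) => h /=; rewrite ?andbF ?andbT /ind; lra.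
apply: mass_le => //; first exact: meas_ge.
have h := qe k; have e10' := e10.
by move=> r /orP[|/andP[h1 h2]]; lra.
Qed.

(* [u] is interior to [0, m0], so a small step along [h] stays in the fluid set. *)
Lemma normal_dir (h : 'cV[R]_K.+1) : (forall j, (A *m h) j 0 <= 0) ->
  \sum_k q k 0 * h k 0 <= 0.
Proof.
move=> Ah; case: fp => _ _ [u0 um Au] nc _.
(* Dominates each ratio of [h] to the distance of [u] from its bounds, so that the step
   [1 / (1 + S)] is admissible in all coordinates at once. *)
pose S := \sum_k (`|h k 0| / u k 0 + `|h k 0| / (m0 M k 0 - u k 0)).
have pos k : 0 <= `|h k 0| / u k 0 /\ 0 <= `|h k 0| / (m0 M k 0 - u k 0).
  have /andP[h1 h2] := u_interior k.
  by split; apply: divr_ge0 => //; lra.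
have S0 : 0 <= S by apply: sumr_ge0 => k _; case: (pos k) => *; exact: addr_ge0.
have Sk k : `|h k 0| / u k 0 <= S /\ `|h k 0| / (m0 M k 0 - u k 0) <= S.
  have -> : S = (`|h k 0| / u k 0 + `|h k 0| / (m0 M k 0 - u k 0)) +
     \sum_(i | i != k) (`|h i 0| / u i 0 + `|h i 0| / (m0 M i 0 - u i 0)) by rewrite /S (bigD1 k).
  have : 0 <= \sum_(i | i != k) (`|h i 0| / u i 0 + `|h i 0| / (m0 M i 0 - u i 0)).
    by apply: sumr_ge0 => i _; case: (pos i) => *; exact: addr_ge0.
  by case: (pos k) => *; lra.
pose t := (1 + S)^-1.
have t0 : 0 < t by rewrite invr_gt0; lra.
have tS : t * (1 + S) = 1 by rewrite /t mulVf//; lra.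
have := nc (u + t *: h) _.
have -> : \sum_i q i 0 * ((u + t *: h) i 0 - u i 0) = t * \sum_k q k 0 * h k 0.
  by rewrite mulr_sumr; apply: eq_bigr => k _; rewrite !mxE; ring.
rewrite pmulr_rle0//; apply.
have small k : t * `|h k 0| <= u k 0 /\ t * `|h k 0| <= m0 M k 0 - u k 0.
  have /andP[h1 h2] := u_interior k; have h3 : 0 < m0 M k 0 - u k 0 by lra.
  have [] := Sk k; rewrite !ler_pdivrMr// => a1 a2.
  split.
    rewrite -[leRHS]mul1r -tS -mulrA ler_pM2l//; lra.
  rewrite -[leRHS]mul1r -tS -mulrA ler_pM2l//; lra.
split.
- move=> k; rewrite !mxE; have [h1 _] := small k.
  have : - (t * `|h k 0|) <= t * h k 0 by rewrite -mulrN ler_pM2l// lerNl -normrN ler_norm.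
  lra.
- move=> k; rewrite [leLHS]mxE [X in _ + X]mxE; have [_ h1] := small k.
  have : t * h k 0 <= t * `|h k 0| by rewrite ler_pM2l// ler_norm.
  lra.
- move=> j; rewrite mulmxDr -scalemxAr mxE [X in _ + X]mxE.
  have := Au j; have : t * (A *m h) j 0 <= 0 by rewrite pmulr_rle0.
  lra.
Qed.

Variable Bm : 'M[R]_(K.+1, d).
Hypothesis ABm : A *m Bm = 1%:M.

(* A right inverse of [A] turns the ratios [q] into resource prices. *)
Definition fluid_price (j : 'I_d) : R := \sum_k Bm k j * q k 0.

(** The direction [- Bm *m delta_mx j 0] releases resource [j] only, so [normal_dir] applies to
    it. *)
Lemma fluid_price_ge0 j : 0 <= fluid_price j.
Proof.
have E : \sum_k q k 0 * (- (Bm *m (delta_mx j 0 : 'cV[R]_d))) k 0 = - fluid_price j.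
  by rewrite /fluid_price -sumrN; apply: eq_bigr => k _; rewrite -colE !mxE; ring.
rewrite -oppr_le0 -E; apply: normal_dir => i.
rewrite mulmxN mulmxA ABm mul1mx !mxE oppr_le0; exact: ler0n.
Qed.

(** Along a direction in the kernel of A both signs are admissible, so [q] is orthogonal to this
    kernel; [h] below is the projection of a unit vector into the kernel. *)
Lemma price_fluid_price k : price M fluid_price k = q k 0.
Proof.
pose h : 'cV[R]_K.+1 := delta_mx k 0 - Bm *m (A *m delta_mx k 0).
have Ah : A *m h = 0.
  by rewrite /h mulmxBr [A *m (Bm *m _)]mulmxA ABm mul1mx subrr.
have E : \sum_i q i 0 * h i 0 = q k 0 - price M fluid_price k.
  have -> : q k 0 = \sum_i q i 0 * (delta_mx k 0 : 'cV[R]_K.+1) i 0.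
    rewrite (bigD1 k)//= big1 ?addr0; first by rewrite mxE !eqxx mulr1.
    by move=> i ik; rewrite mxE (negbTE ik) mulr0.
  have -> : price M fluid_price k = \sum_i q i 0 * (Bm *m (A *m (delta_mx k 0 : 'cV[R]_K.+1))) i 0.
    rewrite /price /fluid_price; under eq_bigr do rewrite mulr_suml.
    rewrite exchange_big/=; apply: eq_bigr => i _.
    rewrite mxE mulr_sumr; apply: eq_bigr => j _.
    by rewrite -colE mxE; ring.
  by rewrite -sumrB; apply: eq_bigr => i _; rewrite /h !mxE; ring.
have h1 := @normal_dir h _; have h2 := @normal_dir (- h) _.
have E2 : \sum_i q i 0 * (- h) i 0 = - \sum_i q i 0 * h i 0.
  by rewrite -sumrN; apply: eq_bigr => i _; rewrite !mxE; ring.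
rewrite E2 E in h2; rewrite E in h1.
have h1' := h1 _; have h2' := h2 _.
apply/eqP; rewrite eq_le; apply/andP; split.
  have : - (q k 0 - price M fluid_price k) <= 0.
    by apply: h2 => j; rewrite mulmxN Ah oppr0 mxE.
  lra.
have : q k 0 - price M fluid_price k <= 0 by apply: h1 => j; rewrite Ah mxE.
lra.
Qed.

End local_masses.

(** * Localization of the dual prices *)

Section lipschitz_level.
Context (R : realType).

(** An intermediate value theorem: the level is attained at the supremum of the sublevel set, by the
    Lipschitz bound on either side of it. *)
Lemma lipschitz_level (m : R -> R) (e C v : R) : 0 <= e -> 0 <= C ->
  (forall t t', 0 <= t -> t <= t' -> t' <= e -> m t <= m t' /\ m t' <= m t + C * (t' - t)) ->
  m 0 <= v <= m e -> exists2 t, 0 <= t <= e & m t = v.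
Proof.
move=> e0 C0 H /andP[v0 v1].
pose S : set R := [set t | 0 <= t <= e /\ m t <= v].
have hS : has_sup S.
  split; first by exists 0; split => //; rewrite lexx.
  by exists e => t [/andP[]].
pose ts := sup S.
have S0 : S 0 by split => //; rewrite lexx.
have ts0 : 0 <= ts by apply: ub_le_sup => //; case: hS.
have tse : ts <= e by apply: ge_sup; [case: hS|move=> t [/andP[]]].
exists ts; first by rewrite ts0.
apply/eqP; rewrite eq_le; apply/andP; split.
  apply/ler_addgt0Pr => ep ep0.
  have ep1 : 0 < ep / (C + 1) by rewrite divr_gt0//; lra.
  have [t [/andP[t0 te] mt] tts] := sup_adherent ep1 hS.
  have tts' : t <= ts by apply: ub_le_sup; [case: hS|split => //; rewrite t0].
  have [_ h] := H t ts t0 tts' tse.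
  have : C * (ts - t) <= C * (ep / (C + 1)) by apply: ler_wpM2l => //; rewrite -/ts in tts; lra.
  have : C * (ep / (C + 1)) <= ep by rewrite mulrA ler_pdivrMr; nra.
  lra.
have [tse'|tse'] := ltP ts e; last first.
  by have -> : ts = e by apply/eqP; rewrite eq_le tse tse'.
apply/ler_addgt0Pr => ep ep0.
have ep1 : 0 < ep / (C + 1) by rewrite divr_gt0//; lra.
pose t' := Num.min e (ts + ep / (C + 1)).
have tt' : ts < t' by rewrite lt_min tse'/=; lra.
have t'e : t' <= e by rewrite ge_min lexx.
have t'1 : t' <= ts + ep / (C + 1) by rewrite ge_min lexx orbT.
have [_ h] := H ts t' ts0 (ltW tt') t'e.
have : C * (t' - ts) <= C * (ep / (C + 1)) by apply: ler_wpM2l => //; lra.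
have : C * (ep / (C + 1)) <= ep by rewrite mulrA ler_pdivrMr; nra.
have : v < m t'.
  rewrite ltNge; apply/negP => mt'.
  have : t' <= ts by apply: ub_le_sup; [case: hS|split => //; rewrite t'e andbT; lra].
  lra.
lra.
Qed.

End lipschitz_level.

Section pairing.
Context (R : realType) (d K : nat) (M : model R d K).
Local Notation A := (direction M).
Local Notation X := (request R K).
Variables (bl bh vh : R).
Hypotheses (bl0 : 0 < bl) (A0 : forall j k, 0 <= A j k) (blh : bl <= bh) (vh0 : 0 <= vh).
Local Notation valid_req := (@valid_req R K bl bh vh).
Variables (rho : 'cV[R]_d) (q u : 'cV[R]_K.+1) (Bm : 'M[R]_(K.+1, d)).
Hypotheses (Au : A *m u = rho) (ABm : A *m Bm = 1%:M).
Hypotheses (ls0 : forall j, 0 <= fluid_price q Bm j) (lsq : forall k, price M (fluid_price q Bm) k = q k 0).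

Definition Bnorm : R := \sum_k \sum_j `|Bm k j|.

Lemma Bnorm_ge0 : 0 <= Bnorm.
Proof. by apply: sumr_ge0 => k _; apply: sumr_ge0. Qed.

Definition gap (l : 'I_d -> R) k : R := `|price M l k - q k 0|.
Definition above (l : 'I_d -> R) k : bool := q k 0 <= price M l k.
Definition tail_dev n (w : nat -> X) k : R := `|emp_mass n k (fun r => q k 0 <= r) w - u k 0|.

(** Transposing [A *m Bm = 1%:M] recovers resource prices from type prices; an error in the latter
    is amplified by at most the entries of [Bm]. *)
Lemma lam_price (l : 'I_d -> R) j : l j = \sum_k Bm k j * price M l k.
Proof.
rewrite /price; under eq_bigr do rewrite mulr_sumr.
rewrite exchange_big/=.
have H i : \sum_k Bm k j * (l i * A i k) = l i * (1%:M : 'M[R]_d) i j.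
  by rewrite -ABm mxE mulr_sumr; apply: eq_bigr => k _; ring.
under eq_bigr do rewrite H.
rewrite (bigD1 j)//= big1 ?addr0; first by rewrite mxE eqxx mulr1.
by move=> i ij; rewrite mxE (negbTE ij) mulr0.
Qed.

Lemma sum_by_type n (w : nat -> X) (D : 'I_K.+1 -> R) (g : 'I_K.+1 -> R -> bool) :
  (0 < n)%N ->
  \sum_(i < n) rsize (w i) * D (rtype (w i)) * ind (g (rtype (w i)) (ratio (w i))) =
  n%:R * \sum_k D k * emp_mass n k (g k) w.
Proof.
move=> n0; have nR : (n%:R : R) != 0 by rewrite pnatr_eq0 -lt0n.
rewrite mulr_sumr.
have H k : n%:R * (D k * emp_mass n k (g k) w) = \sum_(i < n) D k * weight k (g k) (w i).
  by rewrite /emp_mass -mulr_sumr; field.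
under [RHS]eq_bigr do rewrite H.
rewrite exchange_big/=; apply: eq_bigr => i _.
rewrite (bigD1 (rtype (w i)))//= big1 ?addr0.
  by rewrite /weight eqxx /=; ring.
by move=> k kw; rewrite /weight eq_sym (negbTE kw) /= /ind !mulr0.
Qed.

(* Complementary slackness at [l], tested against the fluid prices, with the
   empirical mass above [q] compared to [u]. *)
Lemma pairing n (w : nat -> X) (b : 'cV[R]_d) l (del c1 : R) : (0 < n)%N ->
  (forall i, valid_req (w i)) -> nonneg_vec b -> dual_at M n b w l ->
  (forall j, `|n%:R^-1 * b j 0 - rho j 0| <= c1) ->
  (forall k, gap l k <= del) ->
  \sum_k gap l k * (emp_mass n k (one_side (above l k) (q k 0) (gap l k)) w - tail_dev n w k)
   <= Bnorm * del * c1.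
Proof.
move=> n0 vw b0 dl bc gd.
have nR : 0 < (n%:R : R) by rewrite ltr0n.
(* The acceptance test that [kkt] produces when the competing price vector is the fluid price. *)
pose g k r := if q k 0 < price M l k then price M l k <= r else price M l k < r.
have := kkt bl0 b0 vw dl ls0.
rewrite (eq_bigr (fun i : 'I_n => rsize (w i) * (q (rtype (w i)) 0 - price M l (rtype (w i))) *
   ind (g (rtype (w i)) (ratio (w i))))); last first.
  by move=> i _; rewrite !lsq /g; congr (_ * _); case: ifP.
rewrite (sum_by_type w (fun k => q k 0 - price M l k) g n0).
rewrite -ler_pdivlMl// mulrC mulr_suml => h1.
(* Replacing the capacity per period by [rho = A *m u] turns the right side of [kkt] into prices
   times [u], up to the capacity error. *)
have E : \sum_j (fluid_price q Bm j - l j) * b j 0 * n%:R^-1 =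
   \sum_k (q k 0 - price M l k) * u k 0 +
   \sum_j (fluid_price q Bm j - l j) * (n%:R^-1 * b j 0 - rho j 0).
  have -> : \sum_k (q k 0 - price M l k) * u k 0 = \sum_j (fluid_price q Bm j - l j) * rho j 0.
    rewrite -Au; under [RHS]eq_bigr do rewrite mxE mulr_sumr.
    rewrite exchange_big/=; apply: eq_bigr => k _.
    rewrite -lsq /price -sumrB mulr_suml; apply: eq_bigr => j _; ring.
  rewrite -big_split/=; apply: eq_bigr => j _; ring.
have h2 : \sum_j (fluid_price q Bm j - l j) * (n%:R^-1 * b j 0 - rho j 0) <= Bnorm * del * c1.
  have -> : Bnorm * del * c1 = \sum_j \sum_k `|Bm k j| * del * c1.
    rewrite /Bnorm exchange_big/= !mulr_suml; apply: eq_bigr => j _.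
    by rewrite !mulr_suml.
  apply: ler_sum => j _; rewrite [l j]lam_price /fluid_price -sumrB mulr_suml.
  apply: ler_sum => k _; apply: le_trans (ler_norm _) _.
  rewrite normrM; apply: ler_pM => //.
  rewrite -mulrBr normrM ler_wpM2l// distrC; exact: gd.
apply: le_trans h2; rewrite E in h1.
have h3 : \sum_k gap l k * (emp_mass n k (one_side (above l k) (q k 0) (gap l k)) w - tail_dev n w k) <=
  \sum_k (q k 0 - price M l k) * (emp_mass n k (g k) w - u k 0).
  apply: ler_sum => k _; rewrite /gap /above /g /tail_dev.
  have := ler_norm (emp_mass n k (fun r => q k 0 <= r) w - u k 0).
  have := ler_norm (u k 0 - emp_mass n k (fun r => q k 0 <= r) w); rewrite distrC.
  set D := `|emp_mass _ _ _ _ - _| => d1 d2.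
  (* In both strict cases the mass selected by [g] and the mass above [q] differ by exactly the side
     interval between [q] and the price. *)
  have [qp|qp|qp] := ltgtP (q k 0) (price M l k).
  - rewrite gtr0_norm ?subr_gt0//.
    have e1 : emp_mass n k (fun r => q k 0 <= r) w =
        emp_mass n k (fun r => price M l k <= r) w +
        emp_mass n k (one_side true (q k 0) (price M l k - q k 0)) w.
      apply: emp_mass_add => r; rewrite /one_side [q k 0 + _]addrC subrK.
      by case: (leP (q k 0) r) => a1; case: (leP (price M l k) r) => a2; rewrite /ind /=; lra.
    by nra.
  - rewrite ltr0_norm ?subr_lt0//.
    have e1 : emp_mass n k (fun r => price M l k < r) w =
        emp_mass n k (fun r => q k 0 <= r) w +
        emp_mass n k (one_side false (q k 0) (- (price M l k - q k 0))) w.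
      apply: emp_mass_add => r; rewrite /one_side opprK [q k 0 + _]addrC subrK.
      by case: (leP (q k 0) r) => a1; case: (ltP (price M l k) r) => a2; rewrite /ind /=; lra.
    by nra.
  - by rewrite qp !subrr normr0 !mul0r.
apply: le_trans h3 _.
have -> : \sum_k (q k 0 - price M l k) * (emp_mass n k (g k) w - u k 0) =
  \sum_k (q k 0 - price M l k) * emp_mass n k (g k) w - \sum_k (q k 0 - price M l k) * u k 0.
  by rewrite -sumrB; apply: eq_bigr => k _; ring.
lra.
Qed.

Variables (e1 c C p : R).
Hypotheses (e10 : 0 < e1) (c0 : 0 < c) (p1 : 1 <= p).
Hypothesis one_side_reg : forall k s t, 0 <= t <= e1 ->
  c * t `^ p <= mass M k (one_side s (q k 0) t) <= C * t.
Hypothesis one_side_incr : forall k s t t', 0 <= t -> t <= t' -> t' <= e1 ->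
  mass M k (one_side s (q k 0) t) <= mass M k (one_side s (q k 0) t') /\
  mass M k (one_side s (q k 0) t') <= mass M k (one_side s (q k 0) t) + C * (t' - t).

Lemma C_ge0 : 0 <= C.
Proof.
have e11 : 0 <= e1 <= e1 by rewrite ltW/=.
have /andP[h1 h2] := one_side_reg ord0 true e11.
rewrite -(pmulr_lge0 _ e10); apply: le_trans h2; apply: le_trans h1.
by rewrite mulr_ge0 ?(ltW c0)// powR_ge0.
Qed.

(* Side intervals at [q] whose masses halve: the variances of their empirical
   masses then sum geometrically, so second moments give a uniform bound. *)
Lemma grid_exists k s j : exists t, 0 <= t <= e1 /\
  mass M k (one_side s (q k 0) t) = mass M k (one_side s (q k 0) e1) / 2 ^+ j.
Proof.
have e11 : 0 <= e1 <= e1 by rewrite ltW/=.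
have e00 : 0 <= (0 : R) <= e1 by rewrite lexx ltW.
have /andP[h1 h2] := one_side_reg k s e11.
have m10 : 0 <= mass M k (one_side s (q k 0) e1).
  by apply: le_trans h1; rewrite mulr_ge0 ?(ltW c0)// powR_ge0.
have [|t t01 mt] := @lipschitz_level R (fun t => mass M k (one_side s (q k 0) t)) e1 C
   (mass M k (one_side s (q k 0) e1) / 2 ^+ j) (ltW e10) C_ge0 (@one_side_incr k s).
  have /andP[_ h3] := one_side_reg k s e00.
  apply/andP; split.
    apply: le_trans h3 _; rewrite mulr0; apply: divr_ge0 => //; exact: exprn_ge0.
  rewrite ler_pdivrMr ?exprn_gt0// ler_peMr//.
  by apply: exprn_ege1; lra.
by exists t.
Qed.

Definition grid : 'I_K.+1 -> bool -> nat -> R :=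
  fun k s j => projT1 (cid (grid_exists k s j)).

Lemma gridP k s j : 0 <= grid k s j <= e1 /\
  mass M k (one_side s (q k 0) (grid k s j)) = mass M k (one_side s (q k 0) e1) / 2 ^+ j.
Proof. by rewrite /grid; case: cid. Qed.

Definition grid_dev n (w : nat -> X) k s j : R :=
  `|emp_mass n k (one_side s (q k 0) (grid k s j)) w - mass M k (one_side s (q k 0) (grid k s j))|.

Lemma one_side_sub s (a t t' r : R) : t <= t' -> one_side s a t r -> one_side s a t' r.
Proof. by move=> tt'; rewrite /one_side; case: s => /andP[h1 h2]; apply/andP; split; lra. Qed.

(** The first grid interval whose mass falls below that of the given interval is contained in it and
    has at least half its mass; its empirical mass is under control. If no grid mass up to index [n]
    is that small, the given mass is itself at most [ep]. *)
Lemma mass_compare n (w : nat -> X) k s t ep : (forall i, valid_req (w i)) ->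
  0 <= ep -> 0 <= t <= e1 ->
  (forall j, (j <= n)%N -> grid_dev n w k s j <= ep) ->
  mass M k (one_side s (q k 0) e1) / 2 ^+ n <= ep ->
  mass M k (one_side s (q k 0) t) <= 2 * emp_mass n k (one_side s (q k 0) t) w + 2 * ep.
Proof.
move=> vw ep0 /andP[t0 te] gd small.
have em0 := emp_mass_ge0 bl0 blh n k (one_side s (q k 0) t) vw.
set mt := mass M k (one_side s (q k 0) t); set m1 := mass M k (one_side s (q k 0) e1) in small *.
have [h|h] := leP mt (m1 / 2 ^+ n); first by lra.
have mt1 : mt <= m1 by case: (one_side_incr k s t0 te (lexx _)).
pose Q j := m1 / 2 ^+ j < mt.
have exQ : exists j, Q j by exists n.
have [j Qj minj] := ex_minnP exQ.
have jn : (j <= n)%N by apply: minj.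
case: j Qj minj jn => [|i] Qi minj jn.
  by move: Qi; rewrite /Q expr0 divr1; lra.
have nQi : mt <= m1 / 2 ^+ i.
  by rewrite leNgt; apply/negP => /minj; rewrite ltnn.
have [/andP[g0 ge] gE] := gridP k s i.+1.
have gt : grid k s i.+1 <= t.
  rewrite leNgt; apply/negP => tg.
  have [h1 _] := one_side_incr k s t0 (ltW tg) ge.
  by move: Qi h1; rewrite /Q gE -/mt -/m1; lra.
have h1 := emp_mass_le bl0 n k vw (fun r => @one_side_sub s (q k 0) _ _ r gt).
have h2 := gd _ jn; rewrite /grid_dev gE -/m1 in h2.
have h3 := ler_norm (m1 / 2 ^+ i.+1 - emp_mass n k (one_side s (q k 0) (grid k s i.+1)) w).
rewrite distrC in h3.
have h4 : m1 / 2 ^+ i = 2 * (m1 / 2 ^+ i.+1) by rewrite exprS; field; rewrite expf_neq0.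
lra.
Qed.

(** [del] is the largest gap. In [C1], [K.+1] stems from the tail deviations, [Bnorm * c1] from the
    capacity error, and the 1 and the factor 2 from [mass_compare]. At a type with the largest gap
    [pairing] may be divided by [del]; this bounds a mass, and regularity turns it into a bound on
    [del]. *)
Lemma price_localization n (w : nat -> X) (b : 'cV[R]_d) l (c1 ep : R) :
  let C1 := 2 * (K.+1%:R + Bnorm * c1 + 1) in
  (0 < n)%N -> (forall i, valid_req (w i)) -> nonneg_vec b -> dual_at M n b w l ->
  0 <= c1 -> (forall j, `|n%:R^-1 * b j 0 - rho j 0| <= c1 * n%:R^-1) ->
  0 < ep -> n%:R^-1 <= ep ->
  (forall k, tail_dev n w k <= ep) ->
  (forall k s j, (j <= n)%N -> grid_dev n w k s j <= ep) ->
  (forall k s, mass M k (one_side s (q k 0) e1) / 2 ^+ n <= ep) ->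
  C1 * ep < c * e1 `^ p ->
  exists del, [/\ 0 <= del <= e1, forall k, gap l k <= del, c * del `^ p <= C1 * ep
    & forall k, gap l k * mass M k (one_side (above l k) (q k 0) (gap l k)) <= C1 * del * ep].
Proof.
move=> C1 n0 vw b0 dl c10 bc ep0 nep td gd sm epsmall.
have gap0 k : 0 <= gap l k by exact: normr_ge0.
pose ks := [arg max_(k > ord0) gap l k]%O.
have ksP k : gap l k <= gap l ks.
  by rewrite /ks; case: Order.TotalTheory.arg_maxP => // i _ h; exact: h.
set del := gap l ks in ksP *.
have del0 : 0 <= del by exact: gap0.
have B0 := Bnorm_ge0.
have em0 k t s := emp_mass_ge0 bl0 blh n k (one_side s (q k 0) t) vw.
have hp := pairing n0 vw b0 dl bc ksP.
have hp2 : \sum_k gap l k * emp_mass n k (one_side (above l k) (q k 0) (gap l k)) w <=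
   (K.+1%:R + Bnorm * c1) * del * ep.
  have : \sum_k gap l k * tail_dev n w k <= K.+1%:R * (del * ep).
    rewrite -[K.+1 in leRHS]card_ord mulr_natl -sumr_const.
    by apply: ler_sum => k _; apply: ler_pM => //; exact: normr_ge0.
  have : Bnorm * del * (c1 * n%:R^-1) <= Bnorm * c1 * del * ep.
    have -> : Bnorm * del * (c1 * n%:R^-1) = Bnorm * c1 * del * n%:R^-1 by ring.
    by apply: ler_wpM2l => //; rewrite !mulr_ge0.
  move: hp; under eq_bigr do rewrite mulrBr.
  rewrite sumrB; lra.
have each k : gap l k * emp_mass n k (one_side (above l k) (q k 0) (gap l k)) w <=
   (K.+1%:R + Bnorm * c1) * del * ep.
  apply: le_trans hp2; rewrite (bigD1 k)//= lerDl; apply: sumr_ge0 => i _.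
  by rewrite mulr_ge0.
have cmp k s t : 0 <= t <= e1 ->
    mass M k (one_side s (q k 0) t) <= 2 * emp_mass n k (one_side s (q k 0) t) w + 2 * ep.
  by move=> t01; apply: mass_compare => //; [exact: ltW|exact: gd].
(* Otherwise the side interval of length [e1] would also have small empirical mass, against the
   lower regularity bound and the smallness of [ep]. *)
have dele : del <= e1.
  rewrite leNgt; apply/negP => edel.
  have e11 : 0 <= e1 <= e1 by rewrite ltW/=.
  have := each ks; rewrite -/del => h1.
  have h2 := emp_mass_le bl0 n ks vw (fun r => @one_side_sub (above l ks) (q ks 0) _ _ r (ltW edel)).
  have delp : 0 < del by exact: lt_trans edel.
  have h3 : emp_mass n ks (one_side (above l ks) (q ks 0) del) w <= (K.+1%:R + Bnorm * c1) * ep.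
    rewrite -(ler_pM2l delp); lra.
  have h4 := cmp ks (above l ks) e1 e11.
  have /andP[h5 _] := one_side_reg ks (above l ks) e11.
  by rewrite /C1 in epsmall; lra.
exists del; split => //.
- by rewrite del0.
- have [d0|d0] := eqVneq del 0.
    rewrite d0 powR0; last by rewrite gt_eqF// (lt_le_trans ltr01).
    by rewrite mulr0 /C1 !mulr_ge0 ?(ltW ep0)// !addr_ge0// mulr_ge0.
  have delp : 0 < del by rewrite lt_def d0.
  have := each ks; rewrite -/del => h1.
  have h3 : emp_mass n ks (one_side (above l ks) (q ks 0) del) w <= (K.+1%:R + Bnorm * c1) * ep.
    rewrite -(ler_pM2l delp); lra.
  have del01 : 0 <= del <= e1 by rewrite del0.
  have h4 := cmp ks (above l ks) del del01.
  have /andP[h5 _] := one_side_reg ks (above l ks) del01.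
  by rewrite /C1; lra.
- move=> k; have g01 : 0 <= gap l k <= e1 by rewrite gap0 (le_trans (ksP k)).
  have h1 := cmp k (above l k) _ g01.
  have h2 := each k; have h3 := ksP k; have h0 := gap0 k.
  have : gap l k * mass M k (one_side (above l k) (q k 0) (gap l k)) <=
     gap l k * (2 * emp_mass n k (one_side (above l k) (q k 0) (gap l k)) w + 2 * ep) by apply: ler_wpM2l.
  have : gap l k * (2 * ep) <= del * (2 * ep) by apply: ler_wpM2r => //; lra.
  by rewrite /C1; lra.
Qed.

End pairing.

(** * One period *)

Section swap.
Context (R : realType) d1 d2 (T1 : measurableType d1) (T2 : measurableType d2).
Context (P1 : probability T1 R) (P2 : probability T2 R).

Lemma expect_swap (f : T1 * T2 -> R) : bmeas f ->
  \int[P1]_x \int[P2]_y f (x, y) = \int[P2]_y \int[P1]_x f (x, y).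
Proof.
move=> mf; have i12 : (P1 \x P2)%E.-integrable setT (EFin \o f).
  case: mf => [m [M bf]]; apply: measurable_bounded_integrable => //.
    exact: (prob_setT_lty (P1 \x P2)%E).
  exists M; split; first by rewrite num_real.
  by move=> y My x _ /=; exact: le_trans (bf x) (ltW My).
have := Fubini i12; rewrite /Rintegral => h.
have -> : (\int[P1]_x (fine (\int[P2]_y (f (x, y))%:E))%:E =
          \int[P1]_x \int[P2]_y (f (x, y))%:E)%E.
  apply: eq_integral => x _; rewrite fineK//; apply: integrable_fin_num => //.
  exact: (bmeas_integrable P2 (bmeas_pair1 x mf)).
have -> : (\int[P2]_y (fine (\int[P1]_x (f (x, y))%:E))%:E =
          \int[P2]_y \int[P1]_x (f (x, y))%:E)%E.
  apply: eq_integral => y _; rewrite fineK//; apply: integrable_fin_num => //.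
  exact: (bmeas_integrable P1 (bmeas_pair2 y mf)).
by rewrite h.
Qed.

Lemma bmeas_fubini2 (f : T1 * T2 -> R) : bmeas f -> bmeas (fun y => \int[P1]_x f (x, y)).
Proof.
move=> mf; apply: (@bmeas_fubini1 _ _ _ _ _ P1 (fun z : T2 * T1 => f (z.2, z.1))).
apply: (bmeas_comp _ mf); apply: measurable_fun_pair; [exact: measurable_snd|exact: measurable_fst].
Qed.

End swap.


Section young.
Context (R : realType).

Lemma powR_le_1sqr (x g : R) : 0 <= x -> 0 <= g <= 2 -> x `^ g <= 1 + x ^+ 2.
Proof.
move=> x0 /andP[g0 g2]; have [x1|x1] := leP x 1.
  apply: le_trans (_ : 1 <= _); last by rewrite lerDl sqr_ge0.
  have -> : (1 : R) = 1 `^ g by rewrite powR1.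
  by apply: ge0_ler_powR => //; rewrite nnegrE.
apply: le_trans (_ : x `^ 2%:R <= _); first by apply: ler_powR => //; exact: ltW.
by rewrite powR_mulrn// lerDr.
Qed.

(* Linearizes a power of [eps], so that only the mean of [dev2] matters. *)
Lemma powR_scaled (N x g : R) : 0 < N -> 0 <= x -> 0 <= g <= 2 ->
  x `^ g <= N `^ (- (g / 2)) * (1 + N * x ^+ 2).
Proof.
move=> N0 x0 g02; have Nh : 0 < N `^ (1 / 2) by apply: powR_gt0.
have sq : (N `^ (1 / 2)) ^+ 2 = N.
  rewrite -powR_mulrn ?ltW// -powRrM.
  by rewrite (_ : 1 / 2 * 2%:R = 1) ?powRr1 ?ltW//; field.
have -> : x = (x * N `^ (1 / 2)) * N `^ (- (1 / 2)).
  by rewrite powRN; field; rewrite gt_eqF.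
have y0 : 0 <= x * N `^ (1 / 2) by rewrite mulr_ge0// ltW.
rewrite powRM ?powR_ge0// -powRrM.
have -> : - (1 / 2) * g = - (g / 2) by field.
have -> : N * (x * N `^ (1 / 2) * N `^ (- (1 / 2))) ^+ 2 = (x * N `^ (1 / 2)) ^+ 2.
  have -> : x * N `^ (1 / 2) * N `^ (- (1 / 2)) = x.
    by rewrite powRN; field; rewrite gt_eqF.
  by rewrite exprMn sq mulrC.
by rewrite mulrC ler_wpM2l ?powR_ge0//; apply: powR_le_1sqr.
Qed.

Lemma convex_le (x y e e' s : R) : 0 <= x -> 0 <= y -> e <= s -> e' <= s ->
  x * e + y * e' <= (x + y) * s.
Proof. by move=> x0 y0 es es'; rewrite mulrDl lerD// ler_wpM2l. Qed.

End young.

Section step.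
Context (R : realType) (d K : nat) (M : model R d K).
Local Notation A := (direction M).
Local Notation X := (request R K).
Variables (bl bh vh : R).
Hypotheses (bl0 : 0 < bl) (A0 : forall j k, 0 <= A j k) (blh : bl <= bh) (vh0 : 0 <= vh).
Local Notation valid_req := (@valid_req R K bl bh vh).
Variables (e1 c C p : R) (Bm : 'M[R]_(K.+1, d)).
Hypotheses (e10 : 0 < e1) (c0 : 0 < c) (p1 : 1 <= p) (ABm : A *m Bm = 1%:M).
Context dO (Omega : measurableType dO) (P : probability Omega R).
Variables (Z : nat -> {RV P >-> X}) (T : nat).
Hypothesis iidZ : iid_requests M Z T.
Hypothesis ZV : forall t w, valid_req (Z t w).
Hypothesis T0 : (0 < T)%N.
Hypothesis pi0 : forall k, 0 < type_prob M k.
Variables (rho : 'cV[R]_d) (q u : 'cV[R]_K.+1).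
Hypotheses (fp : fluid_pair M rho q u) (qe : forall k, 0 <= q k 0 - e1).
Hypothesis (reg : forall k b1 b2 x y, q k 0 - e1 <= x -> x <= y -> y <= q k 0 + e1 ->
        c * (y - x) `^ p <= mu_ratio M k [set` Interval (BSide b1 x) (BSide b2 y)]
          <= C * (y - x)).

Definition step_sreg := @one_side_reg R d K M q e1 c C p reg.
Definition step_sinc := one_side_incr bl0 blh iidZ ZV T0 pi0 reg.
Definition step_ls0 := fluid_price_ge0 bl0 blh iidZ ZV T0 pi0 fp e10 c0 qe reg ABm.
Definition step_lsq := price_fluid_price bl0 blh iidZ ZV T0 pi0 fp e10 c0 qe reg ABm.
Definition step_utail := u_tail bl0 blh iidZ ZV T0 pi0 fp e10 reg.
Definition sgrid := grid e10 c0 step_sreg step_sinc.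

(* The term [(bh ^+ 2 + 1) / n] makes [eps], the square root of [dev2], dominate
   [1 / n] and the mass of the last grid interval. *)
Definition dev2 n (w : nat -> X) : R := (bh ^+ 2 + 1) / n%:R +
  (\sum_k (emp_mass n k (fun r => q k 0 <= r) w - u k 0) ^+ 2 +
   \sum_k \sum_(s : bool) \sum_(j < n.+1)
     (emp_mass n k (one_side s (q k 0) (sgrid k s j)) w - mass M k (one_side s (q k 0) (sgrid k s j))) ^+ 2).

(** The deterministic term, the tails of all types, and for each type two sides with a geometric
    series of sum at most 2. *)
Definition C_dev : R := bh ^+ 2 + 1 + (K.+1%:R * bh ^+ 2 + K.+1%:R * (2 * (2 * bh ^+ 2))).

Lemma bmeas_emp_mass n k (f : R -> bool) : measurable [set r | f r] ->
  bmeas (fun w => emp_mass n k f (fun i => Z i w)).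
Proof.
move=> mf; apply: bmeasM; first exact: bmeas_cst.
by apply: bmeas_sum => i; exact: (bmeas_weightZ bl0 blh ZV i k mf).
Qed.

Let bm1 n k : bmeas (fun w => (emp_mass n k (fun r => q k 0 <= r) (fun i => Z i w) - u k 0) ^+ 2).
Proof.
by apply: bmeasX; apply: bmeasB; [exact: (bmeas_emp_mass n k (meas_ge _))|exact: bmeas_cst].
Qed.

Let bm2 n k s j : bmeas (fun w => (emp_mass n k (one_side s (q k 0) (sgrid k s j)) (fun i => Z i w)
  - mass M k (one_side s (q k 0) (sgrid k s j))) ^+ 2).
Proof.
by apply: bmeasX; apply: bmeasB; [exact: (bmeas_emp_mass n k (meas_one_side _ _ _))|exact: bmeas_cst].
Qed.

Lemma bmeas_dev2 n : bmeas (fun w => dev2 n (fun i => Z i w)).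
Proof.
apply: bmeasD; first exact: bmeas_cst.
apply: bmeasD; first by apply: bmeas_sum => k; exact: bm1.
by apply: bmeas_sum => k; apply: bmeas_sum => s; apply: bmeas_sum => j; exact: bm2.
Qed.

Lemma dev2_ge0 n w : 0 <= dev2 n w.
Proof.
apply: addr_ge0; first by apply: divr_ge0 => //; rewrite addr_ge0// sqr_ge0.
apply: addr_ge0; apply: sumr_ge0 => k _; first exact: sqr_ge0.
by apply: sumr_ge0 => s _; apply: sumr_ge0 => j _; exact: sqr_ge0.
Qed.

Lemma geometric_half (m : R) n : 0 <= m -> \sum_(j < n) m / 2 ^+ j <= 2 * m.
Proof.
move=> m0; suff : \sum_(j < n) m / 2 ^+ j <= 2 * m - 2 * (m / 2 ^+ n).
  have h : 0 <= m / 2 ^+ n by rewrite divr_ge0// exprn_ge0.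
  by move=> h1; lra.
elim: n => [|n IH]; first by rewrite big_ord0 expr0 divr1; lra.
rewrite big_ord_recr /=.
have h4 : m / 2 ^+ n = 2 * (m / 2 ^+ n.+1) by rewrite exprS; field; rewrite expf_neq0.
lra.
Qed.

Lemma expect_dev2 n : (0 < n <= T)%N -> \int[P]_w dev2 n (fun i => Z i w) <= C_dev / n%:R.
Proof.
move=> n0T; have bh0 : 0 <= bh by apply: le_trans blh; exact: ltW.
have n0 : 0 < (n%:R : R) by rewrite ltr0n; case/andP: n0T.
rewrite expect_D; [|exact: bmeas_cst|]; last first.
  apply: bmeasD; first by apply: bmeas_sum => k; exact: bm1.
  by apply: bmeas_sum => k; apply: bmeas_sum => s; apply: bmeas_sum => j; exact: bm2.
rewrite expect_cst expect_D; last 2 first.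
- by apply: bmeas_sum => k; exact: bm1.
- by apply: bmeas_sum => k; apply: bmeas_sum => s; apply: bmeas_sum => j; exact: bm2.
have h1 : \int[P]_w \sum_k (emp_mass n k (fun r => q k 0 <= r) (fun i => Z i w) - u k 0) ^+ 2
   <= K.+1%:R * bh ^+ 2 / n%:R.
  rewrite expect_sum; last by move=> k; exact: bm1.
  rewrite -mulrA -[K.+1 in leRHS]card_ord mulr_natl -sumr_const; apply: ler_sum => k _.
  rewrite step_utail; apply: le_trans (emp_mass_dev bl0 blh vh0 iidZ ZV T0 pi0 k n0T (meas_ge _)) _.
  rewrite ler_pM2r ?invr_gt0// expr2 ler_wpM2l//.
  exact: (mass_le_bh bl0 blh iidZ ZV T0 pi0 k (meas_ge _)).
have h2 : \int[P]_w \sum_k \sum_(s : bool) \sum_(j < n.+1)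
     (emp_mass n k (one_side s (q k 0) (sgrid k s j)) (fun i => Z i w)
      - mass M k (one_side s (q k 0) (sgrid k s j))) ^+ 2
   <= K.+1%:R * (2 * (2 * bh ^+ 2)) / n%:R.
  rewrite expect_sum; last by move=> k; apply: bmeas_sum => s; apply: bmeas_sum => j; exact: bm2.
  rewrite -mulrA -[K.+1 in leRHS]card_ord mulr_natl -sumr_const; apply: ler_sum => k _.
  rewrite expect_sum; last by move=> s; apply: bmeas_sum => j; exact: bm2.
  have hs s : \int[P]_w \sum_(j < n.+1)
     (emp_mass n k (one_side s (q k 0) (sgrid k s j)) (fun i => Z i w)
      - mass M k (one_side s (q k 0) (sgrid k s j))) ^+ 2 <= 2 * bh ^+ 2 / n%:R.
    rewrite expect_sum; last by move=> j; exact: bm2.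
    have m10 := mass_ge0 bl0 blh iidZ ZV T0 pi0 k (meas_one_side s (q k 0) e1).
    apply: le_trans (_ : bh / n%:R * (2 * mass M k (one_side s (q k 0) e1)) <= _); last first.
      have hb := mass_le_bh bl0 blh iidZ ZV T0 pi0 k (meas_one_side s (q k 0) e1).
      have -> : 2 * bh ^+ 2 / n%:R = bh / n%:R * (2 * bh) by ring.
      by apply: ler_wpM2l; [apply: divr_ge0 => //; exact: ltW|lra].
    apply: le_trans (ler_wpM2l _ (geometric_half n.+1 m10)); last by apply: divr_ge0 => //; exact: ltW.
    rewrite mulr_sumr; apply: ler_sum => j _.
    apply: le_trans (emp_mass_dev bl0 blh vh0 iidZ ZV T0 pi0 k n0T (meas_one_side _ _ _)) _.
    rewrite -[mu_ratio _ _ _]/(mass M k (one_side s (q k 0) (sgrid k s j))).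
    have [_ ->] := gridP e10 c0 step_sreg step_sinc k s j.
    by rewrite -mulrA [_ / n%:R]mulrC mulrA.
  rewrite big_bool /=; have := hs true; have := hs false; lra.
rewrite /C_dev !mulrDl; lra.
Qed.

(** With capacity [(n + 1) rho] less up to [bh + 1] units of a column of A, the capacity for each of
    [n] periods differs from rho by at most this over [n]. *)
Definition C_cap (rmax ah : R) : R := rmax + (bh + 1) * ah.
Definition C_loc (rmax ah : R) : R := 2 * (K.+1%:R + Bnorm Bm * C_cap rmax ah + 1).
(** Half the threshold of [price_localization], where a strict inequality is required. *)
Definition eps_good (rmax ah : R) : R := c * e1 `^ p / (2 * C_loc rmax ah).
Definition gap_bound (rmax ah e : R) : R := (C_loc rmax ah * e / c) `^ p^-1.

Variables (rmax ah rmin : R).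
Hypotheses (ah0 : 0 < ah) (rmin0 : 0 < rmin) (Aah : forall j k, A j k <= ah)
   (rho_le : forall j, rmin <= rho j 0 <= rmax).
Variables (n : nat) (b : 'cV[R]_d).
Hypotheses (n0 : (0 < n)%N) (nT : (n < T)%N) (bE : b = n.+1%:R *: rho)
   (nbig : (bh + 1) * ah <= n%:R * rmin) (d0 : (0 < d)%N).

Let bh0 : 0 <= bh. Proof. by apply: le_trans blh; exact: ltW. Qed.
Let nR : 0 < (n%:R : R). Proof. by rewrite ltr0n. Qed.

Lemma rmax0 : 0 < rmax.
Proof. by have /andP[h1 h2] := rho_le (Ordinal d0); apply: lt_le_trans h2; exact: lt_le_trans h1. Qed.

Lemma C_loc_gt0 : 0 < C_loc rmax ah.
Proof.
have h1 := Bnorm_ge0 Bm; have h2 := rmax0; have h3 := bh0; have h4 := ah0.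
have : 0 <= Bnorm Bm * C_cap rmax ah.
  by apply: mulr_ge0 => //; rewrite /C_cap addr_ge0 ?(ltW h2)// mulr_ge0 ?(ltW ah0)// addr_ge0.
have : 0 <= (K.+1%:R : R) by [].
rewrite /C_loc; lra.
Qed.

Lemma cap_pos t k j : 0 <= t <= bh + 1 -> 0 < (b - t *: col k A) j 0.
Proof.
move=> /andP[t0 t1]; rewrite bE !mxE subr_gt0.
apply: le_lt_trans (_ : n%:R * rmin < _).
  by apply: le_trans nbig; apply: ler_pM => //.
have /andP[h1 h2] := rho_le j; have h3 := rmin0; have h4 := nR.
rewrite -natr1 mulrDl mul1r.
have : n%:R * rmin <= n%:R * rho j 0 by rewrite ler_pM2l.
lra.
Qed.

Lemma cap_ge0 t k : 0 <= t <= bh + 1 -> nonneg_vec (b - t *: col k A).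
Proof. by move=> t01 j; apply: ltW; exact: cap_pos. Qed.

Lemma cap_close t k j : 0 <= t <= bh + 1 ->
  `|n%:R^-1 * (b - t *: col k A) j 0 - rho j 0| <= C_cap rmax ah * n%:R^-1.
Proof.
move=> /andP[t0 t1]; have nR' := nR; have h1 := bh0; have h2 := A0 j k; have h3 := Aah j k.
have -> : n%:R^-1 * (b - t *: col k A) j 0 - rho j 0 = (rho j 0 - t * A j k) * n%:R^-1.
  by rewrite bE !mxE -[n.+1]addn1 natrD; field; rewrite gt_eqF.
rewrite normrM [`|n%:R^-1|]ger0_norm ?invr_ge0 ?(ltW nR')//.
rewrite ler_pM2r ?invr_gt0//.
apply: le_trans (ler_normB _ _) _; rewrite /C_cap; apply: lerD.
  have /andP[a1 a2] := rho_le j; have a3 := rmin0.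
  by rewrite ger0_norm//; lra.
by rewrite normrM !ger0_norm//; apply: ler_pM.
Qed.

Definition eps (w : nat -> X) : R := Num.sqrt (dev2 n w).

Lemma dev2_ge w : (bh ^+ 2 + 1) / n%:R <= dev2 n w.
Proof.
rewrite /dev2 lerDl; apply: addr_ge0; apply: sumr_ge0 => k _; first exact: sqr_ge0.
by apply: sumr_ge0 => s _; apply: sumr_ge0 => j _; exact: sqr_ge0.
Qed.

Lemma abs_le_eps w (x : R) : x ^+ 2 <= dev2 n w -> `|x| <= eps w.
Proof. by move=> h; rewrite -sqrtr_sqr; apply: ler_wsqrtr. Qed.

Lemma eps_gt0 w : 0 < eps w.
Proof.
rewrite sqrtr_gt0; apply: lt_le_trans (dev2_ge w).
by apply: divr_gt0 => //; rewrite ltr_wpDl// sqr_ge0.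
Qed.

Lemma eps2 w : eps w ^+ 2 = dev2 n w.
Proof. by rewrite sqr_sqrtr// dev2_ge0. Qed.

Lemma inv_n_le_eps w : n%:R^-1 <= eps w.
Proof.
have nR' := nR; have n1 : 1 <= (n%:R : R) by rewrite ler1n.
have ni : 0 < (n%:R^-1 : R) by rewrite invr_gt0.
have ni1 : (n%:R^-1 : R) <= 1 by rewrite invf_le1.
rewrite -[leLHS]ger0_norm ?(ltW ni)//; apply: abs_le_eps; apply: le_trans (dev2_ge w).
rewrite expr2 ler_pM2r//; have := sqr_ge0 bh; lra.
Qed.

Lemma tail_dev_le w k : tail_dev q u n w k <= eps w.
Proof.
apply: abs_le_eps; rewrite /dev2 (bigD1 k)//=.
set a := (_ - _) ^+ 2; set b1 := \sum_(i | _) _; set b2 := \sum_k _.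
have h1 : 0 <= b1 by apply: sumr_ge0 => i _; exact: sqr_ge0.
have h2 : 0 <= b2.
  by apply: sumr_ge0 => i _; apply: sumr_ge0 => s _; apply: sumr_ge0 => j _; exact: sqr_ge0.
have h3 : 0 <= (bh ^+ 2 + 1) / n%:R by rewrite divr_ge0// addr_ge0// sqr_ge0.
lra.
Qed.

Lemma grid_dev_le w k s j : (j <= n)%N ->
  grid_dev e10 c0 step_sreg step_sinc n w k s j <= eps w.
Proof.
move=> jn; apply: abs_le_eps; rewrite /dev2.
have h1 : 0 <= \sum_k (emp_mass n k (fun r => q k 0 <= r) w - u k 0) ^+ 2.
  by apply: sumr_ge0 => i _; exact: sqr_ge0.
have h3 : 0 <= (bh ^+ 2 + 1) / n%:R by rewrite divr_ge0// addr_ge0// sqr_ge0.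
have nn (F : 'I_K.+1 -> bool -> nat -> R) : (forall k s j, 0 <= F k s j) ->
    F k s j <= \sum_k \sum_(s : bool) \sum_(j < n.+1) F k s j.
  move=> F0; rewrite (bigD1 k)//= (bigD1 s)//= (bigD1 (Ordinal (jn : (j < n.+1)%N)))//=.
  rewrite -!addrA lerDl; apply: addr_ge0; first by apply: sumr_ge0.
  apply: addr_ge0; first by apply: sumr_ge0 => i _; apply: sumr_ge0.
  by apply: sumr_ge0 => i _; apply: sumr_ge0 => i' _; apply: sumr_ge0.
have h4 := nn (fun k s j => (emp_mass n k (one_side s (q k 0) (sgrid k s j)) w -
   mass M k (one_side s (q k 0) (sgrid k s j))) ^+ 2) (fun k s j => sqr_ge0 _).
rewrite /= in h4; apply: le_trans h4 _; lra.
Qed.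

Lemma pow2_ge m : (m%:R : R) <= 2 ^+ m.
Proof.
elim: m => [|m IH]; first by rewrite expr0.
rewrite exprS -natr1; have : 1 <= (2 : R) ^+ m by apply: exprn_ege1; lra.
lra.
Qed.

Lemma small_mass w k s : mass M k (one_side s (q k 0) e1) / 2 ^+ n <= eps w.
Proof.
have m0 := mass_ge0 bl0 blh iidZ ZV T0 pi0 k (meas_one_side s (q k 0) e1).
have m1 := mass_le_bh bl0 blh iidZ ZV T0 pi0 k (meas_one_side s (q k 0) e1).
have nR' := nR; have p2 := pow2_ge n; have p20 : 0 < (2 : R) ^+ n by rewrite exprn_gt0.
apply: le_trans (ler_norm _) _; apply: abs_le_eps; apply: le_trans (dev2_ge w).
apply: le_trans (_ : bh ^+ 2 / n%:R <= _); last first.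
  by rewrite ler_pM2r ?invr_gt0// lerDl.
have n1 : 1 <= (n%:R : R) by rewrite ler1n.
rewrite exprMn; apply: ler_pM; [exact: sqr_ge0|exact: sqr_ge0| |].
  by apply: lerXn2r => //; rewrite nnegrE.
rewrite exprVn lef_pV2 ?posrE ?exprn_gt0//.
by apply: (le_trans p2); rewrite expr2 ler_peMl ?(ltW p20)//; exact: le_trans n1 p2.
Qed.

Definition good (w : nat -> X) : bool := dev2 n w <= eps_good rmax ah ^+ 2.

Lemma eps_good_gt0 : 0 < eps_good rmax ah.
Proof.
rewrite /eps_good; apply: divr_gt0; first by rewrite mulr_gt0// powR_gt0.
by rewrite mulr_gt0// C_loc_gt0.
Qed.

Lemma good_eps w : good w -> C_loc rmax ah * eps w < c * e1 `^ p.
Proof.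
move=> gw; have h0 := eps_good_gt0; have hc := C_loc_gt0.
have h1 : eps w <= eps_good rmax ah.
  by rewrite -[leRHS]gtr0_norm// -sqrtr_sqr; apply: ler_wsqrtr.
apply: le_lt_trans (_ : C_loc rmax ah * eps_good rmax ah < _); first by rewrite ler_pM2l.
have hp : 0 < c * e1 `^ p by rewrite mulr_gt0// powR_gt0.
have -> : C_loc rmax ah * eps_good rmax ah = c * e1 `^ p / 2.
  by rewrite /eps_good; field; rewrite gt_eqF.
lra.
Qed.

Lemma localize w t k l : (forall i, valid_req (w i)) -> good w -> 0 <= t <= bh + 1 ->
  dual_at M n (b - t *: col k A) w l -> forall k',
  [/\ gap M q l k' <= e1, gap M q l k' <= gap_bound rmax ah (eps w) &
    gap M q l k' * mass M k' (one_side (above M q l k') (q k' 0) (gap M q l k')) <=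
    C_loc rmax ah * gap_bound rmax ah (eps w) * eps w].
Proof.
move=> vw gw t01 dl k'.
have hAu : A *m u = rho by case: fp.
have c10 : 0 <= C_cap rmax ah.
  by rewrite /C_cap addr_ge0 ?(ltW rmax0)// mulr_ge0 ?(ltW ah0)// addr_ge0 ?bh0.
have [del [/andP[del0 dele1] gd dp gm]] := price_localization bl0 blh hAu ABm step_ls0 step_lsq
  p1 n0 vw (cap_ge0 k t01) dl c10 (fun j => cap_close k j t01) (eps_gt0 w) (inv_n_le_eps w)
  (tail_dev_le w) (fun k s j => @grid_dev_le w k s j) (small_mass w) (good_eps gw).
have hC1 := C_loc_gt0; have he := eps_gt0 w.
have delG : del <= gap_bound rmax ah (eps w).
  have p0 : p != 0 by rewrite gt_eqF// (lt_le_trans ltr01).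
  rewrite -[leLHS](powRr1 del0) -[X in del `^ X](mulfV p0) powRrM.
  apply: ge0_ler_powR.
  - by rewrite invr_ge0 (le_trans ler01).
  - by rewrite nnegrE powR_ge0.
  - by rewrite nnegrE; apply: divr_ge0; [apply: mulr_ge0; exact: ltW|exact: ltW].
  - by rewrite ler_pdivlMr// mulrC.
split; [exact: le_trans (gd k') dele1|exact: le_trans (gd k') delG|].
apply: le_trans (gm k') _; rewrite ler_pM2r//.
by rewrite ler_pM2l.
Qed.

Definition fluid_rule (z : X) : bool := q (rtype z) 0 <= ratio z.

Lemma measurable_fluid_rule : measurable_fun setT fluid_rule.
Proof.
apply: measurable_fun_ler; last exact: measurable_ratio.
exact: (measurable_rtype_fun (fun k => q k 0)).
Qed.

Lemma size_range z : valid_req z -> 0 <= rsize z <= bh + 1.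
Proof.
move=> vz; rewrite (ltW (valid_req_size bl0 vz))/=; case: vz => /andP[_ h] _.
by rewrite (le_trans h)// lerDl.
Qed.

Lemma cons_cap z : valid_req z -> nonneg_vec (b - consumption M z).
Proof. by move=> vz; exact: cap_ge0 (size_range vz). Qed.

Lemma b_pos j : 0 < b j 0.
Proof.
have h := @cap_pos 0 ord0 j; rewrite scale0r subr0 in h; apply: h.
by rewrite lexx/= addr_ge0.
Qed.

Lemma b_ge0 : nonneg_vec b.
Proof. by move=> j; exact: ltW (b_pos j). Qed.

Lemma fluid_rule_feasible z : valid_req z -> fluid_rule z -> forall j, consumption M z j 0 <= b j 0.
Proof. by move=> vz _ j; have := cons_cap vz j; rewrite mxE [X in _ + X]mxE subr_ge0. Qed.

Lemma localize0 w l : (forall i, valid_req (w i)) -> good w ->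
  dual_at M n b w l -> forall k',
  [/\ gap M q l k' <= e1, gap M q l k' <= gap_bound rmax ah (eps w) &
    gap M q l k' * mass M k' (one_side (above M q l k') (q k' 0) (gap M q l k')) <=
    C_loc rmax ah * gap_bound rmax ah (eps w) * eps w].
Proof.
move=> vw gw dl; apply: (@localize w 0 ord0) => //; last by rewrite scale0r subr0.
by rewrite lexx/= addr_ge0.
Qed.

Lemma weight_one_side k s t z : rtype z = k -> one_side s (q k 0) t (ratio z) ->
  weight k (one_side s (q k 0) t) z = rsize z.
Proof. by move=> zk sz; rewrite /weight zk eqxx sz /ind mulr1. Qed.

(** The lengths [g] depend on the sample but not on the request, so that averaging over the request
    produces length times mass. Acceptance errs only for ratios from [q] up to a higher price,
    rejection only for ratios between a lower price and [q]. *)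
Lemma loss_good w : (forall i, valid_req (w i)) -> good w ->
  exists g : bool -> 'I_K.+1 -> R,
  [/\ forall s k, 0 <= g s k,
    forall s k, g s k * mass M k (one_side s (q k 0) (g s k)) <=
      C_loc rmax ah * gap_bound rmax ah (eps w) * eps w &
    forall z, valid_req z -> one_step_loss M n b fluid_rule z w <=
      \sum_k \sum_(s : bool) g s k * weight k (one_side s (q k 0) (g s k)) z].
Proof.
move=> vw gw; have [l dl] := dual_exists M n vw b_pos.
have bh1 : 0 <= bh + 1 <= bh + 1 by rewrite lexx addr_ge0.
have ex k : exists l', dual_at M n (b - (bh + 1) *: col k A) w l'.
  by apply: (dual_exists M n vw) => j; exact: cap_pos.
pose l2 k := proj1_sig (cid (ex k)); have dl2 k : dual_at M n (b - (bh + 1) *: col k A) w (l2 k).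
  by rewrite /l2; case: cid.
pose g (s : bool) k := if s then (if above M q (l2 k) k then gap M q (l2 k) k else 0)
  else (if above M q l k then 0 else gap M q l k).
have C1p := C_loc_gt0; have ep := eps_gt0 w.
have rhs0 : 0 <= C_loc rmax ah * gap_bound rmax ah (eps w) * eps w.
  by rewrite mulr_ge0 ?(ltW ep)// mulr_ge0 ?(ltW C1p)// powR_ge0.
have g0 s k : 0 <= g s k by rewrite /g; case: s; case: ifP => // _; exact: normr_ge0.
have gT k : g true k = if above M q (l2 k) k then gap M q (l2 k) k else 0 by [].
have gF k : g false k = if above M q l k then 0 else gap M q l k by [].
clearbody g; exists g; split => // [s k|z vz].
  case: s; rewrite ?gT ?gF; case: ifP => [jk|jk]; rewrite ?mul0r//.
    by have [_ _] := localize vw gw bh1 (dl2 k) k; rewrite jk.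
  by have [_ _] := localize0 vw gw dl k; rewrite jk.
have z0 := valid_req_size bl0 vz; pose k := rtype z.
have wt0 s k' t : 0 <= weight k' (one_side s (q k' 0) t) z.
  by case/andP: (weight_bound bl0 blh k' (one_side s (q k' 0) t) vz).
have rz : reward z = rsize z * ratio z by rewrite /ratio; field; rewrite gt_eqF.
have tot s0 : g s0 k * weight k (one_side s0 (q k 0) (g s0 k)) z <=
    \sum_k \sum_(s : bool) g s k * weight k (one_side s (q k 0) (g s k)) z.
  rewrite (bigD1 k)//= (bigD1 s0)//= -addrA lerDl addr_ge0//.
    by apply: sumr_ge0 => s _; rewrite mulr_ge0.
  by apply: sumr_ge0 => k' _; apply: sumr_ge0 => s _; rewrite mulr_ge0.
have [xz|xz] := boolP (fluid_rule z); rewrite /one_step_loss.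
  rewrite xz mulr1; apply: le_trans (tot true).
  (* The capacity behind [l2] is lowered by [bh + 1] and not [bh], so that it lies strictly below
     the one left by any request, as [price_mono] requires. *)
  have t1 : 0 < bh + 1 - rsize z by case: vz => /andP[_ h] _; lra.
  have cz := cons_cap vz.
  have [l' dl'] : exists l', dual_at M n (b - consumption M z) w l'.
    by apply: (dual_exists M n vw) => j; apply: (cap_pos k j (size_range vz)).
  have h1 := OPT_accept_le bl0 A0 b_ge0 cz vz vw dl'.
  have E : b - consumption M z - (bh + 1 - rsize z) *: col k A = b - (bh + 1) *: col k A.
    by rewrite /consumption scalerBl opprB addrA subrK.
  have h2 : price M l' k <= price M (l2 k) k.
    apply: (@price_mono _ _ _ M bl bh vh n (b - consumption M z) (bh + 1 - rsize z) k w) => //.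
      by rewrite E; exact: cap_ge0.
    by rewrite E.
  apply: le_trans (_ : Num.max 0 (rsize z * price M l' k - reward z) <= _); first by rewrite -/k in h1; lra.
  rewrite ge_max mulr_ge0//=.
  have [lt|ge] := ltP (ratio z) (price M (l2 k) k).
    have qr : q k 0 <= ratio z by [].
    have jk : above M q (l2 k) k by rewrite /above (le_trans qr)// ltW.
    have gE : g true k = price M (l2 k) k - q k 0.
      by rewrite gT jk /gap ger0_norm// subr_ge0.
    rewrite weight_one_side ?gE//; last by rewrite /one_side qr/=; lra.
    rewrite rz -mulrBr mulrC ler_pM2r//; lra.
  apply: le_trans (_ : 0 <= _); last by rewrite mulr_ge0.
  rewrite rz -mulrBr mulr_ge0_le0 ?(ltW z0)//; lra.
rewrite (negbTE xz) mulr0 subr0; apply: le_trans (tot false).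
have h1 := OPT_reject_le bl0 A0 b_ge0 vz vw dl.
apply: le_trans (_ : Num.max 0 (reward z - rsize z * price M l k) <= _); first by rewrite -/k in h1; lra.
rewrite ge_max mulr_ge0//=.
have [lt|ge] := ltP (price M l k) (ratio z).
  have qr : ratio z < q k 0 by move: xz; rewrite /fluid_rule -ltNge.
  have jk : above M q l k = false by apply/negbTE; rewrite /above -ltNge (lt_trans lt).
  have gE : g false k = q k 0 - price M l k.
    by rewrite gF jk /gap ler0_norm ?opprB// subr_le0 ltW// (lt_trans lt).
  rewrite weight_one_side ?gE//; last by rewrite /one_side qr andbT; lra.
  rewrite rz -mulrBr mulrC ler_pM2r//; lra.
apply: le_trans (_ : 0 <= _); last by rewrite mulr_ge0.
rewrite rz -mulrBr mulr_ge0_le0 ?(ltW z0)//; lra.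
Qed.

Definition C_step : R := bh * ah * vh / rmin.

Lemma C_step_ge0 : 0 <= C_step.
Proof. by rewrite /C_step divr_ge0 ?mulr_ge0 ?(ltW ah0) ?(ltW rmin0)// bh0. Qed.

(** Shrinking [b] by the factor [1 - bh * ah / (n.+1%:R * rmin)] makes room for any request. The
    relative loss is of order [1 / n] and OPT is at most [n * vh], whence a bound free of [n]. *)
Lemma OPT_diff_crude w z : valid_req z -> (forall i, valid_req (w i)) ->
  OPT M n b w - OPT M n (b - consumption M z) w <= C_step.
Proof.
move=> vz vw; have nR' := nR; have r0 := rmin0; have a0 := ah0; have h0 := bh0.
have N0 : 0 < (n.+1%:R : R) by rewrite ltr0n.
have N1 : (n.+1%:R : R) = n%:R + 1 by rewrite -natr1.
have xi0 : 0 <= bh * ah / (n.+1%:R * rmin) by rewrite divr_ge0 ?mulr_ge0 ?(ltW a0) ?(ltW r0).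
have xi1 : bh * ah / (n.+1%:R * rmin) <= 1.
  rewrite ler_pdivrMr ?mulr_gt0// mul1r N1.
  by have := nbig; rewrite !mulrDl !mul1r; lra.
have th01 : 0 <= 1 - bh * ah / (n.+1%:R * rmin) <= 1 by rewrite subr_ge0 xi1 gerBl.
have hle : le_vec ((1 - bh * ah / (n.+1%:R * rmin)) *: b) (b - consumption M z).
  move=> j; have -> : (b - consumption M z) j 0 = b j 0 - rsize z * A j (rtype z).
    by rewrite -consE [LHS]mxE; congr (_ + _); rewrite mxE.
  rewrite bE [X in X <= _]mxE [(n.+1%:R *: rho) j 0]mxE mulrBl mul1r lerB//.
  have /andP[r1 _] := rho_le j.
  apply: le_trans (_ : bh * ah <= _).
    by case: vz => /andP[z1 z2] _; apply: ler_pM => //; exact: le_trans (ltW bl0) z1.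
  have -> : bh * ah / (n.+1%:R * rmin) * (n.+1%:R * rho j 0) = bh * ah * (rho j 0 / rmin).
    by field; rewrite !gt_eqF.
  by rewrite ler_peMr ?mulr_ge0 ?(ltW a0)// ler_pdivlMr// mul1r.
have hs0 := OPT_scale M n b_ge0 vw th01 hle; move: hs0.
have := OPT_leM M vh0 n b vw; have := OPT_ge0 M n b vw.
set o := OPT M n b w; set o' := OPT _ _ _ _ => p0 pM hs.
apply: le_trans (_ : bh * ah / (n.+1%:R * rmin) * o <= _).
  by rewrite lerBlDr -lerBlDl -[X in X - _]mul1r -mulrBl.
apply: le_trans (_ : bh * ah / (n.+1%:R * rmin) * (n.+1%:R * vh) <= _).
  by apply: ler_wpM2l => //; apply: (le_trans pM); rewrite N1; have := vh0; lra.
rewrite /C_step [X in X <= _](_ : _ = bh * ah * vh / rmin)//.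
by field; rewrite !gt_eqF.
Qed.

Lemma loss_crude w z : valid_req z -> (forall i, valid_req (w i)) -> one_step_loss M n b fluid_rule z w <= vh + C_step.
Proof.
move=> vz vw; have h1 := OPT_scons_crude bl0 A0 n b_ge0 vz vw.
have h2 := OPT_diff_crude vz vw; have h3 := C_step_ge0; have h4 := vh0.
have h5 : 0 <= reward z by case: vz => _ /andP[].
rewrite /one_step_loss; case: (fluid_rule z); rewrite ?mulr1 ?mulr0; lra.
Qed.

Let bmeas_loss2 := bmeas_one_step_loss bl0 A0 vh0 ZV n b measurable_fluid_rule.

Lemma loss_inner y' : \int[P]_y one_step_loss M n b fluid_rule (Z 0%N y) (fun i => Z i y') <=
  K.+1%:R * (2 * (C_loc rmax ah * gap_bound rmax ah (eps (fun i => Z i y')) * eps (fun i => Z i y')))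
  + (vh + C_step) * (dev2 n (fun i => Z i y') / eps_good rmax ah ^+ 2).
Proof.
set w := fun i => Z i y'; have vw i : valid_req (w i) by exact: ZV.
have C1p := C_loc_gt0; have ep := eps_gt0 w; have e0 := eps_good_gt0; have cg := C_step_ge0; have v0 := vh0.
have t10 : 0 <= C_loc rmax ah * gap_bound rmax ah (eps w) * eps w.
  by rewrite mulr_ge0 ?(ltW ep)// mulr_ge0 ?(ltW C1p)// powR_ge0.
have mo : bmeas (fun y => one_step_loss M n b fluid_rule (Z 0%N y) w) by exact: (bmeas_pair2 y' bmeas_loss2).
have t20 : 0 <= (vh + C_step) * (dev2 n w / eps_good rmax ah ^+ 2).
  by rewrite mulr_ge0 ?addr_ge0// divr_ge0 ?sqr_ge0// dev2_ge0.
have [gw|bw] := boolP (good w).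
  have [g [g0 gm gl]] := loss_good vw gw.
  have mw k s : bmeas (fun y => g s k * weight k (one_side s (q k 0) (g s k)) (Z 0%N y)).
    apply: bmeasM; first exact: bmeas_cst.
    exact: (bmeas_weightZ bl0 blh ZV 0 k (meas_one_side _ _ _)).
  have mw2 k : bmeas (fun y => \sum_(s : bool) g s k * weight k (one_side s (q k 0) (g s k)) (Z 0%N y)).
    by apply: bmeas_sum => s; exact: mw.
  apply: le_trans (expect_le P mo (bmeas_sum _ mw2) (fun y => gl _ (ZV 0%N y))) _.
  rewrite expect_sum// -[leLHS]addr0; apply: lerD => //.
  rewrite -[K.+1 in leRHS]card_ord mulr_natl -sumr_const; apply: ler_sum => k _.
  rewrite expect_sum// big_bool /= !expect_Z; [|exact: (bmeas_weightZ bl0 blh ZV 0 k (meas_one_side _ _ _))..].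
  rewrite -!(massE bl0 blh iidZ ZV T0 pi0); [|exact: meas_one_side..].
  by have := gm true k; have := gm false k; lra.
(* On a bad sample [dev2] exceeds [eps_good ^+ 2], so the crude bound may be multiplied by their
   quotient, as in Markov's inequality. *)
apply: le_trans (_ : vh + C_step <= _).
  by apply: expect_le_cst => // y; exact: loss_crude.
rewrite -[leLHS]add0r; apply: lerD; first by apply: mulr_ge0 => //; apply: mulr_ge0.
rewrite ler_peMr ?addr_ge0// ler_pdivlMr ?exprn_gt0// mul1r.
by move: bw; rewrite /good -ltNge; exact: ltW.
Qed.

Definition rate_exp : R := 1 / (2 * p).
Definition C_gap : R := (C_loc rmax ah / c) `^ p^-1.

Lemma gap_boundE e : 0 <= e -> gap_bound rmax ah e = C_gap * e `^ p^-1.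
Proof.
move=> e_ge0; have h : 0 <= C_loc rmax ah / c by apply: divr_ge0; [exact: ltW C_loc_gt0|exact: ltW].
have -> : gap_bound rmax ah e = (C_loc rmax ah / c * e) `^ p^-1 by rewrite /gap_bound mulrAC.
by rewrite powRM.
Qed.

Lemma rate_exp01 : 0 < rate_exp <= 1 / 2.
Proof.
have h := p1; rewrite /rate_exp; apply/andP; split; first by rewrite divr_gt0// mulr_gt0//; lra.
by rewrite ler_pM2l// lef_pV2 ?posrE//; lra.
Qed.

Lemma eps_rate w : eps w `^ p^-1 <= n%:R `^ (- rate_exp) * (1 + n%:R * dev2 n w).
Proof.
have h := p1; rewrite -eps2.
have -> : rate_exp = p^-1 / 2 by rewrite /rate_exp; field; rewrite gt_eqF//; lra.
apply: powR_scaled => //; first exact: ltW (eps_gt0 w).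
rewrite invr_ge0; apply/andP; split; first lra.
by apply: le_trans (_ : 1 <= _); [rewrite invf_le1//; lra|lra].
Qed.

Lemma eps_rate2 w : eps w `^ p^-1 * eps w <= n%:R `^ (- (1 / 2 + rate_exp)) * (1 + n%:R * dev2 n w).
Proof.
have h := p1; have h0 := eps_gt0 w; rewrite -eps2.
have -> : 1 / 2 + rate_exp = (p^-1 + 1) / 2 by rewrite /rate_exp; field; rewrite gt_eqF//; lra.
have -> : eps w `^ p^-1 * eps w = eps w `^ (p^-1 + 1).
  by rewrite powRD ?powRr1 ?(ltW h0)// (gt_eqF h0) implybT.
apply: powR_scaled => //; first exact: ltW.
have : 0 <= p^-1 <= 1 by rewrite invr_ge0 invf_le1; [apply/andP; split; lra|lra].
lra.
Qed.

Lemma dev2_rate g w : g <= 1 -> dev2 n w <= n%:R `^ (- g) * (1 + n%:R * dev2 n w).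
Proof.
move=> g1; have e2 := dev2_ge0 n w; have nR' := nR.
have n1 : 1 <= (n%:R : R) by rewrite ler1n.
apply: le_trans (_ : n%:R `^ (-1) * (1 + n%:R * dev2 n w) <= _).
  rewrite powR_inv1 ?(ltW nR')// mulrDr mulrA mulVf ?gt_eqF// mul1r mulr1.
  by rewrite lerDr invr_ge0 ltW.
apply: ler_wpM2r; first by rewrite addr_ge0// mulr_ge0.
by apply: ler_powR => //; lra.
Qed.

Lemma expect_scaled : \int[P]_w (1 + n%:R * dev2 n (fun i => Z i w)) <= 1 + C_dev.
Proof.
have mE := bmeas_dev2 n; have nR' := nR.
rewrite expect_D ?expect_cst ?expect_Z//; [|exact: bmeas_cst|by apply: bmeasM => //; exact: bmeas_cst].
have : \int[P]_w dev2 n (fun i => Z i w) <= C_dev / n%:R by apply: expect_dev2; rewrite n0 ltnW.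
by rewrite lerD2l ler_pdivlMr// mulrC.
Qed.

Lemma bmeas_scaled (a : R) : bmeas (fun w => a * (1 + n%:R * dev2 n (fun i => Z i w))).
Proof.
apply: bmeasM; first exact: bmeas_cst.
apply: bmeasD; first exact: bmeas_cst.
by apply: bmeasM; [exact: bmeas_cst|exact: bmeas_dev2].
Qed.

Lemma expect_scaled_le (a : R) : 0 <= a ->
  \int[P]_w (a * (1 + n%:R * dev2 n (fun i => Z i w))) <= a * (1 + C_dev).
Proof.
move=> a0; rewrite expect_Z; first by apply: ler_wpM2l => //; exact: expect_scaled.
have := bmeas_scaled 1; by under eq_fun do rewrite mul1r.
Qed.

Definition C_loss : R :=
  (K.+1%:R * (2 * (C_loc rmax ah * C_gap)) + (vh + C_step) / eps_good rmax ah ^+ 2) * (1 + C_dev).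

Lemma loss_rate :
  \int[P]_w \int[P]_w' one_step_loss M n b fluid_rule (Z 0%N w) (fun i => Z i w') <=
  C_loss * n%:R `^ (- (1 / 2 + rate_exp)).
Proof.
have C1p := C_loc_gt0; have cg := C_step_ge0; have v0 := vh0; have e0 := eps_good_gt0.
have ka := rate_exp01.
(* The request is averaged first, for a fixed future sample: the prices depend on the sample
   only. *)
rewrite (expect_swap P P bmeas_loss2).
pose a : R := (K.+1%:R * (2 * (C_loc rmax ah * C_gap)) + (vh + C_step) / eps_good rmax ah ^+ 2)
  * n%:R `^ (- (1 / 2 + rate_exp)).
have a1 : 0 <= K.+1%:R * (2 * (C_loc rmax ah * C_gap)).
  by do 2 (apply: mulr_ge0 => //); apply: mulr_ge0; [exact: ltW|exact: powR_ge0].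
have a2 : 0 <= (vh + C_step) / eps_good rmax ah ^+ 2 by rewrite divr_ge0 ?addr_ge0// sqr_ge0.
apply: le_trans (expect_le P (bmeas_fubini2 P bmeas_loss2) (bmeas_scaled a) _) _; last first.
  apply: le_trans (expect_scaled_le _) _; first by rewrite mulr_ge0 ?addr_ge0 ?powR_ge0.
  by rewrite /a /C_loss mulrAC.
move=> y /=; apply: le_trans (loss_inner y) _; set w := fun i => Z i y.
rewrite {}/a; have r2 := eps_rate2 w.
have : dev2 n w <= n%:R `^ (- (1 / 2 + rate_exp)) * (1 + n%:R * dev2 n w) by apply: dev2_rate; lra.
rewrite gap_boundE ?(ltW (eps_gt0 w))//; move: r2.
set N := n%:R `^ _; set S := 1 + _; set e := eps w; set e' := e `^ _; move=> r2 rE.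
have -> : K.+1%:R * (2 * (C_loc rmax ah * (C_gap * e') * e)) + (vh + C_step) * (dev2 n w / eps_good rmax ah ^+ 2)
  = K.+1%:R * (2 * (C_loc rmax ah * C_gap)) * (e' * e) + (vh + C_step) / eps_good rmax ah ^+ 2 * dev2 n w by ring.
by rewrite -[leRHS]mulrA; exact: convex_le.
Qed.

Variable qm : R.
Hypotheses (qm_ge : forall k, q k 0 <= qm) (Cge0 : 0 <= C).

(** By concavity the difference lies between the size times the price before and after acceptance,
    and both prices are near [q] on a good sample. Bad samples are charged to [dev2]. *)
Lemma OPT_diff_near w z : (forall i, valid_req (w i)) -> valid_req z ->
  `|OPT M n b w - OPT M n (b - consumption M z) w - rsize z * q (rtype z) 0| <=
  bh * gap_bound rmax ah (eps w) + (C_step + bh * qm) * (dev2 n w / eps_good rmax ah ^+ 2).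
Proof.
move=> vw vz; have z0 := valid_req_size bl0 vz; pose k := rtype z.
have zbh : rsize z <= bh by case: vz => /andP[].
have q0 : 0 <= q k 0 by have := qe k; have := e10; lra.
have qmk := qm_ge k; have cg := C_step_ge0; have e0 := eps_good_gt0; have h0 := bh0.
have qm0 : 0 <= qm by exact: le_trans qmk.
have t20 : 0 <= (C_step + bh * qm) * (dev2 n w / eps_good rmax ah ^+ 2).
  apply: mulr_ge0; last by rewrite divr_ge0 ?sqr_ge0// dev2_ge0.
  by apply: addr_ge0 => //; apply: mulr_ge0.
have t10 : 0 <= bh * gap_bound rmax ah (eps w) by rewrite mulr_ge0// powR_ge0.
have cz := cons_cap vz.
have [gw|bw] := boolP (good w).
  apply: le_trans (_ : bh * gap_bound rmax ah (eps w) <= _); last by rewrite lerDl.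
  have [l dl] := dual_exists M n vw b_pos.
  have [l' dl'] : exists l', dual_at M n (b - consumption M z) w l'.
    by apply: (dual_exists M n vw) => j; apply: (cap_pos k j (size_range vz)).
  have h1 := OPT_diff_ge cz vw dl; have h2 := OPT_diff_le b_ge0 vw dl'.
  have [_ g1 _] := localize0 vw gw dl k.
  have [_ g2 _] := localize vw gw (size_range vz) dl' k.
  have gG : rsize z * gap_bound rmax ah (eps w) <= bh * gap_bound rmax ah (eps w).
    by rewrite ler_wpM2r// powR_ge0.
  have b1 : rsize z * (q k 0 - gap_bound rmax ah (eps w)) <= rsize z * price M l k.
    by rewrite ler_pM2l//; move: g1; rewrite /gap ler_norml => /andP[+ _]; lra.
  have b2 : rsize z * price M l' k <= rsize z * (q k 0 + gap_bound rmax ah (eps w)).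
    by rewrite ler_pM2l//; move: g2; rewrite /gap ler_norml => /andP[_]; lra.
  rewrite -/k in h1 h2 *; rewrite ler_norml; apply/andP; split; lra.
apply: le_trans (_ : C_step + bh * qm <= _); last first.
  rewrite -[leLHS]add0r; apply: lerD => //.
  rewrite ler_peMr//; first by apply: addr_ge0 => //; exact: mulr_ge0.
  rewrite ler_pdivlMr ?exprn_gt0// mul1r.
  by move: bw; rewrite /good -ltNge; exact: ltW.
have h1 := OPT_diff_crude vz vw.
have h2 : OPT M n (b - consumption M z) w <= OPT M n b w.
  apply: (OPT_mono M n cz vw) => j; rewrite mxE [X in _ + X]mxE gerBl.
  exact: (cons_ge0 bl0 A0 j vz).
have h3 : 0 <= rsize z * q k 0 by rewrite mulr_ge0// ltW.
have h4 : rsize z * q k 0 <= bh * qm by apply: ler_pM => //; exact: ltW.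
rewrite -/k; rewrite ler_norml; apply/andP; split; lra.
Qed.

Definition C_thr : R := (bh * C_gap + (C_step + bh * qm) / eps_good rmax ah ^+ 2) * (1 + C_dev).

Lemma Phi_diff_near z : valid_req z ->
  `|Phi M Z n b - Phi M Z n (b - consumption M z) - rsize z * q (rtype z) 0| <=
  C_thr * n%:R `^ (- rate_exp).
Proof.
move=> vz; have ka := rate_exp01; have cg := C_step_ge0; have e0 := eps_good_gt0; have h0 := bh0.
have qm0 : 0 <= qm by apply: le_trans (qm_ge ord0); have := qe ord0; have := e10; lra.
have m1 := bmeas_OPTZ bl0 A0 vh0 ZV n b.
have m2 := bmeas_OPTZ bl0 A0 vh0 ZV n (b - consumption M z).
have -> : Phi M Z n b - Phi M Z n (b - consumption M z) - rsize z * q (rtype z) 0 =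
  \int[P]_w (OPT M n b (fun i => Z i w) - OPT M n (b - consumption M z) (fun i => Z i w)
     - rsize z * q (rtype z) 0).
  rewrite !PhiE expect_B ?expect_B ?expect_cst//; [exact: bmeasB|exact: bmeas_cst].
pose a : R := (bh * C_gap + (C_step + bh * qm) / eps_good rmax ah ^+ 2) * n%:R `^ (- rate_exp).
have a1 : 0 <= bh * C_gap by rewrite mulr_ge0// powR_ge0.
have a2 : 0 <= (C_step + bh * qm) / eps_good rmax ah ^+ 2.
  by apply: divr_ge0; [apply: addr_ge0 => //; exact: mulr_ge0|exact: sqr_ge0].
have a0 : 0 <= a by rewrite mulr_ge0 ?addr_ge0 ?powR_ge0.
have bnd w' : (let w := fun i => Z i w' in
  `|OPT M n b w - OPT M n (b - consumption M z) w - rsize z * q (rtype z) 0|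
   <= a * (1 + n%:R * dev2 n w)).
  move=> w /=; have vw i : valid_req (w i) by exact: ZV.
  apply: le_trans (OPT_diff_near vw vz) _.
  rewrite /a; have r2 := eps_rate w.
  have : dev2 n w <= n%:R `^ (- rate_exp) * (1 + n%:R * dev2 n w) by apply: dev2_rate; lra.
  rewrite gap_boundE ?(ltW (eps_gt0 w))//; move: r2.
  set N := n%:R `^ _; set S := 1 + _; set e := eps w; set e' := e `^ _; move=> r2 rE.
  have -> : bh * (C_gap * e') + (C_step + bh * qm) * (dev2 n w / eps_good rmax ah ^+ 2)
    = bh * C_gap * e' + (C_step + bh * qm) / eps_good rmax ah ^+ 2 * dev2 n w by ring.
  by rewrite -[leRHS]mulrA; exact: convex_le.
have m3 : bmeas (fun w => OPT M n b (fun i => Z i w) -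
   OPT M n (b - consumption M z) (fun i => Z i w) - rsize z * q (rtype z) 0).
  by apply: bmeasB; [exact: bmeasB|exact: bmeas_cst].
have hup := expect_scaled_le a0.
have -> : C_thr * n%:R `^ (- rate_exp) = a * (1 + C_dev) by rewrite /C_thr /a mulrAC.
rewrite ler_norml; apply/andP; split.
  rewrite lerNl; apply: le_trans hup.
  rewrite -[leLHS]mulN1r -expect_Z//; apply: expect_le => //.
  - by apply: bmeasM => //; exact: bmeas_cst.
  - exact: bmeas_scaled.
  - by move=> w; rewrite mulN1r; have := bnd w; rewrite /= ler_norml => /andP[+ _]; lra.
apply: le_trans hup; apply: expect_le => //; first exact: bmeas_scaled.
by move=> w; have := bnd w; rewrite /= ler_norml => /andP[].
Qed.

Section drift.
Variable j : 'I_d.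
Local Notation acc z := (spm_accept M (Phi M Z) n.+1 b z).
Local Notation tau := (C_thr * n%:R `^ (- rate_exp) / bl).
Definition used (z : X) : R := rsize z * A j (rtype z) * ind (acc z).

Lemma nextcap_used z : nextcap M (Phi M Z) n.+1 b z j 0 = b j 0 - used z.
Proof.
rewrite /nextcap /used /ind; case: ifP => _; last by rewrite mulr0 subr0.
by rewrite mulr1 -consE !mxE.
Qed.

Lemma used_bound z : valid_req z -> 0 <= used z <= bh * ah.
Proof.
move=> vz; have h0 := bh0; have a0 := ah0; have z0 := valid_req_size bl0 vz.
have zb : rsize z <= bh by case: vz => /andP[].
rewrite /used /ind; case: ifP => _; last by rewrite mulr0 lexx mulr_ge0// ltW.
by rewrite mulr1 mulr_ge0 ?(ltW z0)//= ler_pM// ltW.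
Qed.

Lemma bmeas_used : bmeas (fun w => used (Z 0%N w)).
Proof.
split; last first.
  exists (bh * ah) => w; have /andP[h1 h2] := used_bound (ZV 0%N w).
  by rewrite ger0_norm.
rewrite /used; apply: measurable_funM.
  by under eq_fun do rewrite -consE; exact: (measurableT_comp (measurable_cons M j)).
rewrite /ind; apply: measurable_fun_ifT => //.
apply: (measurable_accept M _ n.+1 (cvmeas_cst b)) => // dY Y n' B mB.
by case: (bmeas_Phi bl0 A0 vh0 ZV n' mB).
Qed.

Definition near_price k (r : R) : bool := (q k 0 - tau <= r) && (r <= q k 0 + tau).

(** [tau] is the error of the SPM threshold divided by the smallest size, so that in units of the
    ratio it covers requests of every size. *)
Lemma acc_near z : valid_req z -> ~~ near_price (rtype z) (ratio z) -> acc z = fluid_rule z.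
Proof.
move=> vz; have h := Phi_diff_near vz; have z0 := valid_req_size bl0 vz.
have b0 : 0 < bl := bl0.
have zl : bl <= rsize z by case: vz => /andP[].
have rz : reward z = rsize z * ratio z by rewrite /ratio; field; rewrite gt_eqF.
have ct0 : 0 <= C_thr * n%:R `^ (- rate_exp) by exact: le_trans h.
have tl : C_thr * n%:R `^ (- rate_exp) <= rsize z * tau.
  by rewrite mulrA ler_pdivlMr// [X in _ <= X]mulrC; exact: ler_wpM2l.
have t0 : 0 <= tau by rewrite divr_ge0// ltW.
move: h; rewrite ler_norml => /andP[h1 h2].
have fz : [forall j, consumption M z j 0 <= b j 0].
  by apply/forallP => i; have := cons_cap vz i; rewrite mxE [X in _ + X]mxE subr_ge0.
rewrite /near_price negb_and -!ltNge => /orP nz.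
rewrite /spm_accept fz /= rz /fluid_rule; apply/idP/idP => [ha|hx].
  case: nz => nz; last lra.
  have : rsize z * ratio z < rsize z * (q (rtype z) 0 - tau) by rewrite ltr_pM2l.
  lra.
case: nz => nz; first lra.
have : rsize z * (q (rtype z) 0 + tau) < rsize z * ratio z by rewrite ltr_pM2l.
lra.
Qed.

Definition C_drift : R := K.+1%:R * (ah * ((2 * C + bh / e1) * (C_thr / bl))).

Lemma meas_near_price k : measurable [set r | near_price k r].
Proof.
rewrite (_ : [set r | _] = [set` `[q k 0 - tau, q k 0 + tau]%R]) ?meas_itv//.
Qed.

Lemma near_mass k : 0 <= tau -> mass M k (near_price k) <= (2 * C + bh / e1) * tau.
Proof.
move=> t0; have h0 := bh0; have cg := Cge0; have e10' := e10.
have [te|te] := leP tau e1.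
  rewrite mulrDl -[leLHS]addr0 lerD//; last by rewrite mulr_ge0// divr_ge0// ltW.
  have := @reg k true false (q k 0 - tau) (q k 0 + tau).
  rewrite (_ : [set` _] = [set r | near_price k r]); last first.
    by apply/seteqP; split => r; rewrite /= in_itv.
  have -> : q k 0 + tau - (q k 0 - tau) = 2 * tau by ring.
  rewrite /mass => hr; have {}hr : mu_ratio M k [set r | near_price k r] <= C * (2 * tau).
    by have /andP[] := hr ltac:(lra) ltac:(lra) ltac:(lra).
  by rewrite mulrCA mulrC mulrA [X in _ <= X * _]mulrC mulrC in hr *; lra.
(* Beyond distance [e1] regularity says nothing, but then [tau / e1] exceeds 1 and the total mass
   suffices. *)
apply: le_trans (mass_le_bh bl0 blh iidZ ZV T0 pi0 k (meas_near_price k)) _.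
apply: le_trans (_ : bh / e1 * tau <= _).
  by rewrite mulrAC ler_pdivlMr//; apply: ler_wpM2l => //; exact: ltW.
by rewrite mulrDl lerDr; apply: mulr_ge0 => //; apply: mulr_ge0.
Qed.

Lemma used_near z : valid_req z ->
  `|used z - \sum_k A j k * weight k (fun r => q k 0 <= r) z| <=
  \sum_k A j k * weight k (near_price k) z.
Proof.
move=> vz; pose k := rtype z; have z0 := valid_req_size bl0 vz.
have off (f : 'I_K.+1 -> R -> bool) : \sum_k A j k * weight k (f k) z =
    A j k * (rsize z * ind (f k (ratio z))).
  rewrite (bigD1 k)//= big1 ?addr0 /weight ?eqxx// => k' k'k.
  by rewrite eq_sym (negbTE k'k) /ind /= !mulr0.
rewrite !off /used -/k.
have -> : rsize z * A j k * ind (acc z) - A j k * (rsize z * ind (q k 0 <= ratio z)) =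
   A j k * rsize z * (ind (acc z) - ind (q k 0 <= ratio z)) by ring.
rewrite normrM [`|_ * rsize z|]ger0_norm ?mulr_ge0 ?(ltW z0)// mulrA ler_wpM2l ?mulr_ge0 ?(ltW z0)//.
have [nz|nz] := boolP (near_price k (ratio z)).
  by rewrite /ind /=; case: (acc z); case: (q k 0 <= ratio z); rewrite ?subrr ?subr0 ?sub0r ?normrN ?normr1 ?normr0 ?ler01.
by rewrite (acc_near vz nz) /fluid_rule subrr normr0 /ind.
Qed.

(** The fluid rule consumes rho on average, because [u] is the mass above [q] and [A *m u = rho].
    SPM deviates from it only for ratios in the band of width [2 * tau]. *)
Lemma drift_rate : `|\int[P]_w used (Z 0%N w) - rho j 0| <= C_drift * n%:R `^ (- rate_exp).
Proof.
have hAu : A *m u = rho by case: fp.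
have t0 : 0 <= tau.
  apply: divr_ge0; last exact: ltW.
  by apply: le_trans (Phi_diff_near (ZV 0%N (point : Omega))).
have mw k (f : R -> bool) : measurable [set r | f r] ->
    bmeas (fun w => A j k * weight k f (Z 0%N w)).
  by move=> mf; apply: bmeasM; [exact: bmeas_cst|exact: (bmeas_weightZ bl0 blh ZV 0 k mf)].
have ms (f : 'I_K.+1 -> R -> bool) : (forall k, measurable [set r | f k r]) ->
    bmeas (fun w => \sum_k A j k * weight k (f k) (Z 0%N w)).
  by move=> mf; apply: bmeas_sum => k; exact: mw.
have mI (f : 'I_K.+1 -> R -> bool) : (forall k, measurable [set r | f k r]) ->
    \int[P]_w (\sum_k A j k * weight k (f k) (Z 0%N w)) = \sum_k A j k * mass M k (f k).
  move=> mf; rewrite expect_sum => [|k]; last exact: mw.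
  apply: eq_bigr => k _; rewrite expect_Z; last exact: (bmeas_weightZ bl0 blh ZV 0 k (mf k)).
  by rewrite (massE bl0 blh iidZ ZV T0 pi0 k (mf k)).
have rE : rho j 0 = \int[P]_w (\sum_k A j k * weight k (fun r => q k 0 <= r) (Z 0%N w)).
  rewrite (mI (fun k r => q k 0 <= r)) => [|k]; last exact: meas_ge.
  by rewrite -hAu mxE; apply: eq_bigr => k _; rewrite step_utail.
have mN := ms near_price meas_near_price.
have mU := ms (fun k r => q k 0 <= r) (fun k => meas_ge _).
have mD := bmeasB bmeas_used mU.
rewrite rE -expect_B//; last exact: bmeas_used.
apply: le_trans (_ : \int[P]_w (\sum_k A j k * weight k (near_price k) (Z 0%N w)) <= _).
  rewrite ler_norml; apply/andP; split.
    rewrite lerNl -mulN1r -expect_Z//; apply: expect_le => //.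
      by apply: bmeasM => //; exact: bmeas_cst.
    by move=> w; have := used_near (ZV 0%N w); rewrite ler_norml => /andP[+ _]; lra.
  by apply: expect_le => // w; have := used_near (ZV 0%N w); rewrite ler_norml => /andP[].
rewrite (mI near_price meas_near_price).
have -> : C_drift * n%:R `^ (- rate_exp) = K.+1%:R * (ah * ((2 * C + bh / e1) * tau)).
  by rewrite /C_drift; ring.
rewrite -[K.+1 in leRHS]card_ord mulr_natl -sumr_const; apply: ler_sum => k _.
apply: ler_pM => //; first exact: (mass_ge0 bl0 blh iidZ ZV T0 pi0 k (meas_near_price k)).
exact: near_mass.
Qed.

End drift.

End step.

(** * The potential and the backward induction *)

Section potential.
Context (R : realType).

(** The squared distance from [x] to the interval from [- m] to [m]. *)
Definition excess_sq (m x : R) : R := Num.max 0 (`|x| - m) ^+ 2.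

Lemma excess_sq_ge0 m x : 0 <= excess_sq m x.
Proof. exact: sqr_ge0. Qed.

Lemma excess_sq_le m x y : `|y| <= m -> excess_sq m x <= (x - y) ^+ 2.
Proof.
move=> ym; rewrite /excess_sq -[leRHS]real_normK ?num_real//.
apply: lerXn2r; rewrite ?nnegrE ?normr_ge0//; first by rewrite le_max lexx.
rewrite ge_max normr_ge0/=; apply: le_trans (lerB_dist _ _).
exact: lerB.
Qed.

Lemma excess_sq_large m a x : 0 <= a -> m + a <= `|x| -> a ^+ 2 <= excess_sq m x.
Proof.
move=> a0 h; apply: lerXn2r; rewrite ?nnegrE//; first by rewrite le_max lexx.
by rewrite le_max; apply/orP; right; lra.
Qed.

Context dO (Omega : measurableType dO) (P : probability Omega R).

Lemma bmeas_excess_sq m (f : Omega -> R) : bmeas f -> bmeas (fun w => excess_sq m (f w)).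
Proof.
move=> [mf [B fB]]; apply: bmeasX; split.
  apply: measurable_maxr; first exact: measurable_cst.
  apply: measurable_funB; last exact: measurable_cst.
  exact: measurableT_comp.
exists (B + `|m|) => w; rewrite ger0_norm ?le_max ?lexx//.
have := fB w; have := ler_norm (- m); rewrite normrN => h1 h2.
have := normr_ge0 (f w); have := normr_ge0 m.
by move=> h3 h4; rewrite ge_max; apply/andP; split; lra.
Qed.

(** [r] is the old distance with its sign and [e'] the displacement of the nearest point. The
    assumption on their product removes the first-order term, and only second-order terms remain. *)
Lemma sq_step (r t e e' B1 : R) (zeta : Omega -> R) :
  bmeas zeta -> (forall w, `|zeta w| <= B1) ->
  r * (t * \int[P]_w zeta w - e') <= 0 -> `|e'| <= e ->
  \int[P]_w (r + t * zeta w - e') ^+ 2 <= r ^+ 2 + 2 * (t ^+ 2 * B1 ^+ 2 + e ^+ 2).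
Proof.
move=> mz zB rn ee.
have -> : (fun w => (r + t * zeta w - e') ^+ 2) = fun w => (r ^+ 2 - 2 * r * e') +
   ((2 * r * t) * zeta w + (t * zeta w - e') ^+ 2).
  by apply/funext => w; ring.
have m1 : bmeas (fun w => (2 * r * t) * zeta w) by apply: bmeasM => //; exact: bmeas_cst.
have m2 : bmeas (fun w => (t * zeta w - e') ^+ 2).
  by apply: bmeasX; apply: bmeasB; [apply: bmeasM => //; exact: bmeas_cst|exact: bmeas_cst].
rewrite expect_D; [|exact: bmeas_cst|exact: bmeasD].
rewrite expect_cst expect_D// expect_Z//.
suff : \int[P]_w (t * zeta w - e') ^+ 2 <= 2 * (t ^+ 2 * B1 ^+ 2 + e ^+ 2) by lra.
apply: expect_le_cst => // w.
have h1 : zeta w ^+ 2 <= B1 ^+ 2.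
  by rewrite -[leLHS]real_normK ?num_real//; apply: lerXn2r; rewrite ?nnegrE ?normr_ge0//; exact: le_trans (zB w).
have h2 : e' ^+ 2 <= e ^+ 2.
  by rewrite -[leLHS]real_normK ?num_real//; apply: lerXn2r; rewrite ?nnegrE ?normr_ge0//; exact: le_trans ee.
have h3 : t ^+ 2 * zeta w ^+ 2 <= t ^+ 2 * B1 ^+ 2 by apply: ler_wpM2l => //; exact: sqr_ge0.
have h4 : 0 <= (t * zeta w + e') ^+ 2 by exact: sqr_ge0.
have -> : (t * zeta w - e') ^+ 2 = 2 * (t ^+ 2 * zeta w ^+ 2 + e' ^+ 2) - (t * zeta w + e') ^+ 2.
  by ring.
lra.
Qed.

(** The flat interval grows by at least the mean displacement, so beyond either end the mean motion
    does not increase the distance. *)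
Lemma excess_sq_step (m e t x B1 : R) (zeta : Omega -> R) :
  bmeas zeta -> (forall w, `|zeta w| <= B1) -> 0 <= m -> 0 <= t ->
  t * `|\int[P]_w zeta w| <= e ->
  \int[P]_w excess_sq (m + e) (x + t * zeta w) <= excess_sq m x + 2 * (t ^+ 2 * B1 ^+ 2 + e ^+ 2).
Proof.
move=> mz zB m0 t0 ze.
have e0 : 0 <= e by apply: le_trans ze; rewrite mulr_ge0.
have mx : bmeas (fun w => x + t * zeta w).
  by apply: bmeasD; [exact: bmeas_cst|apply: bmeasM => //; exact: bmeas_cst].
have mh := bmeas_excess_sq (m + e) mx.
(* [y] is the point of the widened interval from which the new distance is estimated; it is 0 if [x]
   is inside, and otherwise the endpoint on the side of [x]. *)
have key (y e' r : R) : `|y| <= m + e -> r - e' = x - y -> `|e'| <= e ->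
    r * (t * \int[P]_w zeta w - e') <= 0 -> r ^+ 2 <= excess_sq m x ->
    \int[P]_w excess_sq (m + e) (x + t * zeta w) <= excess_sq m x + 2 * (t ^+ 2 * B1 ^+ 2 + e ^+ 2).
  move=> ym ry ee rn rx.
  apply: le_trans (_ : \int[P]_w (r + t * zeta w - e') ^+ 2 <= _).
    apply: expect_le => //.
      apply: bmeasX; apply: bmeasB; last exact: bmeas_cst.
      by apply: bmeasD; [exact: bmeas_cst|apply: bmeasM => //; exact: bmeas_cst].
    move=> w; have -> : r + t * zeta w - e' = x + t * zeta w - y by lra.
    exact: excess_sq_le.
  apply: le_trans (sq_step mz zB rn ee) _; lra.
have abs := ler_norm (\int[P]_w zeta w); have absN := ler_norm (- \int[P]_w zeta w).
rewrite normrN in absN.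
have tz1 : t * \int[P]_w zeta w <= e by apply: le_trans ze; exact: ler_wpM2l.
have tz2 : - e <= t * \int[P]_w zeta w.
  by rewrite lerNl -mulrN; apply: le_trans ze; exact: ler_wpM2l.
have [xm|xm] := leP `|x| m.
  apply: (key x 0 0); rewrite ?normr0 ?expr0n ?mul0r ?subrr ?excess_sq_ge0//.
  lra.
have hx : excess_sq m x = (`|x| - m) ^+ 2.
  by rewrite /excess_sq max_r// subr_ge0 ltW.
have [x0|x0] := leP 0 x.
  rewrite (ger0_norm x0) in xm hx.
  apply: (key (m + e) e (x - m)).
  - by rewrite ger0_norm// addr_ge0.
  - by ring.
  - by rewrite ger0_norm.
  - by apply: mulr_ge0_le0; lra.
  - by rewrite hx.
rewrite (ltr0_norm x0) in xm hx.
apply: (key (- (m + e)) (- e) (x + m)).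
- by rewrite normrN ger0_norm// addr_ge0.
- by ring.
- by rewrite normrN ger0_norm.
- by apply: mulr_le0_ge0; lra.
- by rewrite hx -[leLHS]sqrrN; have -> : - (x + m) = - x - m by ring.
Qed.

(** With [y = 1 / n] the difference is [n%:R]^ (- k)[times]1 - (1 + y) [^ (- k)], and
    [y / 2 <= ln (1 + y) <= y]. The 4 combines this 2 with the one lost in inverting
    [1 + k * y / 2]. *)
Lemma powR_step (k : R) (n : nat) : 0 < k <= 1 -> (0 < n)%N ->
  k / 4 * n%:R `^ (- k) / n%:R <= n%:R `^ (- k) - n.+1%:R `^ (- k) <= n%:R^-1.
Proof.
move=> /andP[k0 k1] n0; have nR : 0 < (n%:R : R) by rewrite ltr0n.
have n1 : 1 <= (n%:R : R) by rewrite ler1n.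
pose y : R := n%:R^-1; have y0 : 0 < y by rewrite invr_gt0.
have y1 : y <= 1 by rewrite invf_le1.
have nS : (n.+1%:R : R) = n%:R * (1 + y) by rewrite mulrDr mulr1 mulfV ?gt_eqF// natr1.
have y1p : 0 < 1 + y by lra.
have N0 : 0 < (n%:R : R) `^ (- k) by rewrite powR_gt0.
have N1 : (n%:R : R) `^ (- k) <= 1.
  by apply: le_trans (_ : n%:R `^ 0 <= _); [apply: ler_powR => //; lra|rewrite powRr0].
rewrite nS powRM ?(ltW nR) ?(ltW y1p)// -[X in X - _]mulr1 -mulrBr.
have lnle : ln (1 + y) <= y by apply: le_ln1Dx; lra.
have lnge : y / 2 <= ln (1 + y).
  have h : ln ((1 + y)^-1) <= (1 + y)^-1 - 1.
    have e1 : 1 + ((1 + y)^-1 - 1) = (1 + y)^-1 by ring.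
    have := @le_ln1Dx _ ((1 + y)^-1 - 1); rewrite e1; apply.
    have : 0 < (1 + y)^-1 by rewrite invr_gt0.
    lra.
  rewrite lnV ?posrE// in h.
  have h2 : y / 2 <= 1 - (1 + y)^-1.
    have -> : 1 - (1 + y)^-1 = y / (1 + y) by field; rewrite gt_eqF.
    apply: ler_wpM2l; first exact: ltW.
    by rewrite lef_pV2 ?posrE//; lra.
  lra.
have E : (1 + y) `^ (- k) = expR (- k * ln (1 + y)) by rewrite /powR gt_eqF.
rewrite E; apply/andP; split.
  rewrite -[leLHS]mulrA [k / 4 * _]mulrC -mulrA ler_pM2l// -/y.
  have h : 1 + k * ln (1 + y) <= expR (k * ln (1 + y)) by exact: expR_ge1Dx.
  rewrite mulNr expRN.
  have kl : k * (y / 2) <= k * ln (1 + y) by rewrite ler_pM2l.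
  have kl1 : k * y <= 1 by rewrite -[leRHS]mulr1; apply: ler_pM => //; exact: ltW.
  have ky0 : 0 < k * y by rewrite mulr_gt0.
  have d0 : 0 < 1 + k * (y / 2) by lra.
  have : (expR (k * ln (1 + y)))^-1 <= (1 + k * (y / 2))^-1.
    by rewrite lef_pV2 ?posrE ?expR_gt0//; lra.
  have : (1 + k * (y / 2))^-1 <= 1 - k * y / 4.
    rewrite -[leLHS]mul1r ler_pdivrMr//.
    have -> : (1 - k * y / 4) * (1 + k * (y / 2)) = 1 + k * y / 4 - (k * y) ^+ 2 / 8 by field.
    have : (k * y) ^+ 2 <= k * y by rewrite expr2 ler_piMl// ltW.
    lra.
  have -> : y * (k / 4) = k * y / 4 by ring.
  lra.
rewrite -/y; have h : 1 + - k * ln (1 + y) <= expR (- k * ln (1 + y)) by exact: expR_ge1Dx.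
have l0 : 0 <= ln (1 + y) by lra.
have kl : k * ln (1 + y) <= y.
  by apply: le_trans lnle; rewrite ler_piMl.
apply: le_trans (_ : 1 * (1 - expR (- k * ln (1 + y))) <= _); last lra.
apply: ler_wpM2r => //; rewrite subr_ge0 -[leRHS]expR0 ler_expR mulNr oppr_le0.
by rewrite mulr_ge0// ltW.
Qed.

End potential.

Section induction.
Context (R : realType) (d K : nat) (M : model R d K).
Local Notation A := (direction M).
Local Notation X := (request R K).
Variables (bl bh vh : R).
Hypotheses (bl0 : 0 < bl) (A0 : forall j k, 0 <= A j k) (blh : bl <= bh) (vh0 : 0 <= vh).
Local Notation valid_req := (@valid_req R K bl bh vh).
Variables (e1 c C p : R) (Bm : 'M[R]_(K.+1, d)).
Hypotheses (e10 : 0 < e1) (c0 : 0 < c) (p1 : 1 <= p) (ABm : A *m Bm = 1%:M) (Cge0 : 0 <= C).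
Context dO (Omega : measurableType dO) (P : probability Omega R).
Variables (Z : nat -> {RV P >-> X}) (T : nat).
Hypothesis iidZ : iid_requests M Z T.
Hypothesis ZV : forall t w, valid_req (Z t w).
Hypothesis T0 : (0 < T)%N.
Hypothesis pi0 : forall k, 0 < type_prob M k.
Variables (ah rmin rmax qm delta : R) (rho0 : 'cV[R]_d).
Hypotheses (ah0 : 0 < ah) (rmin0 : 0 < rmin) (Aah : forall j k, A j k <= ah)
  (dl0 : 0 < delta) (d0 : (0 < d)%N).
Hypothesis box : forall rho : 'cV[R]_d, (forall j, `|rho j 0 - rho0 j 0| <= delta / 2) ->
  (forall j, rmin <= rho j 0 <= rmax) /\
  exists q u, [/\ fluid_pair M rho q u, forall k, 0 <= q k 0 - e1, forall k, q k 0 <= qm &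
    forall k b1 b2 x y, q k 0 - e1 <= x -> x <= y -> y <= q k 0 + e1 ->
        c * (y - x) `^ p <= mu_ratio M k [set` Interval (BSide b1 x) (BSide b2 y)]
          <= C * (y - x)].

Local Notation rate_exp := (rate_exp p).
Definition C_loss_abs : R := `|C_loss bh vh e1 c p Bm rmax ah rmin|.
Definition C_drift_abs : R := `|C_drift bl bh vh e1 c C p Bm rmax ah rmin qm|.
(** Cancels the factor [rate_exp / 4] of [powR_step], so that in each period the margin widens by at
    least the bound on the mean displacement. *)
Definition C_widen : R := 4 * C_drift_abs / rate_exp.
(* The flat part of the potential widens as fewer periods remain; the widening
   absorbs the drift, of order [s `^ (- rate_exp)], of the capacity ratio. *)
Definition margin (s : nat) : R := delta / 8 + C_widen * s%:R `^ (- rate_exp).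
Definition potential s (rho : 'cV[R]_d) : R := \sum_j excess_sq (margin s) (rho j 0 - rho0 j 0).
Definition C_pot : R := 2 * ((bh * ah + rmax) ^+ 2 + C_widen ^+ 2).
(** The margin is at most [delta / 4], so outside the box of half-width [delta / 2] the potential is
    at least [delta ^+ 2 / 16], and [C_out] times it is at least [vh]. *)
Definition C_out : R := 16 * vh / delta ^+ 2.
Definition C_sum : R := C_loss_abs + C_out * (d%:R * C_pot).

Variable s0 : nat.
Hypotheses (s0_gt0 : (0 < s0)%N)
  (s0_big : forall n, (s0 <= n)%N -> (bh + 1) * ah <= n%:R * rmin /\
     C_widen * n%:R `^ (- rate_exp) <= delta / 8).

Let ka : 0 < rate_exp <= 1 / 2. Proof. exact: rate_exp01. Qed.

Lemma potential_ge0 s rho : 0 <= potential s rho.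
Proof. by apply: sumr_ge0 => j _; exact: excess_sq_ge0. Qed.

Lemma C_widen_ge0 : 0 <= C_widen.
Proof.
have /andP[k0 _] := ka; rewrite /C_widen; apply: divr_ge0; last exact: ltW.
by apply: mulr_ge0 => //; exact: normr_ge0.
Qed.

Lemma margin_step n : (0 < n)%N ->
  C_drift_abs * n%:R `^ (- rate_exp) / n%:R <= margin n - margin n.+1 <= C_widen / n%:R.
Proof.
move=> n0; have /andP[k0 k1] := ka; have D0 := C_widen_ge0.
have k01 : 0 < rate_exp <= 1 by rewrite k0/=; lra.
have /andP[h1 h2] := powR_step k01 n0.
have -> : margin n - margin n.+1 = C_widen * (n%:R `^ (- rate_exp) - n.+1%:R `^ (- rate_exp)).
  by rewrite /margin; ring.
apply/andP; split; last exact: ler_wpM2l.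
apply: le_trans (ler_wpM2l D0 h1).
have -> : C_widen * (rate_exp / 4 * n%:R `^ (- rate_exp) / n%:R) = C_drift_abs * n%:R `^ (- rate_exp) / n%:R.
  by rewrite /C_widen; field; rewrite !gt_eqF// ltr0n.
by [].
Qed.

Section one_step.
Variables (n : nat) (rho : 'cV[R]_d).
Hypotheses (sn : (s0 <= n)%N) (nT : (n < T)%N)
  (near0 : forall j, `|rho j 0 - rho0 j 0| <= delta / 2).
Let b := n.+1%:R *: rho.
Local Notation nc w := (nextcap M (Phi M Z) n.+1 b (Z 0%N w)).

Let n0 : (0 < n)%N. Proof. exact: leq_trans sn. Qed.

Lemma mPhi dY (Y : measurableType dY) m (B : Y -> 'cV[R]_d) : cvmeas B ->
  measurable_fun setT (fun y => Phi M Z m (B y)).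
Proof. by move=> mB; case: (bmeas_Phi bl0 A0 vh0 ZV m mB). Qed.

Lemma potential_step :
  \int[P]_w potential n (n%:R^-1 *: nc w) <= potential n.+1 rho + d%:R * C_pot / n%:R ^+ 2.
Proof.
have nR : 0 < (n%:R : R) by rewrite ltr0n.
have [rr [q [u [fp qe qmm reg]]]] := box near0.
have [nbig _] := s0_big sn.
have bE : b = n.+1%:R *: rho by [].
have D0 := C_widen_ge0.
pose zeta j w := rho j 0 - used M Z n b j (Z 0%N w).
have mz j : bmeas (zeta j).
  by apply: bmeasB; [exact: bmeas_cst|exact: (bmeas_used bl0 A0 blh vh0 ZV ah0 Aah)].
(* Since the capacity is [(n + 1) rho], the ratio for [n] periods changes by exactly
   [(rho - used) / n]. *)
have E j w : (n%:R^-1 *: nc w) j 0 - rho0 j 0 = rho j 0 - rho0 j 0 + n%:R^-1 * zeta j w.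
  rewrite mxE nextcap_used /zeta bE mxE -natr1; field.
  by rewrite gt_eqF.
have zB j w : `|zeta j w| <= bh * ah + rmax.
  have /andP[h1 h2] := used_bound bl0 A0 blh Z ah0 Aah n b j (ZV 0%N w).
  have /andP[h3 h4] := rr j; have h5 := rmin0.
  by rewrite /zeta ler_norml; apply/andP; split; lra.
have mp j : bmeas (fun w => excess_sq (margin n) ((n%:R^-1 *: nc w) j 0 - rho0 j 0)).
  apply: bmeas_excess_sq; under eq_fun do rewrite E.
  by apply: bmeasD; [exact: bmeas_cst|apply: bmeasM => //; exact: bmeas_cst].
have -> : d%:R * C_pot / n%:R ^+ 2 = \sum_(j < d) C_pot / n%:R ^+ 2.
  by rewrite sumr_const card_ord -[RHS]mulr_natl mulrA.
rewrite expect_sum// /potential -big_split/=.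
apply: ler_sum => j _.
have /andP[e1' e2'] := margin_step n0.
pose e := margin n - margin n.+1.
have em : margin n = margin n.+1 + e by rewrite /e; ring.
have m0 : 0 <= margin n.+1.
  by rewrite addr_ge0//; [rewrite divr_ge0// ltW|rewrite mulr_ge0// powR_ge0].
have t0 : 0 <= (n%:R^-1 : R) by rewrite invr_ge0.
have ez : n%:R^-1 * `|\int[P]_w zeta j w| <= e.
  apply: le_trans e1'; rewrite [X in _ <= X]mulrC; apply: ler_wpM2l => //.
  rewrite expect_B ?expect_cst; [|exact: bmeas_cst|exact: (bmeas_used bl0 A0 blh vh0 ZV ah0 Aah)].
  rewrite distrC; apply: le_trans (drift_rate bl0 A0 blh vh0 e10 c0 p1 ABm iidZ ZV T0 pi0 fp qe reg
    ah0 rmin0 Aah rr n0 nT bE nbig d0 qmm Cge0 j) _.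
  by apply: ler_wpM2r; [exact: powR_ge0|exact: ler_norm].
under eq_Rintegral do rewrite E em.
apply: le_trans (excess_sq_step (rho j 0 - rho0 j 0) (mz j) (zB j) m0 t0 ez) _.
rewrite lerD2l /C_pot -/e.
have h : e ^+ 2 <= C_widen ^+ 2 / n%:R ^+ 2.
  rewrite -exprVn -exprMn; apply: lerXn2r => //.
    by rewrite nnegrE; apply: le_trans ez; rewrite mulr_ge0.
  by rewrite nnegrE; apply: divr_ge0.
have -> : 2 * ((bh * ah + rmax) ^+ 2 + C_widen ^+ 2) / n%:R ^+ 2 =
   2 * (n%:R^-1 ^+ 2 * (bh * ah + rmax) ^+ 2 + C_widen ^+ 2 / n%:R ^+ 2) by rewrite exprVn; ring.
lra.
Qed.

Lemma loss_to_go_step_local (a : R) :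
  (forall b', nonneg_vec b' -> loss_to_go M Z n b' <= a + C_out * n%:R * potential n (n%:R^-1 *: b')) ->
  loss_to_go M Z n.+1 b <= a + C_sum * n%:R `^ (- (1 / 2 + rate_exp)) + C_out * n.+1%:R * potential n.+1 rho.
Proof.
move=> IH; have nR : 0 < (n%:R : R) by rewrite ltr0n.
have n1 : 1 <= (n%:R : R) by rewrite ler1n.
have /andP[k0 k1] := ka.
have [rr [q [u [fp qe qmm reg]]]] := box near0.
have [nbig _] := s0_big sn.
have bE : b = n.+1%:R *: rho by [].
have bge0 : nonneg_vec b.
  move=> j; rewrite mxE mulr_ge0//; have /andP[h _] := rr j; apply: le_trans h; exact: ltW.
have B0 : 0 <= C_out by rewrite /C_out divr_ge0 ?sqr_ge0// mulr_ge0.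
have hloss := loss_rate bl0 A0 blh vh0 e10 c0 p1 ABm iidZ ZV T0 pi0 fp qe reg
    ah0 rmin0 Aah rr n0 nT bE nbig d0.
have mx := measurable_fluid_rule q.
have xb := @fluid_rule_feasible _ _ _ _ bl bh vh bl0 A0 rho q rmax ah rmin rmin0 Aah rr n b n0 bE nbig.
apply: le_trans (loss_to_go_step bl0 A0 blh vh0 iidZ ZV nT mx xb) _.
have mZ0 : measurable_fun setT (Z 0%N) by [].
have mnc : cvmeas (fun w => nc w).
  exact: (cvmeas_nextcap M mPhi n.+1 (cvmeas_cst b) mZ0).
have mG : bmeas (fun w => loss_to_go M Z n (nc w)) by exact: (bmeas_loss_to_go bl0 A0 vh0 ZV n mnc).
have mphi : bmeas (fun w => potential n (n%:R^-1 *: nc w)).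
  apply: bmeas_sum => j; apply: bmeas_excess_sq; apply: bmeasB; last exact: bmeas_cst.
  under eq_fun do rewrite mxE nextcap_used.
  apply: bmeasM; first exact: bmeas_cst.
  by apply: bmeasB; [exact: bmeas_cst|exact: (bmeas_used bl0 A0 blh vh0 ZV ah0 Aah)].
have hG : \int[P]_w loss_to_go M Z n (nc w) <= a + C_out * n%:R * \int[P]_w potential n (n%:R^-1 *: nc w).
  rewrite -expect_Z// -[X in _ <= X + _](expect_cst P) -expect_D.
  - apply: expect_le => //.
      by apply: bmeasD; [exact: bmeas_cst|apply: bmeasM => //; exact: bmeas_cst].
    by move=> w; apply: IH; exact: nextcap_ge0.
  - exact: bmeas_cst.
  - by apply: bmeasM => //; exact: bmeas_cst.
have hp := potential_step.
have C30 : 0 <= C_pot by rewrite /C_pot mulr_ge0// addr_ge0// sqr_ge0.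
have h1 : C_out * n%:R * \int[P]_w potential n (n%:R^-1 *: nc w) <=
    C_out * n%:R * potential n.+1 rho + C_out * (d%:R * C_pot) / n%:R.
  have -> : C_out * n%:R * potential n.+1 rho + C_out * (d%:R * C_pot) / n%:R =
    C_out * n%:R * (potential n.+1 rho + d%:R * C_pot / n%:R ^+ 2).
    by field; rewrite gt_eqF.
  by apply: ler_wpM2l => //; rewrite mulr_ge0.
have h2 : C_out * n%:R * potential n.+1 rho <= C_out * n.+1%:R * potential n.+1 rho.
  apply: ler_wpM2r; first exact: potential_ge0.
  by apply: ler_wpM2l => //; rewrite ler_nat.
(* The weighted growth of the potential, of order [1 / n], is absorbed into the rate of the loss
   because [rate_exp <= 1 / 2]. *)
have inv : (n%:R^-1 : R) <= n%:R `^ (- (1 / 2 + rate_exp)).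
  by rewrite -powR_inv1 ?(ltW nR)//; apply: ler_powR => //; lra.
have h3 : C_out * (d%:R * C_pot) / n%:R <= C_out * (d%:R * C_pot) * n%:R `^ (- (1 / 2 + rate_exp)).
  by apply: ler_wpM2l => //; apply: mulr_ge0 => //; apply: mulr_ge0.
have h4 : C_loss bh vh e1 c p Bm rmax ah rmin * n%:R `^ (- (1 / 2 + rate_exp)) <=
   C_loss_abs * n%:R `^ (- (1 / 2 + rate_exp)).
  by apply: ler_wpM2r; [exact: powR_ge0|exact: ler_norm].
rewrite /C_sum mulrDl; lra.
Qed.

End one_step.

Lemma potential_far s (rho : 'cV[R]_d) j : (s0 <= s)%N -> delta / 2 < `|rho j 0 - rho0 j 0| ->
  delta ^+ 2 / 16 <= potential s rho.
Proof.
move=> ss far; have [_ ms] := s0_big ss; have dl := dl0.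
rewrite /potential (bigD1 j)//= -[leLHS]addr0 lerD//; last by apply: sumr_ge0 => i _; exact: excess_sq_ge0.
have -> : delta ^+ 2 / 16 = (delta / 4) ^+ 2 by field.
apply: excess_sq_large; first lra.
rewrite /margin; lra.
Qed.

Lemma C_sum_ge0 : 0 <= C_sum.
Proof.
have B0 : 0 <= C_out by rewrite /C_out divr_ge0 ?sqr_ge0// mulr_ge0.
have C30 : 0 <= C_pot by rewrite /C_pot mulr_ge0// addr_ge0// sqr_ge0.
rewrite /C_sum /C_loss_abs; apply: addr_ge0; first exact: normr_ge0.
by apply: mulr_ge0 => //; apply: mulr_ge0.
Qed.

(** Up to [s0] periods the crude bound is covered by the first term, and outside the box by the
    potential. Only inside the box is the induction hypothesis used. *)
Lemma loss_to_go_induction s b : (s <= T)%N -> nonneg_vec b ->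
  loss_to_go M Z s b <= s0%:R * vh + C_sum * \sum_(1 <= n < s) n%:R `^ (- (1 / 2 + rate_exp))
    + C_out * s%:R * potential s (s%:R^-1 *: b).
Proof.
have B0 : 0 <= C_out by rewrite /C_out divr_ge0 ?sqr_ge0// mulr_ge0.
have C40 := C_sum_ge0; have vh0' := vh0; have dl := dl0.
have S0 s' : 0 <= \sum_(1 <= n < s') (n%:R : R) `^ (- (1 / 2 + rate_exp)).
  by apply: sumr_ge0 => i _; exact: powR_ge0.
elim: s b => [|n IH] b nT b0.
  apply: le_trans (loss_to_go_le bl0 A0 vh0 ZV 0 b) _; rewrite mul0r.
  by rewrite big_geq// !mulr0 mul0r !addr0 mulr_ge0.
have t1 : 0 <= C_sum * \sum_(1 <= n < n.+1) (n%:R : R) `^ (- (1 / 2 + rate_exp)) by rewrite mulr_ge0.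
have t2 : 0 <= C_out * n.+1%:R * potential n.+1 (n.+1%:R^-1 *: b) by apply: mulr_ge0; [apply: mulr_ge0|exact: potential_ge0].
have t3 : 0 <= s0%:R * vh by rewrite mulr_ge0.
have gl := loss_to_go_le bl0 A0 vh0 ZV n.+1 b.
have [sn|sn] := leqP n.+1 s0.
  have : n.+1%:R * vh <= s0%:R * vh by rewrite ler_wpM2r// ler_nat.
  lra.
rewrite ltnS in sn; have n0 : (0 < n)%N by exact: leq_trans sn.
pose rho := n.+1%:R^-1 *: b.
have bE : b = n.+1%:R *: rho by rewrite scalerA mulfV ?scale1r// pnatr_eq0.
have [/forallP near0|] := boolP [forall j, `|rho j 0 - rho0 j 0| <= delta / 2].
  have := @loss_to_go_step_local n rho sn nT near0 (s0%:R * vh + C_sum * \sum_(1 <= n < n) n%:R `^ (- (1 / 2 + rate_exp))).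
  rewrite -bE -/rho big_nat_recr//= mulrDr !addrA; apply => b' b'0.
  by apply: IH => //; exact: ltnW.
rewrite negb_forall => /existsP[j]; rewrite -ltNge => far.
have h := @potential_far n.+1 rho j (leqW sn) far.
have : n.+1%:R * vh <= C_out * n.+1%:R * potential n.+1 rho.
  apply: le_trans (_ : C_out * n.+1%:R * (delta ^+ 2 / 16) <= _).
    by rewrite [leLHS](_ : _ = C_out * n.+1%:R * (delta ^+ 2 / 16))// /C_out; field; rewrite gt_eqF.
  by apply: ler_wpM2l => //; rewrite mulr_ge0.
rewrite -/rho; lra.
Qed.

Lemma loss_to_go_bound b : nonneg_vec b -> T%:R^-1 *: b = rho0 ->
  loss_to_go M Z T b <= s0%:R * vh + C_sum * \sum_(1 <= n < T) n%:R `^ (- (1 / 2 + rate_exp)).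
Proof.
move=> b0 bE; apply: le_trans (loss_to_go_induction (leqnn T) b0) _.
suff -> : potential T (T%:R^-1 *: b) = 0 by rewrite mulr0 addr0.
rewrite bE /potential; apply: big1 => j _; rewrite subrr /excess_sq normr0 sub0r max_l ?expr0n// oppr_le0 /margin.
have dl := dl0; have := C_widen_ge0; move=> D0.
apply: addr_ge0; first by rewrite divr_ge0// ltW.
by apply: mulr_ge0 => //; exact: powR_ge0.
Qed.

End induction.

(** * Almost surely valid requests *)

Section integral_off_null.
Context (R : realType) dT (T : measurableType dT) (mu : {measure set T -> \bar R}).
Import HBNNSimple.
Local Open Scope ereal_scope.

(* No measurability is assumed: OPT of a sequence with invalid requests need not
   be measurable. *)
Lemma le_integral_off_null (f g : T -> \bar R) (N : set T) : measurable N -> mu N = 0 ->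
  (forall x, 0 <= f x) -> (forall x, 0 <= g x) -> (forall x, ~ N x -> f x <= g x) ->
  \int[mu]_x f x <= \int[mu]_x g x.
Proof.
move=> mN N0 f0 g0 fg; rewrite [X in X <= _]ge0_integralTE//.
apply: ge_ereal_sup => _ [h /= hf <-].
(* Cutting a simple function below [f] off on [N] keeps its integral and puts it below [g]. *)
pose h' := proj_nnsfun h (measurableC mN).
have h'E x : h' x = (h x * \1_(~` N) x)%R by [].
have -> : sintegral mu h = sintegral mu h'.
  have := integral_nnsfun mu measurableT h; rewrite patch_setT => <-.
  have := integral_nnsfun mu measurableT h'; rewrite patch_setT => <-.
  apply: ae_eq_integral => //; [exact/measurable_EFinP|exact/measurable_EFinP|].
  exists N; split => // x /=; apply: contra_notP => Nx _.
  by rewrite -[mindic _ _]/(\1_(~` N) : T -> R) indicE mem_set// mulr1.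
rewrite ge0_integralTE//; apply: ereal_sup_ubound; exists h' => //= x.
rewrite -[mindic _ _]/(\1_(~` N) : T -> R) indicE; have [Nx|Nx] := pselect (N x).
  by rewrite memNset ?mulr0//= => h; exact: h.
by rewrite mem_set// mulr1; apply: le_trans (fg x Nx).
Qed.

Lemma eq_integral_off_null (f g : T -> \bar R) (N : set T) : measurable N -> mu N = 0 ->
  (forall x, ~ N x -> f x = g x) -> \int[mu]_x f x = \int[mu]_x g x.
Proof.
move=> mN N0 fg; rewrite [LHS]integralE [RHS]integralE.
have pn (h : T -> \bar R) x : 0 <= h^\+ x by exact: funepos_ge0.
have nn (h : T -> \bar R) x : 0 <= h^\- x by exact: funeneg_ge0.
congr (_ - _); apply/eqP; rewrite eq_le; apply/andP; split;
  apply: (le_integral_off_null mN N0) => // x Nx;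
  by rewrite ?funeposE ?funenegE fg.
Qed.

End integral_off_null.

Section surely_valid.
Context (R : realType) (d K : nat) (M : model R d K).
Local Notation X := (request R K).
Variables (bl bh vh : R).
Hypotheses (blh : bl <= bh) (vh0 : 0 <= vh).
Local Notation valid_req := (@valid_req R K bl bh vh).
Hypothesis lawV : {ae law M, forall z, valid_req z}.
Context dO (Omega : measurableType dO) (P : probability Omega R).
Variables (Z : nat -> {RV P >-> X}) (T : nat).
Hypothesis iidZ : iid_requests M Z T.
Local Notation san := (@sanitize R K bl bh vh).

Let mZ' t : measurable_fun setT (fun w => san (Z t w)).
Proof. by apply: measurableT_comp; [exact: measurable_sanitize|]. Qed.

Definition sanitized (t : nat) : {RV P >-> X} := mkRV P (mZ' t).

Lemma sanitized_valid t w : valid_req (sanitized t w).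
Proof. exact: sanitizeV. Qed.

Lemma law_sanitize (B : set X) : measurable B -> law M (san @^-1` B) = law M B.
Proof.
move=> mB; have mB' : measurable (san @^-1` B).
  by rewrite -[X in measurable X]setTI; exact: (@measurable_sanitize R K bl bh vh measurableT _ mB).
case: lawV => N [mN N0 VN].
have off z : ~ N z -> san z = z.
  by move=> Nz; apply: sanitize_id; apply: contrapT => h; apply: Nz; exact: VN.
have h (D : set X) : measurable D -> law M D = law M (D `\` N).
  move=> mD; rewrite (measureDI (law M) mD mN).
  rewrite (@subset_measure0 _ _ _ (law M) (D `&` N) N)//; first by rewrite adde0.
  exact: measurableI.
rewrite (h _ mB) (h _ mB'); congr (law M _); apply/seteqP.
by split => z [/= h1 h2]; split => //=; move: h1; rewrite off.
Qed.

Lemma iid_sanitized : iid_requests M sanitized T.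
Proof.
case: iidZ => hlaw hind; split => [t B tT mB|B mB].
  rewrite -law_sanitize// -(hlaw t _ tT)//.
  by rewrite -[X in measurable X]setTI; exact: (@measurable_sanitize R K bl bh vh measurableT _ mB).
apply: (hind (fun t => san @^-1` B t)) => t.
by rewrite -[X in measurable X]setTI; exact: (@measurable_sanitize R K bl bh vh measurableT _ (mB t)).
Qed.

Lemma sanitized_off_null : exists N, [/\ measurable N, P N = 0%E &
  forall w, ~ N w -> forall t, (t < T)%N -> sanitized t w = Z t w].
Proof.
case: lawV => N [mN N0 VN]; case: iidZ => hlaw _.
pose F t := if (t < T)%N then Z t @^-1` N else set0.
have : P.-negligible (\bigcup_t F t).
  apply: negligible_bigcup => t; rewrite /F; case: ifP => tT; last exact: negligible_set0.
  exists (Z t @^-1` N); split => //.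
    have mz : measurable_fun setT (Z t) by [].
    by rewrite -[X in measurable X]setTI; exact: (mz measurableT N mN).
  by rewrite -[LHS](hlaw t N tT mN) in N0.
move=> [N' [mN' N'0 FN']]; exists N'; split => // w Nw t tT.
apply: sanitize_id; apply: contrapT => h; apply: Nw; apply: FN'; exists t => //.
by rewrite /F tT; exact: VN.
Qed.

Lemma Phi_sanitized n b : (n <= T)%N -> Phi M Z n b = Phi M sanitized n b.
Proof.
move=> nT; have [N [mN N0 off]] := sanitized_off_null.
rewrite /Phi unlock; congr fine; apply: (eq_integral_off_null mN N0) => w Nw.
congr (_%:E); apply: OPT_loc => i iT; rewrite off//; exact: leq_trans nT.
Qed.

(** SPM sees the arrivals and, through its thresholds, the functions [Phi]. The latter agree for
    both families up to [T] periods, so off a null set all capacities and decisions agree. *)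
Lemma regret_sanitized b : regret M Z T b (SPM M Z T b) = regret M sanitized T b (SPM M sanitized T b).
Proof.
have [N [mN N0 off]] := sanitized_off_null.
rewrite /regret unlock; congr (fine _ - fine _);
  apply: (eq_integral_off_null mN N0) => w Nw; congr (_%:E).
  by apply: OPT_loc => i iT; rewrite off.
have acc s x (b' : 'cV[R]_d) : (0 < s <= T)%N ->
    spm_accept M (Phi M Z) s b' x = spm_accept M (Phi M sanitized) s b' x.
  move=> /andP[s0 sT]; have sT' : (s.-1 <= T)%N by rewrite (leq_trans (leq_pred s)).
  by rewrite /spm_accept !(Phi_sanitized _ sT').
have cap t : (t <= T)%N -> spm_capacity M (Phi M Z) T b (fun i => Z i w) t =
   spm_capacity M (Phi M sanitized) T b (fun i => sanitized i w) t.
  elim: t => //= t IH tT; have aT : (0 < T - t <= T)%N by rewrite subn_gt0 tT leq_subr.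
  by rewrite (IH (ltnW tT)) -[san (Z t w)]/(sanitized t w) off// acc.
apply: eq_bigr => t _; rewrite off//; congr (_ * (_ : bool)%:R).
have aT : (0 < T - t <= T)%N by rewrite subn_gt0 ltn_ord leq_subr.
by rewrite /SPM /spm_decision cap ?(ltnW (ltn_ord t))// off// acc.
Qed.

End surely_valid.

(** * Summation of the rates and the final choice of constants *)

Section rate.
Context (R : realType).

Lemma harmonic_le (T : nat) : (0 < T)%N -> \sum_(1 <= n < T) (n%:R^-1 : R) <= ln (expR 1 * T%:R).
Proof.
move=> T0; have lnE n : (0 < n)%N -> ln (expR 1 * n%:R) = 1 + ln n%:R :> R.
  by move=> n0; rewrite lnM ?posrE ?expR_gt0 ?ltr0n// expRK.
suff h n : \sum_(1 <= m < n.+2) (m%:R^-1 : R) <= 1 + ln n.+1%:R.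
  case: T T0 => // [] [|T] _; first by rewrite big_geq// lnE// ln1 addr0.
  rewrite lnE//; apply: le_trans (h T) _; rewrite lerD2l ler_ln ?posrE ?ltr0n// ler_nat.
  by [].
elim: n => [|n IH]; first by rewrite big_nat1 invr1 ln1 addr0.
rewrite big_nat_recr//=.
have n2 : 0 < (n.+2%:R : R) by rewrite ltr0n.
have n1 : 0 < (n.+1%:R : R) by rewrite ltr0n.
have e : 1 + (- (n.+2%:R : R)^-1) = n.+1%:R / n.+2%:R.
  have gen (y : R) : 0 < y -> 1 + (- (y + 1)^-1) = y / (y + 1).
    by move=> y0; field; rewrite gt_eqF// addr_gt0.
  by rewrite -[n.+2]addn1 natrD gen.
have := @le_ln1Dx R (- n.+2%:R^-1).
rewrite e lnM ?posrE ?invr_gt0// lnV ?posrE// => h.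
have {}h : ln n.+1%:R - ln n.+2%:R <= - (n.+2%:R : R)^-1.
  by apply: h; rewrite ltrN2 invf_lt1// ltr1n.
move: h IH; move: (n.+2%:R^-1 : R) (ln n.+1%:R : R) (ln n.+2%:R : R) => v l1 l2 h IH.
lra.
Qed.

Lemma sum_rate (p : R) (T : nat) : 1 <= p -> (0 < T)%N ->
  \sum_(1 <= n < T) (n%:R : R) `^ (- (1 / 2 + rate_exp p)) <=
  T%:R `^ (1 / 2 - 1 / (2 * p)) * ln (expR 1 * T%:R).
Proof.
move=> p1 T0; have /andP[k0 k1] := rate_exp01 p1.
apply: le_trans (_ : \sum_(1 <= n < T) T%:R `^ (1 / 2 - 1 / (2 * p)) * n%:R^-1 <= _); last first.
  by rewrite -mulr_sumr; apply: ler_wpM2l; [exact: powR_ge0|exact: harmonic_le].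
rewrite !big_nat; apply: ler_sum => n /andP[n0 nT].
have nR : 0 < (n%:R : R) by rewrite ltr0n.
rewrite -(powR_inv1 (ltW nR)).
have -> : - (1 / 2 + rate_exp p) = (1 / 2 - 1 / (2 * p)) + (-1) :> R.
  by rewrite /rate_exp; field; rewrite gt_eqF//; lra.
rewrite powRD; last by rewrite (gt_eqF nR) implybT.
apply: ler_wpM2r; first exact: powR_ge0.
rewrite /rate_exp in k1; apply: ge0_ler_powR; rewrite ?nnegrE ?ler_nat 1?ltnW//.
lra.
Qed.

Lemma regret_rate_ge (p : R) (T : nat) : 1 <= p -> (0 < T)%N ->
  1 <= regret_rate p T /\
  T%:R `^ (1 / 2 - 1 / (2 * p)) * ln (expR 1 * T%:R) <= regret_rate p T.
Proof.
move=> p1 T0; have /andP[k0 k1] := rate_exp01 p1; rewrite /rate_exp in k0 k1.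
have T1 : 1 <= (T%:R : R) by rewrite ler1n.
have TR : 0 < (T%:R : R) by rewrite ltr0n.
have L1 : 1 <= ln (expR 1 * T%:R) :> R.
  by rewrite lnM ?posrE ?expR_gt0// expRK lerDl ln_ge0.
rewrite /regret_rate; set L := ln _ in L1 *.
have L0 : 0 < L by exact: lt_le_trans L1.
have tw : 1 <= (T%:R : R) `^ (1 / 2 - 1 / (2 * p)).
  rewrite -[leLHS](powRr0 T%:R); apply: ler_powR => //; lra.
case: eqP => [->|/eqP pn1].
  rewrite mulr1 subrr powRr0 mul1r; split; first exact: exprn_ege1.
  by rewrite expr2 ler_peMl// ltW.
have LL : L <= L `^ ((p + 1) / (2 * p) + 1).
  rewrite -[leLHS](powRr1 (ltW L0)); apply: ler_powR => //.
  by rewrite lerDr divr_ge0//; lra.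
split; last by apply: ler_wpM2l => //; exact: powR_ge0.
by rewrite -[leLHS]mulr1; apply: ler_pM => //; exact: le_trans LL.
Qed.

End rate.

(** The constants are fixed before any arrival process is given, whereas masses are handled through
    one. The law itself as sample space, with the identity as its single request, provides it. *)
Lemma m0_ge0 (R : realType) (d K : nat) (M : model R d K) (bl bh vh : R) :
  0 < bl -> bl <= bh -> 0 <= vh -> (forall k, 0 < type_prob M k) ->
  {ae law M, forall z, valid_req bl bh vh z} -> nonneg_vec (m0 M).
Proof.
move=> bl0 blh vh0 pi0 lawV.
pose Z (t : nat) : {RV (law M) >-> request R K} := mkRV (law M) (@measurable_id _ _ setT).
have iidZ : iid_requests M Z 1.
  split=> // B mB; rewrite big_ord1; congr (law M _); apply/seteqP; split => z /=.
    by move=> /(_ ord0); apply.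
  by move=> h t _; rewrite (ord1 t).
move=> k; rewrite mxE.
exact: (mass_ge0 bl0 blh (iid_sanitized lawV iidZ) (sanitized_valid blh vh0 Z) (ltn0Sn 0) pi0 k (meas_ge 0)).
Qed.

Lemma exists_large (R : realType) (x y z a k : R) : 0 < z -> 0 < k -> 0 < y -> 0 <= a ->
  exists s0 : nat, (0 < s0)%N /\ forall n : nat, (s0 <= n)%N ->
    x <= n%:R * y /\ a * n%:R `^ (- k) <= z.
Proof.
move=> z0 k0 y0 a0; pose s0 := (Num.truncn (Num.max (x / y) ((a / z) `^ k^-1))).+1.
exists s0; split => // n sn.
have : Num.max (x / y) ((a / z) `^ k^-1) <= n%:R.
  by apply: le_trans (ltW (truncnS_gt _)) _; rewrite ler_nat.
rewrite ge_max => /andP[h1 h2]; split; first by rewrite -ler_pdivrMr.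
have nR : 0 < (n%:R : R) by rewrite ltr0n (leq_trans _ sn).
have nk : 0 < (n%:R : R) `^ k by exact: powR_gt0.
rewrite powRN ler_pdivrMr// -ler_pdivrMl// mulrC.
have az : 0 <= a / z by rewrite divr_ge0// ltW.
rewrite -[leLHS](powRr1 az) -[X in _ `^ X <= _](mulVf (lt0r_neq0 k0)) powRrM.
by apply: ge0_ler_powR; rewrite ?nnegrE ?powR_ge0// ltW.
Qed.

(* [delta] is the margin of rho_0 = b_T / T inside R0. *)
Theorem theoremB7 (R : realType) (d K : nat) (M : model R d K)
  (kap : 'I_K.+1 -> R.-pker R ~> R)
  (R0 Rs : set 'cV[R]_d) (p eta : R) (U : 'I_K.+1 -> set R) (c C : R)
  (delta : R) :
  valid_model M ->
  is_cond_ratio_law M kap ->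
  compact R0 -> compact Rs -> R0 `<=` interior Rs ->
  (forall rho, Rs rho -> nonneg_vec rho) ->
  active_regular M Rs p eta U c C ->
  fluid_nondegenerate M Rs U kap ->
  0 < delta ->
  exists Creg : R,
    forall (T : nat) (b : 'cV[R]_d)
      (disp : measure_display) (Omega : measurableType disp)
      (P : probability Omega R) (Z : nat -> {RV P >-> request R K}),
      (0 < T)%N ->
      nonneg_vec b ->
      ball (T%:R^-1 *: b) delta `<=` R0 ->
      iid_requests M Z T ->
      regret M Z T b (SPM M Z T b) <= Creg * regret_rate p T.
Proof.
move=> vM _ _ _ R0Rs Rs0 reg nd dl0.
case: (vM) => [[A0 Aex _] pi0 slo0 aeV suppK].
(* A positive number below every [size_lo M k]. *)
pose bl := (\sum_k (size_lo M k)^-1)^-1.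
have slo_inv k : (size_lo M k)^-1 <= \sum_k (size_lo M k)^-1.
  rewrite (bigD1 k)//= lerDl; apply: sumr_ge0 => i _; rewrite invr_ge0 ltW//.
have bl0 : 0 < bl.
  by rewrite invr_gt0; apply: lt_le_trans (slo_inv ord0); rewrite invr_gt0.
have bl_lo k : bl <= size_lo M k.
  by rewrite -[leRHS]invrK lef_pV2 ?posrE ?invr_gt0// -invr_gt0.
pose bh := bl + \sum_k `|size_hi M k|.
have blh : bl <= bh by rewrite lerDl; apply: sumr_ge0.
have hi_bh k : size_hi M k <= bh.
  apply: le_trans (ler_norm _) _; rewrite /bh (bigD1 k)//= addrCA lerDl addr_ge0 ?(ltW bl0)//.
  exact: sumr_ge0.
pose vh := Num.max 0 (reward_hi M); have vh0 : 0 <= vh by rewrite le_max lexx.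
have lawV : {ae law M, forall z, valid_req bl bh vh z}.
  apply: filterS aeV => z [/andP[s1 s2] /andP[v1 v2]]; split; apply/andP; split => //.
  - exact: le_trans s1.
  - exact: le_trans s2 _.
  - by rewrite le_max v2 orbT.
have m00 := m0_ge0 bl0 blh vh0 pi0 lawV.
have [e1 e10 pairs] := fluid_margin vM Rs0 reg nd m00.
case: (reg) => p1 _ _ _ [/andP[c0 cC] _].
have Cge0 : 0 <= C by apply: le_trans cC; exact: ltW.
pose ah := 1 + \sum_j \sum_k direction M j k.
have sA j k : direction M j k <= \sum_j \sum_k direction M j k.
  rewrite (bigD1 j)//= (bigD1 k)//= -addrA lerDl addr_ge0//; first exact: sumr_ge0.
  by apply: sumr_ge0 => i _; exact: sumr_ge0.
have ah0 : 0 < ah.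
  by rewrite ltr_pwDl//; apply: sumr_ge0 => i _; exact: sumr_ge0.
have Aah j k : direction M j k <= ah by apply: le_trans (sA j k) _; rewrite lerDr.
pose rmax := \sum_j \sum_k direction M j k * m0 M k 0.
pose rmin := delta / 4; have rmin0 : 0 < rmin by rewrite divr_gt0.
have d0 : (0 < d)%N by have [j _] := Aex ord0; exact: leq_trans (ltn_ord j).
(* The constants need a right inverse of A, hence some ball inside [R0]; without one no instance
   satisfies the assumption on [b]. *)
have [[x0 bx0]|noball] := pselect (exists x0 : 'cV[R]_d, ball x0 delta `<=` R0); last first.
  by exists 0 => T b disp Omega P Z _ _ bR0; case: noball; exists (T%:R^-1 *: b).
have R0s : R0 `<=` Rs by move=> x /R0Rs; exact: interior_subset.
have [Bm ABm] := right_inverse nd dl0 (subset_trans bx0 R0s).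
have Dm0 := C_widen_ge0 bl bh vh e1 c C Bm p1 ah rmin rmax (ymax M).
have dl8 : 0 < delta / 8 by rewrite divr_gt0.
have /andP[kp0 _] := rate_exp01 p1.
have [s0 [s0_gt0 s0_big]] := exists_large ((bh + 1) * ah) dl8 kp0 rmin0 Dm0.
pose Csum := C_sum bl bh vh e1 c C p Bm ah rmin rmax (ymax M) delta.
exists (s0%:R * vh + Csum) => T b disp Omega P Z T0 b0 bR0 iidZ.
pose rho0 := T%:R^-1 *: b.
have box (rho : 'cV[R]_d) : (forall j, `|rho j 0 - rho0 j 0| <= delta / 2) ->
  (forall j, rmin <= rho j 0 <= rmax) /\
  exists q u, [/\ fluid_pair M rho q u, forall k, 0 <= q k 0 - e1, forall k, q k 0 <= ymax M &
    forall k b1 b2 x y, q k 0 - e1 <= x -> x <= y -> y <= q k 0 + e1 ->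
        c * (y - x) `^ p <= mu_ratio M k [set` Interval (BSide b1 x) (BSide b2 y)]
          <= C * (y - x)].
  move=> near0.
  have inRs (x : 'cV[R]_d) : (forall j, `|x j 0 - rho0 j 0| < delta) -> Rs x.
    move=> h; apply/R0s/bR0; split => // i l; rewrite (ord1 l) /ball /= distrC; exact: h.
  have Rrho : Rs rho by apply: inRs => j; apply: le_lt_trans (near0 j) _; lra.
  have [q [u [fp hq]]] := pairs rho Rrho.
  have [qclip _ [u0 um _] _ Au] := fp.
  split=> [j|]; last first.
    exists q, u; split => // k; first by case: (hq k).
      rewrite -(qclip k) /clip; have [_ [_ ry]] := suppK k.
      by apply: le_trans ry; rewrite ge_min lexx.
    by case: (hq k).
  apply/andP; split.
    (* Lowering all coordinates by [delta / 4] stays within [delta] of [rho0], hence in [Rs], whose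
       points are nonnegative. *)
    have /(_ j) : nonneg_vec (rho - const_mx (delta / 4)).
      apply: Rs0; apply: inRs => i; rewrite !mxE.
      have := near0 i; rewrite !mxE => h.
      have -> : rho i 0 - delta / 4 - T%:R^-1 * b i 0 = (rho i 0 - T%:R^-1 * b i 0) - delta / 4 by ring.
      apply: le_lt_trans (ler_normB _ _) _; rewrite [`|delta / 4|]ger0_norm; lra.
    by rewrite !mxE subr_ge0.
  (* The upper bound comes from [rho = A *m u] and [u <= m0]. *)
  rewrite -Au mxE; apply: le_trans (_ : \sum_k direction M j k * m0 M k 0 <= _).
    by apply: ler_sum => k _; apply: ler_wpM2l.
  rewrite /rmax (bigD1 j)//= lerDl; apply: sumr_ge0 => i _; apply: sumr_ge0 => k _.
  exact: mulr_ge0.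
have iidZ' := iid_sanitized lawV iidZ.
rewrite (regret_sanitized lawV iidZ) regretE.
have := loss_to_go_bound bl0 A0 blh vh0 e10 c0 p1 ABm Cge0 iidZ' (sanitized_valid blh vh0 Z) T0 pi0
  ah0 rmin0 Aah dl0 d0 box s0_gt0 s0_big b0 erefl.
move=> h; apply: le_trans h _.
(* The constant term is charged to the rate because the rate is at least 1. *)
have [r1 r2] := regret_rate_ge p1 T0.
rewrite [leRHS]mulrDl; apply: lerD; first by rewrite ler_peMr// mulr_ge0.
apply: ler_wpM2l; last exact: le_trans (sum_rate p1 T0) r2.
exact: C_sum_ge0.
Qed.
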